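(* Let $P(x_1,x_2)=\sum_{k_1,k_2\ge 0} b_{k_1,k_2}x_1^{k_1}x_2^{k_2}$ be a complex polynomial, and let $x_1,x_2\in\mathbb{C}$ with $\max\{|x_1|,|x_2|\}<1$. Assume that $g_\Theta\in\mathcal{F}(r,\vartheta,K)$. Then, as $N\to\infty$, $$\mathbb{E}_\Theta[W^N(P)(x_1,x_2)] = N^{\vartheta(b_{0,0}-1)}\,e^{K(b_{0,0}-1)}\left(E_1+O\left(\frac1N\right)\right),$$ where $$E_1=E_1(x_1,x_2)=\frac{\Gamma(\vartheta)}{\Gamma(\vartheta b_{0,0})}\prod_{(k_1,k_2)\neq(0,0)}\bigl(G_\Theta(r x_1^{k_1}x_2^{k_2})\bigr)^{b_{k_1,k_2}}.$$
   Context: $\mathfrak{S}_N$ is the symmetric group on $N$ objects; for $\sigma\in\mathfrak{S}_N$, $C_k(\sigma)$ is the number of cycles of $\sigma$ of length $k$. Let $\Theta=(\theta_k)_{k\ge1}$ be a sequence of strictly positive reals. The generalized Ewens measure on $\mathfrak{S}_N$ is $\mathbb{P}_\Theta[\sigma]=\frac{1}{h_N N!}\prod_{k=1}^N\theta_k^{C_k(\sigma)}$, with $h_N$ the normalization constant ($h_0:=1$); $\mathbb{E}_\Theta$ is its expectation. Put $g_\Theta(t)=\sum_{k\ge1}\frac{\theta_k}{k}t^k$ and $G_\Theta(t)=\exp(g_\Theta(t))$; for $b\in\mathbb{C}$, $G_\Theta(t)^b:=\exp(b\,g_\Theta(t))$. For a polynomial $P(x_1,x_2)$ and $\sigma\in\mathfrak{S}_N$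 with cycle lengths $\lambda_1,\dots,\lambda_\ell$ (counted with multiplicity), $W^N(P)(x_1,x_2)=W^N(P)(x_1,x_2)(\sigma):=\prod_{m=1}^{\ell}P(x_1^{\lambda_m},x_2^{\lambda_m})$. For $R>r>0$ and $0<\phi<\pi/2$ let $\Delta_0(r,R,\phi)=\{z\in\mathbb{C}: |z|<R,\ z\ne r,\ |\arg(z-r)|>\phi\}$. For $r>0$, $\vartheta\ge0$ and a complex constant $K$, a function $g$ is in $\mathcal{F}(r,\vartheta,K)$ if there exist $R>r$ and $0<\phi<\pi/2$ such that $g$ is holomorphic in $\Delta_0(r,R,\phi)$ and $g(t)=\vartheta\log\left(\frac{1}{1-t/r}\right)+K+O(t-r)$ as $t\to r$ with $t\in\Delta_0(r,R,\phi)$. Here $1/\Gamma$ is the entire reciprocal Gamma function. The constant in $O(\cdot)$ may depend on $P,x_1,x_2,\Theta$.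
   Formalization: The formal statement assumes ϑ > 0, where the class F(r,ϑ,K) allows ϑ = 0: there E_1 contains the undefined Γ(0)/Γ(0), and for entire g_Θ the claim fails under any convention, since r would be arbitrary. *)

(* Defs.v *)
From mathcomp Require Import all_boot all_order all_algebra all_fingroup.
From mathcomp Require Import all_classical all_reals all_analysis.
From mathcomp Require Import complex.
Import Order.TTheory GRing.Theory Num.Theory.
Import numFieldNormedType.Exports.

Set Implicit Arguments.
Unset Strict Implicit.
Unset Printing Implicit Defensive.

Local Open Scope classical_set_scope.
Local Open Scope ring_scope.

(** * Complex numbers *)

(* The field R[i], packaged as a [numClosedFieldType] so that it inherits the
   norm topology that MathComp-Analysis puts on every [numFieldType]. The
   carrier is convertible to R[i]; the algebraic structure is locked, since
   unification otherwise unfolds the construction of R[i] without end. *)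
Definition C (R : realType) : numClosedFieldType :=
  Num.ClosedField.Pack (locked (Num.ClosedField.class (R[i] : numClosedFieldType))).
Arguments C : simpl never.

Lemma C_complexE (R : realType) : C R = R[i] :> numClosedFieldType.
Proof. by rewrite /C -lock; case: (R[i] : numClosedFieldType). Qed.

Section ComplexFunctions.
Variable R : realType.

Definition mkC (x y : R) : C R := Complex x y.
Definition toC (x : R) : C R := mkC x 0.
Definition cRe (z : C R) : R := complex.Re z.
Definition cIm (z : C R) : R := complex.Im z.

(* [`|z|] is a nonnegative real element of [C R]; this is the same number
   seen in [R]. *)
Definition cmod (z : C R) : R := cRe `|z|.

Definition cexp (z : C R) : C R :=
  toC (expR (cRe z)) * mkC (cos (cIm z)) (sin (cIm z)).

(* Principal argument, with values in (-pi, pi] for z <> 0. *)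
Definition carg (z : C R) : R :=
  let a := acos (cRe z / cmod z) in if 0 <= cIm z then a else - a.

(* Principal branch of the logarithm, for z <> 0. *)
Definition clog (z : C R) : C R := mkC (ln (cmod z)) (carg z).

(* x ^ z for a real base x > 0 and a complex exponent z. *)
Definition cpow (x : R) (z : C R) : C R := cexp (z * toC (ln x)).

(* The entire function 1 / Gamma, by the Euler-Gauss limit
   1 / Gamma(z) = lim_n z (z + 1) ... (z + n) / (n! n^z). *)
Definition rgamma (z : C R) : C R :=
  lim ((fun n : nat =>
    (\prod_(j < n.+1) (z + j%:R)) / (n`!%:R * cpow n%:R z)) @ \oo).

(* Only meaningful away from the poles 0, -1, -2, ... *)
Definition cgamma (z : C R) : C R := (rgamma z)^-1.

(* The increments are complex, so [derivable] is complex differentiability. *)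
Definition holomorphic_on (D : set (C R)) (f : C R -> C R) : Prop :=
  forall z, D z -> derivable f z 1.

End ComplexFunctions.

(** * Generalized Ewens measures *)

Section Ewens.
Variable R : realType.
(* The parameters are [theta k] for k >= 1; [theta 0] is never used. *)
Variable theta : nat -> R.

(* Fixed points are cycles of length 1: [porbits s] is the set of all orbits
   of s, singletons included. *)
Definition cycle_count (N : nat) (s : 'S_N) (k : nat) : nat :=
  #|[set c in porbits s | #|c| == k]|.

Definition ewens_weight (N : nat) (s : 'S_N) : R :=
  \prod_(1 <= k < N.+1) theta k ^+ cycle_count s k.

Definition ewens_h (N : nat) : R :=
  (\sum_(s : 'S_N) ewens_weight s) / N`!%:R.

Definition ewens_prob (N : nat) (s : 'S_N) : R :=
  ewens_weight s / (ewens_h N * N`!%:R).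

Definition ewens_expect (N : nat) (X : 'S_N -> C R) : C R :=
  \sum_(s : 'S_N) toC (ewens_prob s) * X s.

Definition g_partial (t : C R) (n : nat) : C R :=
  \sum_(1 <= k < n.+1) toC (theta k / k%:R) * t ^+ k.

(* Sum of the series, meaningful where it converges. *)
Definition g_Theta (t : C R) : C R := lim (g_partial t @ \oo).

Definition G_Theta_pow (t b : C R) : C R := cexp (b * g_Theta t).

End Ewens.

(** * Singularity class *)

Section SingularityClass.
Variable R : realType.

Definition Delta0 (r rho phi : R) : set (C R) :=
  [set z | [/\ cmod z < rho, z != toC r & `|carg (z - toC r)| > phi]].

Definition in_F (r vartheta : R) (K : C R) (g : C R -> C R) : Prop :=
  exists rho phi : R,
    [/\ r < rho, 0 < phi < pi / 2%:R,
        holomorphic_on (Delta0 r rho phi) g &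
        (fun t : C R =>
           g t - (toC vartheta * clog (1 / (1 - t / toC r)) + K))
          =O_ (within (Delta0 r rho phi) (nbhs (toC r)))
        (fun t : C R => t - toC r)].

(* The power series g_Theta, extended analytically from a neighbourhood of 0
   to some domain [Delta0] (which is connected and contains the disc |z| < r),
   belongs to the class F(r, vartheta, K). *)
Definition g_Theta_in_F (theta : nat -> R) (r vartheta : R) (K : C R) : Prop :=
  exists g : C R -> C R,
    (\forall t \near (0 : C R), g_partial theta t @ \oo --> g t) /\
    in_F r vartheta K g.

End SingularityClass.

(** * The polynomial and its cycle statistic *)

Section CycleProduct.
Variable R : realType.

(* P : {poly {poly C R}} stands for P(x1, x2), where x1 is the outer and x2
   the inner variable. *)
Definition bicoef (P : {poly {poly C R}}) (k1 k2 : nat) : C R := P`_k1`_k2.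

Definition bieval (P : {poly {poly C R}}) (x1 x2 : C R) : C R :=
  P.[x1%:P].[x2].

Definition W (P : {poly {poly C R}}) (x1 x2 : C R) (N : nat) (s : 'S_N) : C R :=
  \prod_(c in porbits s) bieval P (x1 ^+ #|c|) (x2 ^+ #|c|).

(* The factors omitted from the product have [bicoef P k1 k2 = 0], hence are
   equal to 1. *)
Definition E1 (theta : nat -> R) (r vartheta : R)
    (P : {poly {poly C R}}) (x1 x2 : C R) : C R :=
  cgamma (toC vartheta) * rgamma (toC vartheta * bicoef P 0 0) *
  \prod_(k1 < size P) \prod_(k2 < size P`_k1 | (k1 : nat, k2 : nat) != (0, 0)%N)
    G_Theta_pow theta (toC r * x1 ^+ k1 * x2 ^+ k2) (bicoef P k1 k2).

End CycleProduct.

(* Main.v *)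
Require Import Defs.
From mathcomp Require Import all_boot all_order all_algebra all_fingroup.
From mathcomp Require Import all_classical all_reals all_analysis.
From mathcomp Require Import complex ring lra.
Import Order.TTheory GRing.Theory Num.Theory numFieldNormedType.Exports.
Local Open Scope classical_set_scope.
Local Open Scope ring_scope.

Set Implicit Arguments.
Unset Strict Implicit.
Unset Printing Implicit Defensive.

(** The sums over permutations of weights that are multiplicative in the cycles
satisfy the recurrence [n q_n = sum_(1 <= k <= n) a_k q_(n-k)] of the coefficients
of [exp (sum_k (a_k / k) t^k)] ([cycle_sum_rec]). Hence the expectation is the
quotient of the [N]-th coefficients of [exp (sum_k theta_k P(x1^k, x2^k) t^k / k)]
and of [G_Theta]. Expanding [P], the first function is [G_Theta(t)^b00] times the
product of the [G_Theta(t x1^k1 x2^k2)^b_(k1,k2)] over [(k1, k2) <> (0, 0)]. As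
[|x1|, |x2| < 1], this product is analytic beyond the circle [|t| = r], and both
coefficients are given by one result on [exp (b g + D)], with [g] logarithmically
singular at [r] and [D] analytic there ([exp_log_asymp]). Up to
[O(|1 - t/r|^(1 - Re (b vartheta)))] that function is
[exp (b K + D(r)) (1 - t/r)^(- b vartheta)], whose coefficients are explicit and are
compared to [1 / Gamma] in [negbin_asymp]; the remainder contributes the relative
error [O(1/N)] by the transfer theorem of singularity analysis ([transfer]). In the
quotient the powers of [r] cancel and [1 / Gamma(vartheta) <> 0] ([rgamma_neq0]).

The function theory is developed with means over the [2^N]-th roots of [-1] in
place of integrals. Midpoint sums over the boundary of a rectangle telescope
exactly under bisection and vanish on affine functions, so Goursat's argument shows
that they tend to [0] for a function that is merely differentiable ([goursat]).
Through the exponential map, the means of an analytic function over concentric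
circles have the same behaviour in the limit ([cavg_const]). This yields Cauchy's
estimate, and Cauchy's formula for the coefficients of a function that is only
known to be the sum of its series near [0] ([coef_cavg]).

The transfer theorem, that [f = O(|1 - z|^alpha)] in the indented disc implies
[a_n = O(n^(- alpha - 1))], is proved on circles inside the unit disc instead of a
Hankel contour. If [alpha <= -2], the mean of [|1 - z|^alpha] over the circle of
radius [n / (n + 1)] is bounded through Parseval's identity for a geometric sum
([sum_pole_le]). In general [f] is first replaced by the [m]-th difference
[sum_j (-1)^j binom(m, j) f(exp (- j s) z)] with [s] of order [1/n]: this multiplies
[a_n] by a constant, and by Cauchy's estimate it is
[O(n^-m |1 - z|^(alpha - m))]. *)

(** * Complex numbers *)

Section Toolkit.
Variable R : realType.
Implicit Types (x y : R) (z w : C R).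

Lemma mkCD x y x' y' : mkC x y + mkC x' y' = mkC (x + x') (y + y').
Proof. by rewrite /mkC /C -lock. Qed.

Lemma mkCM x y x' y' :
  mkC x y * mkC x' y' = mkC (x * x' - y * y') (x * y' + y * x').
Proof. by rewrite /mkC /C -lock. Qed.

Lemma mkCN x y : - mkC x y = mkC (- x) (- y).
Proof. by rewrite /mkC /C -lock. Qed.

Lemma toC0 : toC 0 = 0 :> C R.
Proof. by rewrite /toC /mkC /C -lock. Qed.

Lemma toC1 : toC 1 = 1 :> C R.
Proof. by rewrite /toC /mkC /C -lock. Qed.

Lemma norm_mkC x y : `|mkC x y| = toC (Num.sqrt (x ^+ 2 + y ^+ 2)).
Proof. by rewrite /toC /mkC /C -lock. Qed.

Lemma le_toC x y : (toC x <= toC y) = (x <= y).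
Proof. by rewrite /toC /mkC /C -lock /Order.le /= eqxx. Qed.

Lemma mkCE z : z = mkC (cRe z) (cIm z).
Proof. by case: z. Qed.

Lemma toCD x y : toC (x + y) = toC x + toC y.
Proof. by rewrite /toC mkCD addr0. Qed.

Lemma toCN x : toC (- x) = - toC x.
Proof. by rewrite /toC mkCN oppr0. Qed.

Lemma toCB x y : toC (x - y) = toC x - toC y.
Proof. by rewrite toCD toCN. Qed.

Lemma toCM x y : toC (x * y) = toC x * toC y.
Proof. by rewrite /toC mkCM mulr0 mul0r subr0 mulr0 addr0. Qed.

Lemma toCX x n : toC (x ^+ n) = toC x ^+ n.
Proof. by elim: n => [|n IH]; rewrite ?expr0 ?toC1 // !exprS toCM IH. Qed.

Lemma toC_nat n : toC n%:R = n%:R :> C R.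
Proof. by elim: n => [|n IH]; rewrite ?toC0 // !mulrSr toCD IH toC1. Qed.

Lemma toC_inj : injective (@toC R).
Proof. by move=> x y /(congr1 (@cRe R)). Qed.

Lemma toCV x : toC x^-1 = (toC x)^-1.
Proof.
have [->|x0] := eqVneq x 0; first by rewrite invr0 toC0 invr0.
have x0' : toC x != 0 by rewrite -toC0 (inj_eq toC_inj).
by apply: (mulfI x0'); rewrite -toCM !divff // toC1.
Qed.

Lemma toC_sum I (s : seq I) (P : pred I) (F : I -> R) :
  toC (\sum_(i <- s | P i) F i) = \sum_(i <- s | P i) toC (F i).
Proof. by apply: (big_morph _ toCD toC0). Qed.

Lemma toC_prod I (s : seq I) (P : pred I) (F : I -> R) :
  toC (\prod_(i <- s | P i) F i) = \prod_(i <- s | P i) toC (F i).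
Proof. by apply: (big_morph _ toCM toC1). Qed.

Lemma normE z : `|z| = toC (cmod z).
Proof. by rewrite /cmod (mkCE z) norm_mkC. Qed.

Lemma cmodE z : cmod z = Num.sqrt (cRe z ^+ 2 + cIm z ^+ 2).
Proof. by rewrite /cmod {1}(mkCE z) norm_mkC. Qed.

Lemma cmod_ge0 z : 0 <= cmod z.
Proof. by rewrite cmodE sqrtr_ge0. Qed.

Lemma sqr_cmod z : cmod z ^+ 2 = cRe z ^+ 2 + cIm z ^+ 2.
Proof. by rewrite cmodE sqr_sqrtr // addr_ge0 // sqr_ge0. Qed.

Lemma cmodM z w : cmod (z * w) = cmod z * cmod w.
Proof. by apply: toC_inj; rewrite toCM -!normE normrM. Qed.

Lemma cmodD z w : cmod (z + w) <= cmod z + cmod w.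
Proof. by rewrite -le_toC toCD -!normE ler_normD. Qed.

Lemma cmodN z : cmod (- z) = cmod z.
Proof. by apply: toC_inj; rewrite -!normE normrN. Qed.

Lemma cmodB z w : cmod (z - w) <= cmod z + cmod w.
Proof. by rewrite -[cmod w]cmodN cmodD. Qed.

Lemma cmod_distC z w : cmod (z - w) = cmod (w - z).
Proof. by rewrite -cmodN opprB. Qed.

Lemma cmod0 : cmod (0 : C R) = 0.
Proof. by apply: toC_inj; rewrite -normE normr0 toC0. Qed.

Lemma cmod1 : cmod (1 : C R) = 1.
Proof. by apply: toC_inj; rewrite -normE normr1 toC1. Qed.

Lemma cmod_eq0 z : (cmod z == 0) = (z == 0).
Proof. by rewrite -(inj_eq toC_inj) toC0 -normE normr_eq0. Qed.

Lemma cmod_gt0 z : (0 < cmod z) = (z != 0).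
Proof. by rewrite lt_def cmod_ge0 andbT cmod_eq0. Qed.

Lemma cmodX z n : cmod (z ^+ n) = cmod z ^+ n.
Proof. by elim: n => [|n IH]; rewrite ?expr0 ?cmod1 // !exprS cmodM IH. Qed.

Lemma cmodV z : cmod z^-1 = (cmod z)^-1.
Proof. by apply: toC_inj; rewrite toCV -!normE normfV. Qed.

Lemma cmod_toC x : cmod (toC x) = `|x|.
Proof. by rewrite cmodE /= expr0n addr0 sqrtr_sqr. Qed.

Lemma cmod_toC_ge0 x : 0 <= x -> cmod (toC x) = x.
Proof. by move=> x0; rewrite cmod_toC ger0_norm. Qed.

Lemma cmod_nat n : cmod (n%:R : C R) = n%:R.
Proof. by rewrite -toC_nat cmod_toC normr_nat. Qed.

Lemma cmod_sum I (s : seq I) (P : pred I) (F : I -> C R) :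
  cmod (\sum_(i <- s | P i) F i) <= \sum_(i <- s | P i) cmod (F i).
Proof.
elim/big_rec2: _ => [|i y1 y2 _ h]; first by rewrite cmod0.
by rewrite (le_trans (cmodD _ _)) // lerD2l.
Qed.

Lemma cRe_le z : `|cRe z| <= cmod z.
Proof.
by rewrite cmodE -sqrtr_sqr ler_wsqrtr // lerDl sqr_ge0.
Qed.

Lemma cIm_le z : `|cIm z| <= cmod z.
Proof.
by rewrite cmodE -sqrtr_sqr ler_wsqrtr // lerDr sqr_ge0.
Qed.

Lemma cReD z w : cRe (z + w) = cRe z + cRe w.
Proof. by rewrite {1}(mkCE z) {1}(mkCE w) mkCD. Qed.
Lemma cImD z w : cIm (z + w) = cIm z + cIm w.
Proof. by rewrite {1}(mkCE z) {1}(mkCE w) mkCD. Qed.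
Lemma cReN z : cRe (- z) = - cRe z.
Proof. by rewrite {1}(mkCE z) mkCN. Qed.
Lemma cImN z : cIm (- z) = - cIm z.
Proof. by rewrite {1}(mkCE z) mkCN. Qed.
Lemma cReB z w : cRe (z - w) = cRe z - cRe w.
Proof. by rewrite cReD cReN. Qed.
Lemma cImB z w : cIm (z - w) = cIm z - cIm w.
Proof. by rewrite cImD cImN. Qed.
Lemma cReM z w : cRe (z * w) = cRe z * cRe w - cIm z * cIm w.
Proof. by rewrite {1}(mkCE z) {1}(mkCE w) mkCM. Qed.
Lemma cImM z w : cIm (z * w) = cRe z * cIm w + cIm z * cRe w.
Proof. by rewrite {1}(mkCE z) {1}(mkCE w) mkCM. Qed.

Lemma cmod_mkC x y : cmod (mkC x y) <= `|x| + `|y|.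
Proof.
have -> : mkC x y = toC x + mkC 0 y by rewrite /toC mkCD add0r addr0.
rewrite (le_trans (cmodD _ _)) // cmod_toC lerD2l cmodE /= expr0n add0r.
by rewrite sqrtr_sqr.
Qed.

Lemma cmodB_ge z w : cmod z - cmod w <= cmod (z - w).
Proof. by rewrite lerBlDr (le_trans _ (cmodD _ _)) // subrK. Qed.

(** ** Limits and derivatives *)

(** Convergence and complex differentiability with real error bounds, so that
    estimates are inequalities in [R]. *)
Definition cconv (u : nat -> C R) (l : C R) :=
  forall e : R, 0 < e -> exists N, forall n, (N <= n)%N -> cmod (u n - l) <= e.

Definition cderiv (f : C R -> C R) (z l : C R) :=
  forall e : R, 0 < e -> exists2 d : R, 0 < d &
    forall h, cmod h < d -> cmod (f (z + h) - f z - l * h) <= e * cmod h.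

End Toolkit.

Section LimitsDerivatives.
Variable R : realType.
Implicit Types (x y : R) (z w : C R) (f g : C R -> C R).

Lemma lt_toC x y : (toC x < toC y) = (x < y).
Proof. by rewrite !lt_def le_toC (inj_eq (@toC_inj R)). Qed.

Lemma gt0_toC z : 0 < z -> exists2 e : R, 0 < e & z = toC e.
Proof.
move=> z0; exists (cmod z); first by rewrite cmod_gt0 gt_eqF.
by rewrite -normE gtr0_norm.
Qed.

Lemma cconvP (u : nat -> C R) l : (u @ \oo --> l) <-> cconv u l.
Proof.
split=> [/cvgrPdist_le h e e0|h].
  have e0' : 0 < toC e by rewrite -toC0 lt_toC.
  have [N _ hN] := h _ e0'.
  by exists N => n /hN /=; rewrite normE le_toC cmod_distC.
apply/cvgrPdist_le => e /gt0_toC[d d0 ->].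
have [N hN] := h _ d0; exists N => // n /= /hN.
by rewrite normE le_toC cmod_distC.
Qed.

Lemma cconv_lim (u : nat -> C R) l : cconv u l -> lim (u @ \oo) = l.
Proof. by move=> /cconvP; apply: cvg_lim; exact: norm_hausdorff. Qed.

Lemma nbhs_cmodP z (A : set (C R)) :
  nbhs z A <-> exists2 d : R, 0 < d & forall w, cmod (w - z) < d -> A w.
Proof.
split=> [/nbhs_ballP[e /= /gt0_toC[d d0 ->]] h|[d d0 h]].
  by exists d => // w wz; apply: h; rewrite -ball_normE /= normE lt_toC cmod_distC.
apply/nbhs_ballP; exists (toC d) => /=; first by rewrite -toC0 lt_toC.
by move=> w; rewrite -ball_normE /= normE lt_toC cmod_distC => /h.
Qed.

Lemma derivable_cderiv f z : derivable f z 1 -> exists l, cderiv f z l.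
Proof.
move=> /cvg_ex[l /cvgrPdist_le h]; exists l => e e0.
have e0' : 0 < toC e by rewrite -toC0 lt_toC.
have := h _ e0'; rewrite near_withinE => /nbhs_cmodP[d d0 hd].
exists d => // u ud; have [->|u0] := eqVneq u 0.
  by rewrite addr0 subrr mulr0 subr0 cmod0 mulr0.
have := hd u; rewrite subr0 => /(_ ud u0) /=.
rewrite normE le_toC (_ : u *: _ = u); last exact: mulr1.
rewrite (addrC u z) => H.
have -> : f (z + u) - f z - l * u = - (u * (l - u^-1 * (f (z + u) - f z))).
  by field.
by rewrite cmodN cmodM mulrC ler_pM2r // cmod_gt0.
Qed.

Lemma cderiv_lip f z l : cderiv f z l ->
  exists2 d : R, 0 < d &
    forall h, cmod h < d -> cmod (f (z + h) - f z) <= (cmod l + 1) * cmod h.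
Proof.
move=> /(_ 1 ltr01)[d d0 hd]; exists d => // h /hd H.
rewrite -[f (z + h) - f z](subrK (l * h)) (le_trans (cmodD _ _)) //.
by rewrite cmodM mulrDl addrC lerD2l.
Qed.

Lemma cderiv_cont f z l : cderiv f z l -> forall e : R, 0 < e ->
  exists2 d : R, 0 < d & forall h, cmod h < d -> cmod (f (z + h) - f z) <= e.
Proof.
move=> /cderiv_lip[d d0 hd] e e0.
have l0 : 0 < cmod l + 1 by rewrite ltr_wpDl ?cmod_ge0.
exists (Num.min d (e / (cmod l + 1))); first by rewrite lt_min d0 divr_gt0.
move=> h; rewrite lt_min => /andP[/hd H h2].
by rewrite (le_trans H) // mulrC -ler_pdivlMr // ltW.
Qed.

Lemma cderiv_eq f z l l' : cderiv f z l -> l = l' -> cderiv f z l'.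
Proof. by move=> h <-. Qed.

Lemma cderiv_ext f g z l (d : R) : 0 < d ->
  (forall w, cmod (w - z) < d -> f w = g w) -> cderiv f z l -> cderiv g z l.
Proof.
move=> d0 fg h e /h[d' d0' hd']; exists (Num.min d d').
  by rewrite lt_min d0.
move=> u; rewrite lt_min => /andP[u1 u2].
rewrite -(fg z) ?subrr ?cmod0 // -(fg (z + u)) ?hd' //.
by rewrite (addrC z) addrK.
Qed.

Lemma cderiv_cst (c : C R) z : cderiv (fun=> c) z 0.
Proof.
move=> e e0; exists 1 => // h _; rewrite mul0r subrr subr0 cmod0.
by rewrite mulr_ge0 ?cmod_ge0 // ltW.
Qed.

Lemma cderiv_id z : cderiv id z 1.
Proof.
move=> e e0; exists 1 => // h _.
rewrite /= mul1r (addrC z) addrK subrr cmod0.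
by rewrite mulr_ge0 ?cmod_ge0 // ltW.
Qed.

Lemma cderivD f g z l m :
  cderiv f z l -> cderiv g z m -> cderiv (fun w => f w + g w) z (l + m).
Proof.
move=> hf hg e e0; have e2 : 0 < e / 2 by rewrite divr_gt0.
have [d d0 hd] := hf _ e2; have [d' d0' hd'] := hg _ e2.
exists (Num.min d d'); first by rewrite lt_min d0.
move=> h; rewrite lt_min => /andP[/hd H1 /hd' H2].
have -> : f (z + h) + g (z + h) - (f z + g z) - (l + m) * h =
  (f (z + h) - f z - l * h) + (g (z + h) - g z - m * h) by ring.
by rewrite (le_trans (cmodD _ _)) // (le_trans (lerD H1 H2)) // -mulrDl -splitr.
Qed.

Lemma cderiv_comp f g z l m :
  cderiv f z l -> cderiv g (f z) m -> cderiv (fun w => g (f w)) z (m * l).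
Proof.
move=> hf hg e e0.
have [d1 d10 lip] := cderiv_lip hf.
have L0 : 0 < cmod l + 1 by rewrite ltr_wpDl ?cmod_ge0.
have M0 : 0 < cmod m + 1 by rewrite ltr_wpDl ?cmod_ge0.
have [d2 d20 h2] := hg _ (divr_gt0 (divr_gt0 e0 (ltr0Sn R 1)) L0).
have [d3 d30 h3] := hf _ (divr_gt0 (divr_gt0 e0 (ltr0Sn R 1)) M0).
exists (Num.min (Num.min d1 d3) (d2 / (cmod l + 1))).
  by rewrite !lt_min d10 d30 divr_gt0.
move=> h; rewrite !lt_min => /andP[/andP[a1 a3] a2].
have H1 := lip _ a1.
have K1 : cmod (f (z + h) - f z) < d2.
  by rewrite (le_lt_trans H1) // mulrC -ltr_pdivlMr.
have := h2 _ K1; rewrite [f z + (_ - _)]addrC subrK => H2.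
have H3 := h3 _ a3.
have -> : g (f (z + h)) - g (f z) - m * l * h =
  (g (f (z + h)) - g (f z) - m * (f (z + h) - f z)) +
  m * (f (z + h) - f z - l * h) by ring.
rewrite (le_trans (cmodD _ _)) // (splitr e) mulrDl lerD //.
  rewrite (le_trans H2) // -[leLHS]mulrA ler_pM2l ?divr_gt0 //.
  by rewrite mulrC ler_pdivrMr // mulrC.
rewrite cmodM (le_trans (ler_wpM2l (cmod_ge0 _) H3)) //.
rewrite mulrA ler_wpM2r ?cmod_ge0 // mulrC -[leLHS]mulrA ler_piMr ?divr_ge0 // ?ltW //.
by rewrite mulrC ltr_pdivrMr // mul1r ltrDl.
Qed.

Lemma cderivZ (c : C R) f z l : cderiv f z l -> cderiv (fun w => c * f w) z (c * l).
Proof.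
move=> hf.
have hc : cderiv (fun w => c * w) (f z) c.
  move=> e e0; exists 1 => // h _.
  rewrite mulrDr [_ + _ * h]addrC addrK subrr cmod0.
  by rewrite mulr_ge0 ?cmod_ge0 // ltW.
exact: cderiv_comp hf hc.
Qed.

Lemma cderiv_sqr z : cderiv (fun w => w * w) z (2 * z).
Proof.
move=> e e0; exists e => // h he.
have -> : (z + h) * (z + h) - z * z - 2 * z * h = h * h by ring.
by rewrite cmodM ler_wpM2r ?cmod_ge0 // ltW.
Qed.

(** By polarization: the product is a combination of squares, and the square is
    a composition. *)
Lemma cderivM f g z l m : cderiv f z l -> cderiv g z m ->
  cderiv (fun w => f w * g w) z (l * g z + f z * m).
Proof.
move=> hf hg.
have h1 := cderiv_comp (cderivD hf hg) (cderiv_sqr _).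
have h2 := cderiv_comp hf (cderiv_sqr _).
have h3 := cderiv_comp hg (cderiv_sqr _).
have h := cderivZ (2^-1) (cderivD h1 (cderivZ (-1) (cderivD h2 h3))).
apply: (cderiv_eq (cderiv_ext ltr01 _ h)) => [w _|].
  by field.
by field.
Qed.

Lemma cderivN f z l : cderiv f z l -> cderiv (fun w => - f w) z (- l).
Proof.
move=> /(cderivZ (-1)) h.
by apply: (cderiv_eq (cderiv_ext ltr01 _ h)) => [w _|]; ring.
Qed.

Lemma cderivB f g z l m :
  cderiv f z l -> cderiv g z m -> cderiv (fun w => f w - g w) z (l - m).
Proof. by move=> hf /cderivN; exact: cderivD. Qed.

Lemma cderivX n z : cderiv (fun w => w ^+ n) z (n%:R * z ^+ n.-1).
Proof.
elim: n => [|n IH].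
  by rewrite mul0r; apply: cderiv_ext ltr01 _ (cderiv_cst 1 _) => w _; rewrite expr0.
have h := cderivM (cderiv_id z) IH.
apply: (cderiv_eq (cderiv_ext ltr01 _ h)) => [w _|].
  by rewrite exprS.
case: n {IH h} => [|n] /=; first by rewrite !expr0 mul0r mulr0 addr0.
by rewrite exprS -[n.+2%:R]natr1 mulrDl [_ * (n.+1%:R * _)]mulrCA addrC.
Qed.

Lemma cderiv_sum I (s : seq I) (P : pred I) (F : I -> C R -> C R) (F' : I -> C R) z :
  (forall i, P i -> cderiv (F i) z (F' i)) ->
  cderiv (fun w => \sum_(i <- s | P i) F i w) z (\sum_(i <- s | P i) F' i).
Proof.
move=> h; elim: s => [|i s IH].
  rewrite big_nil; apply: cderiv_ext ltr01 _ (cderiv_cst 0 z) => w _.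
  by rewrite big_nil.
rewrite big_cons; case: ifP => Pi.
  apply: cderiv_ext ltr01 _ (cderivD (h i Pi) IH) => w _.
  by rewrite big_cons Pi.
by apply: cderiv_ext ltr01 _ IH => w _; rewrite big_cons Pi.
Qed.

Lemma cderivV z : z != 0 -> cderiv (fun w => w^-1) z (- (z^-1 ^+ 2)).
Proof.
move=> z0 e e0; have cz0 : 0 < cmod z by rewrite cmod_gt0.
exists (Num.min (cmod z / 2) (e * cmod z ^+ 3 / 2)).
  by rewrite lt_min !divr_gt0 // mulr_gt0 // exprn_gt0.
move=> h; rewrite lt_min => /andP[h1 h2].
have zh : cmod z / 2 <= cmod (z + h).
  have := cmodB_ge z (- h); rewrite opprK cmodN; lra.
have zh0 : z + h != 0 by rewrite -cmod_gt0 (lt_le_trans _ zh) // divr_gt0.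
have -> : (z + h)^-1 - z^-1 - - z^-1 ^+ 2 * h = h * h / (z ^+ 2 * (z + h)).
  by field; rewrite zh0.
rewrite cmodM cmodV [cmod (h * h)]cmodM (cmodM (z ^+ 2)) cmodX.
rewrite -mulrA mulrC ler_wpM2r ?cmod_ge0 //.
rewrite ler_pdivrMr ?mulr_gt0 ?exprn_gt0 // ?(lt_le_trans _ zh) ?divr_gt0 //.
apply: (le_trans (ltW h2)).
rewrite -(mulrA e) ler_pM2l // exprSr -mulrA ler_pM2l ?exprn_gt0 //.
Qed.

Lemma cderiv_shift f z w l : cderiv f (w + z) l -> cderiv (fun u => f (w + u)) z l.
Proof.
move=> h.
have hs : cderiv (fun u => w + u) z 1.
  by have := cderivD (cderiv_cst w z) (cderiv_id z); rewrite add0r.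
by have := cderiv_comp hs h; rewrite mulr1.
Qed.

End LimitsDerivatives.

Section Cexp.
Variable R : realType.
Implicit Types (x y : R) (z w : C R).

Lemma is_derive_eps (f : R -> R) x l : is_derive x 1 f l ->
  forall e : R, 0 < e -> exists2 d : R, 0 < d &
    forall h, `|h| < d -> `|f (x + h) - f x - l * h| <= e * `|h|.
Proof.
move=> [/cvg_ex[l' cl] hl] e e0.
have ll : l' = l by rewrite -hl /derive; apply/esym/cvg_lim.
move: cl; rewrite ll => /cvgrPdist_le/(_ _ e0).
rewrite near_withinE => /nbhs_ballP[d /= d0 hd]; exists d => // h hlt.
have [->|h0] := eqVneq h 0; first by rewrite addr0 subrr mulr0 subr0 normr0 mulr0.
have := hd h; rewrite /ball /= sub0r normrN => /(_ hlt h0).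
rewrite (_ : h *: _ = h); last exact: mulr1.
rewrite (addrC h x) => H.
have -> : f (x + h) - f x - l * h = - (h * (l - h^-1 * (f (x + h) - f x))).
  by field.
by rewrite normrN normrM mulrC ler_pM2r // normr_gt0.
Qed.

Lemma cexpD z w : cexp (z + w) = cexp z * cexp w.
Proof.
rewrite /cexp cReD cImD expRD toCM cosD sinD.
have -> : mkC (cos (cIm z) * cos (cIm w) - sin (cIm z) * sin (cIm w))
  (sin (cIm z) * cos (cIm w) + cos (cIm z) * sin (cIm w)) =
  mkC (cos (cIm z)) (sin (cIm z)) * mkC (cos (cIm w)) (sin (cIm w)).
  by rewrite mkCM; congr mkC; ring.
ring.
Qed.

Lemma cexp0 : cexp (0 : C R) = 1.
Proof. by rewrite -toC0 /cexp /= expR0 cos0 sin0 toC1 mul1r -toC1. Qed.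

Lemma cexp_toC x : cexp (toC x) = toC (expR x).
Proof. by rewrite /cexp /= cos0 sin0 -[mkC 1 0]/(toC 1) toC1 mulr1. Qed.

Lemma cexpNM z : cexp (- z) * cexp z = 1.
Proof. by rewrite -cexpD addNr cexp0. Qed.

Lemma cexp_neq0 z : cexp z != 0.
Proof.
by apply/eqP => h; have := cexpNM z; rewrite h mulr0 => /eqP; rewrite eq_sym oner_eq0.
Qed.

Lemma cexpN z : cexp (- z) = (cexp z)^-1.
Proof. by apply: (mulIf (cexp_neq0 z)); rewrite cexpNM mulVf ?cexp_neq0. Qed.

Lemma cexpB z w : cexp (z - w) = cexp z / cexp w.
Proof. by rewrite cexpD cexpN. Qed.

Lemma cmod_cexp z : cmod (cexp z) = expR (cRe z).
Proof.
rewrite /cexp cmodM cmod_toC_ge0 ?expR_ge0 // [cmod (mkC _ _)]cmodE /= cos2Dsin2.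
by rewrite sqrtr1 mulr1.
Qed.

(** By [exp (x + iy) - 1 - x - iy = (e^x - 1 - x) E + (1 + x) (E - 1 - iy) + i x y]
    with [E = cos y + i sin y], from the derivatives of the real functions. *)
Lemma cderiv_cexp0 : cderiv (@cexp R) 0 1.
Proof.
suff [K K0 H] : exists2 K : R, 0 < K & forall e : R, 0 < e -> exists2 d : R, 0 < d &
    forall h : C R, cmod h < d -> cmod (cexp h - 1 - h) <= (K * e) * cmod h.
  move=> e e0; have [d d0 hd] := H (e / K) (divr_gt0 e0 K0).
  exists d => // h /hd; rewrite add0r cexp0 mul1r.
  by rewrite mulrCA divff ?mulr1 // gt_eqF.
exists 6 => // e e0.
have eD := @is_derive_eps expR 0 _ (is_derive_expR (0 : R)).
have cD := @is_derive_eps cos 0 _ (is_derive_cos (0 : R)).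
have sD := @is_derive_eps sin 0 _ (is_derive_sin (0 : R)).
have [d1 d10 h1] := eD _ e0; have [d2 d20 h2] := cD _ e0.
have [d3 d30 h3] := sD _ e0.
exists (Num.min (Num.min d1 d2) (Num.min d3 (Num.min 1 e))).
  by rewrite !lt_min d10 d20 d30 e0 ltr01.
move=> h; rewrite !lt_min => /andP[/andP[a1 a2] /andP[a3 /andP[a4 a5]]].
have hx := cRe_le h; have hy := cIm_le h.
move: (h1 (cRe h)) (h2 (cIm h)) (h3 (cIm h)).
rewrite !add0r expR0 cos0 sin0 oppr0 mul0r subr0 !mul1r addr0.
move=> /(_ (le_lt_trans hx a1)) H1 /(_ (le_lt_trans hy a2)) H2.
move=> /(_ (le_lt_trans hy a3)) H3.
set x := cRe h in hx H1 *; set y := cIm h in hy H2 H3 *.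
have hE : h = toC x + mkC 0 y by rewrite /toC mkCD addr0 add0r -mkCE.
pose E := mkC (cos y) (sin y).
have E1 : cmod E = 1 by rewrite cmodE /= cos2Dsin2 sqrtr1.
have -> : cexp h - 1 - h = (toC (expR x) - 1 - toC x) * E +
   ((1 + toC x) * (E - 1 - mkC 0 y) + toC x * mkC 0 y).
  by rewrite /cexp -/x -/y -/E [in LHS]hE; ring.
have B1 : cmod (toC (expR x) - 1 - toC x) <= e * cmod h.
  rewrite -toC1 -!toCB cmod_toC (le_trans H1) // ler_pM2l //.
have B2 : cmod (1 + toC x) <= 2.
  rewrite (le_trans (cmodD _ _)) // cmod1 cmod_toC.
  by move: (le_lt_trans hx a4) => /ltW; lra.
have B3 : cmod (E - 1 - mkC 0 y) <= 2 * (e * cmod h).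
  rewrite /E -toC1 /toC !mkCN !mkCD !oppr0 !addr0.
  rewrite (le_trans (cmod_mkC _ _)) // mulr2n mulrDl mul1r lerD //.
    by rewrite (le_trans H2) // ler_pM2l.
  by rewrite (le_trans H3) // ler_pM2l.
have B4 : cmod (toC x * mkC 0 y) <= e * cmod h.
  rewrite cmodM cmod_toC ler_pM //; first by rewrite cmod_ge0.
    by rewrite (le_trans hx) // ltW.
  by rewrite (le_trans (cmod_mkC _ _)) // normr0 add0r.
rewrite (le_trans (cmodD _ _)) //.
have C1 := cmodD ((1 + toC x) * (E - 1 - mkC 0 y)) (toC x * mkC 0 y).
have C2 : cmod ((1 + toC x) * (E - 1 - mkC 0 y)) <= 2 * (2 * (e * cmod h)).
  by rewrite cmodM ler_pM ?cmod_ge0.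
rewrite cmodM E1 mulr1 -mulrA; lra.
Qed.

Lemma cderiv_cexp z : cderiv (@cexp R) z (cexp z).
Proof.
have h := cderivZ (cexp z) (cderiv_shift (w := - z) (f := @cexp R) (z := z) (l := 1) _).
apply: cderiv_eq (cderiv_ext ltr01 _ (h _)) _; last by rewrite mulr1.
  by move=> w _; rewrite cexpD cexpN mulrA mulfV ?cexp_neq0 // mul1r.
by rewrite addNr; exact: cderiv_cexp0.
Qed.

End Cexp.

(** * Bisection of boxes *)

Section Boxes.
Variable R : realType.
Implicit Types (x y w h : R) (a z : C R).

Lemma half_pow_lt (x d : R) : 0 < d -> exists n, forall m, (n <= m)%N -> x / 2 ^+ m < d.
Proof.
move=> d0; have [x0|x0] := leP x 0.
  by exists 0%N => m _; rewrite (le_lt_trans _ d0) // mulr_le0_ge0 // invr_ge0 exprn_ge0.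
exists (Num.bound (x / d)) => m hm.
rewrite ltr_pdivrMr ?exprn_gt0 // mulrC -ltr_pdivrMr //.
apply: (lt_le_trans (archi_boundP _)); first by rewrite divr_ge0 ?ltW.
by rewrite -natrX ler_nat (leq_trans hm) // ltnW // ltn_expl.
Qed.

Definition inbox a w h z :=
  (cRe a <= cRe z <= cRe a + w) /\ (cIm a <= cIm z <= cIm a + h).

Lemma nested_sup (l r : nat -> R) : (forall m n, l n <= r m) ->
  exists x, forall n, l n <= x <= r n.
Proof.
move=> h; exists (sup (range l)) => n.
have ne : range l !=set0 by exists (l 0%N), 0%N.
have ub m : ubound (range l) (r m) by move=> _ [k _ <-].
apply/andP; split; last by apply: ge_sup.
by apply: ub_le_sup; [exists (r 0%N); exact: ub|exists n].
Qed.

(** Cousin's lemma: if [P] failed for the large box, bisection would give nested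
    boxes where it fails, shrinking to a point where the local hypothesis
    contradicts this. It replaces compactness throughout. *)
Lemma box_induction (P : C R -> R -> R -> Prop) :
  (forall a w h, 0 <= w -> 0 <= h ->
     P a (w / 2) (h / 2) -> P (a + mkC (w / 2) 0) (w / 2) (h / 2) ->
     P (a + mkC 0 (h / 2)) (w / 2) (h / 2) ->
     P (a + mkC (w / 2) (h / 2)) (w / 2) (h / 2) -> P a w h) ->
  forall a0 w0 h0, 0 <= w0 -> 0 <= h0 ->
  (forall z, inbox a0 w0 h0 z -> exists2 d : R, 0 < d & forall a w h,
     0 <= w -> 0 <= h ->
     inbox a w h z -> (forall u, inbox a w h u -> inbox a0 w0 h0 u) ->
     w < d -> h < d -> P a w h) ->
  P a0 w0 h0.
Proof.
move=> merge a0 w0 h0 w00 h00 loc; apply: contrapT => nP.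
pose bad (s : C R * R * R) := [/\ 0 <= s.1.2, 0 <= s.2 & ~ P s.1.1 s.1.2 s.2].
have step (s : C R * R * R) : exists s' : C R * R * R,
    bad s -> [/\ bad s', s'.1.2 = s.1.2 / 2, s'.2 = s.2 / 2,
      cRe s.1.1 <= cRe s'.1.1 <= cRe s.1.1 + s.1.2 / 2 &
      cIm s.1.1 <= cIm s'.1.1 <= cIm s.1.1 + s.2 / 2].
  case: s => [[a w] h]; apply: contrapT => /forallNP H.
  have badw : bad (a, w, h) by apply: contrapT => nb; apply: (H (a, w, h)).
  have [/= w_ge h_ge nPw] := badw.
  have w2 : 0 <= w / 2 by rewrite divr_ge0.
  have h2 : 0 <= h / 2 by rewrite divr_ge0.
  have key p q : 0 <= p <= w / 2 -> 0 <= q <= h / 2 ->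
      P (a + mkC p q) (w / 2) (h / 2).
    move=> hp hq; apply: contrapT => nPpq; apply: (H (a + mkC p q, w / 2, h / 2)) => _.
    split=> //=; rewrite ?cReD ?cImD /=; lra.
  apply: nPw; apply: merge => //.
  - by rewrite -[a]addr0 -toC0; apply: key; rewrite lexx.
  - by apply: key; rewrite lexx ?w2.
  - by apply: key; rewrite lexx ?h2.
  - by apply: key; rewrite lexx ?h2 ?w2.
have [F FP] := choice step.
pose s n := iter n F (a0, w0, h0).
have sb n : bad (s n).
  by elim: n => [|n /FP[]] //.
have sS n := FP _ (sb n); rewrite -/(s _.+1) in sS.
have sw n : (s n).1.2 = w0 / 2 ^+ n.
  elim: n => [|n IH]; first by rewrite expr0 divr1.
  by have [_ -> _ _ _] := sS n; rewrite IH exprSr invfM mulrA.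
have sh n : (s n).2 = h0 / 2 ^+ n.
  elim: n => [|n IH]; first by rewrite expr0 divr1.
  by have [_ _ -> _ _] := sS n; rewrite IH exprSr invfM mulrA.
have nest n k : inbox (s n).1.1 (s n).1.2 (s n).2 (s (n + k)%N).1.1 /\
    forall u, inbox (s (n + k)%N).1.1 (s (n + k)%N).1.2 (s (n + k)%N).2 u ->
      inbox (s n).1.1 (s n).1.2 (s n).2 u.
  elim: k => [|k [IH1 IH2]].
    rewrite addn0; split => //; have [? ? _] := sb n.
    by split; rewrite lexx lerDl.
  have [_ e1 e2 b1 b2] := sS (n + k)%N; rewrite addnS.
  have [wp hp _] := sb (n + k)%N.
  split=> [|u [u1 u2]]; apply: IH2; split; lra.
have mono n m : cRe (s n).1.1 <= cRe (s m).1.1 + (s m).1.2 /\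
    cIm (s n).1.1 <= cIm (s m).1.1 + (s m).2.
  have [? ? _] := sb m; have [? ? _] := sb n.
  case: (leqP m n) => [/subnKC <-|/ltnW/subnKC E].
    by have [[/andP[_ ?] /andP[_ ?]] _] := nest m (n - m)%N.
  have [[/andP[h1 _] /andP[h2 _]] _] := nest n (m - n)%N; rewrite E in h1 h2; lra.
have [x hx] := @nested_sup (fun n => cRe (s n).1.1) (fun n => cRe (s n).1.1 + (s n).1.2)
  (fun m n => (mono n m).1).
have [y hy] := @nested_sup (fun n => cIm (s n).1.1) (fun n => cIm (s n).1.1 + (s n).2)
  (fun m n => (mono n m).2).
have zin n : inbox (s n).1.1 (s n).1.2 (s n).2 (mkC x y) by split; [exact: hx|exact: hy].
have [d d0 hd] := loc _ (zin 0%N).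
have [n1 hn1] := half_pow_lt w0 d0; have [n2 hn2] := half_pow_lt h0 d0.
pose n := maxn n1 n2; have [wn hn nPn] := sb n; apply: nPn.
apply: hd => //; last 2 first.
- by rewrite sw hn1 // leq_maxl.
- by rewrite sh hn2 // leq_maxr.
- by have [_] := nest 0%N n; rewrite add0n.
Qed.

(** Local boundedness is asked around every point [z], inside [S] or not: for a
    closed [S] the outer points cost nothing, and compactness is the bisection. *)
Lemma box_bounded (S : C R -> Prop) (f : C R -> C R) a0 w0 h0 :
  0 <= w0 -> 0 <= h0 ->
  (forall z, exists2 d : R, 0 < d &
     exists B : R, forall u, cmod (u - z) < d -> S u -> cmod (f u) <= B) ->
  exists B : R, forall z, inbox a0 w0 h0 z -> S z -> cmod (f z) <= B.
Proof.
move=> w00 h00 loc.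
apply: (box_induction (P := fun a w h =>
  exists B : R, forall z, inbox a w h z -> S z -> cmod (f z) <= B)) => //.
  move=> a w h w_ge h_ge [B1 H1] [B2 H2] [B3 H3] [B4 H4].
  exists (Num.max (Num.max B1 B2) (Num.max B3 B4)) => z [z1 z2] Sz.
  rewrite !le_max.
  have [c1|c1] := leP (cRe z) (cRe a + w / 2); have [c2|c2] := leP (cIm z) (cIm a + h / 2).
  - by rewrite H1 //; split; lra.
  - by rewrite H3 ?orbT //; split; rewrite ?cReD ?cImD /=; lra.
  - by rewrite H2 ?orbT //; split; rewrite ?cReD ?cImD /=; lra.
  - by rewrite H4 ?orbT //; split; rewrite ?cReD ?cImD /=; lra.
move=> z _; have [d d0 [B hB]] := loc z; exists (d / 2); first by rewrite divr_gt0.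
move=> a w h w_ge h_ge [z1 z2] _ wd hd; exists B => u [u1 u2]; apply: hB.
apply: (le_lt_trans (y := `|cRe (u - z)| + `|cIm (u - z)|)).
  by rewrite {1}(mkCE (u - z)) cmod_mkC.
have k1 : `|cRe (u - z)| <= w by rewrite cReB ler_norml; lra.
have k2 : `|cIm (u - z)| <= h by rewrite cImB ler_norml; lra.
lra.
Qed.

(** The derivative bounds the increments from each point of the segment by
    [B + e'], and such bounds add up along a subdivision. The segment is encoded
    as a box of height [0]. *)
Lemma mean_value_ineq (f : C R -> C R) z (v : C R) (B : R) :
  (forall t : R, 0 <= t <= 1 ->
     exists2 l, cderiv f (z + toC t * v) l & cmod l <= B) ->
  cmod (f (z + v) - f z) <= B * cmod v.
Proof.
move=> H; apply/ler_addgt0Pr => e e0.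
have [->|v0] := eqVneq v 0.
  by rewrite addr0 subrr cmod0 mulr0 add0r ltW.
have cv0 : 0 < cmod v by rewrite cmod_gt0.
pose e' := e / cmod v; have e'0 : 0 < e' by rewrite divr_gt0.
pose P (a : C R) (w h : R) := cmod (f (z + toC (cRe a + w) * v) - f (z + toC (cRe a) * v))
  <= (B + e') * (w * cmod v).
have cRe00 : cRe (0 : C R) = 0 by rewrite -toC0.
suff : P 0 1 0.
  by rewrite /P cRe00 toC0 add0r mul1r mul0r addr0 toC1 mul1r mulrDl mulfVK // gt_eqF.
apply: (box_induction (P := P)) => //.
  rewrite /P => a w h w_ge h_ge H1 H2 _ _.
  rewrite cReD /= in H2.
  have -> : f (z + toC (cRe a + w) * v) - f (z + toC (cRe a) * v) =
     (f (z + toC (cRe a + w / 2 + w / 2) * v) - f (z + toC (cRe a + w / 2) * v)) +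
     (f (z + toC (cRe a + w / 2) * v) - f (z + toC (cRe a) * v)).
    have -> : cRe a + w / 2 + w / 2 = cRe a + w by rewrite -addrA -splitr.
    by ring.
  rewrite (le_trans (cmodD _ _)) // (le_trans (lerD H2 H1)) //.
  by rewrite -mulrDr -mulrDl -splitr.
move=> t [t1 _]; rewrite /= cRe00 add0r in t1.
have [l df db] := H _ t1.
have [d d0 hd] := df _ e'0; exists (d / cmod v); first by rewrite divr_gt0.
move=> a w h w_ge _ [a1 _] _ wd _; rewrite /P.
set t0 := cRe t in t1 df db hd a1 *; set x := cRe a in a1 *.
have est (s : R) : `|s - t0| <= w ->
    cmod (f (z + toC s * v) - f (z + toC t0 * v)) <= (B + e') * (`|s - t0| * cmod v).
  move=> hs.
  have E : z + toC s * v = z + toC t0 * v + toC (s - t0) * v by rewrite toCB; ring.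
  have := hd (toC (s - t0) * v); rewrite -E cmodM cmod_toC.
  rewrite -ltr_pdivlMr // => /(_ (le_lt_trans hs wd)) K.
  rewrite -[X in cmod X](subrK (l * (toC (s - t0) * v))).
  rewrite (le_trans (cmodD _ _)) // mulrDl addrC lerD //.
  by rewrite !cmodM cmod_toC ler_wpM2r ?mulr_ge0 ?cmod_ge0.
have s1 : `|x + w - t0| = x + w - t0 by rewrite ger0_norm //; lra.
have s2 : `|x - t0| = t0 - x by rewrite distrC ger0_norm //; lra.
have := est (x + w); have := est x; rewrite s1 s2 => /(_ _) K1 /(_ _) K2.
have k1 := K1 ltac:(lra); have k2 := K2 ltac:(lra).
rewrite -[f _](subrK (f (z + toC t0 * v))) -addrA (le_trans (cmodD _ _)) //.
rewrite [cmod (f (z + toC t0 * v) - _)]cmod_distC (le_trans (lerD k2 k1)) //.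
by rewrite -mulrDr -mulrDl (_ : x + w - t0 + (t0 - x) = w) //; ring.
Qed.

End Boxes.

(** * Goursat's theorem for midpoint sums *)

Section Goursat.
Variable R : realType.
Implicit Types (x y w h : R) (a z v : C R) (H : C R -> C R) (n : nat).

(** Midpoint sum for the integral of [H] over the segment from [a] to [a + v]. *)
Definition midsum H a v n : C R :=
  v / n%:R * \sum_(j < n) H (a + (j%:R + 2^-1) / n%:R * v).

(** Midpoint sum for the integral over the boundary of a rectangle. *)
Definition rectsum H a w h n : C R :=
  midsum H a (toC w) n + midsum H (a + toC w) (mkC 0 h) n
  - midsum H (a + mkC 0 h) (toC w) n - midsum H a (mkC 0 h) n.

(* Instances of generic sum lemmas whose right-hand sides are already in
   simplified form: simplification would unfold the carrier of [C R]. *)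
Lemma csum_split I (s : seq I) (P : pred I) (F G : I -> C R) :
  \sum_(i <- s | P i) (F i + G i) =
  \sum_(i <- s | P i) F i + \sum_(i <- s | P i) G i.
Proof. exact: big_split. Qed.

Lemma csum_recr n (F : nat -> C R) :
  \sum_(j < n.+1) F j = \sum_(j < n) F j + F n.
Proof. exact: big_ord_recr. Qed.

Lemma csum_const n (c : C R) : \sum_(j < n) c = n%:R * c.
Proof.
elim: n => [|n IH]; first by rewrite big_ord0 mul0r.
by rewrite (csum_recr n (fun=> c)) IH -natr1 mulrDl mul1r.
Qed.

Lemma natC_neq0 n : (0 < n)%N -> n%:R != 0 :> C R.
Proof. by move=> n0; rewrite pnatr_eq0 -lt0n. Qed.

Lemma midsum_split H a v n : (0 < n)%N ->
  midsum H a v (n + n) = midsum H a (v / 2) n + midsum H (a + v / 2) (v / 2) n.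
Proof.
move=> n0; have n0' := natC_neq0 n0.
have nn0 : (n + n)%:R = 2 * n%:R :> C R by rewrite natrD; ring.
rewrite /midsum big_split_ord /= nn0 -[RHS]mulrDr.
have -> : v / (2 * n%:R) = v / 2 / n%:R by field.
apply: (congr2 (fun p q => v / 2 / n%:R * (p + q))); apply: eq_bigr => j _;
  congr (H _).
  by field.
by rewrite natrD; field.
Qed.

(** The sums over the inner edges cancel exactly, because the midpoints of the
    quarters are midpoints of the finer subdivision. *)
Lemma rectsum_split H a w h n : (0 < n)%N ->
  rectsum H a w h (n + n) =
  rectsum H a (w / 2) (h / 2) n + rectsum H (a + mkC (w / 2) 0) (w / 2) (h / 2) n
  + rectsum H (a + mkC 0 (h / 2)) (w / 2) (h / 2) n
  + rectsum H (a + mkC (w / 2) (h / 2)) (w / 2) (h / 2) n.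
Proof.
move=> n0; rewrite /rectsum !midsum_split //.
have e1 : toC w / 2 = toC (w / 2) :> C R by rewrite toCM toCV toC_nat.
have e2 : mkC 0 h / 2 = mkC 0 (h / 2) :> C R.
  by rewrite -[2 in LHS](toC_nat R) -toCV /toC mkCM !mul0r mulr0 subr0 add0r.
have e3 : mkC (w / 2) (h / 2) = toC (w / 2) + mkC 0 (h / 2) :> C R.
  by rewrite /toC mkCD addr0 add0r.
have e4 : toC w = toC (w / 2) + toC (w / 2) by rewrite -toCD -splitr.
have e5 : mkC 0 h = mkC 0 (h / 2) + mkC 0 (h / 2) :> C R.
  by rewrite mkCD addr0 -splitr.
rewrite e1 e2 e3 -[mkC (w / 2) 0]/(toC (w / 2)) e4 e5 !addrA.
set p := toC (w / 2); set q := mkC 0 (h / 2).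
have -> : a + q + q + p = a + p + q + q by ring.
have -> : a + p + q + p = a + p + p + q by ring.
have -> : a + q + p = a + p + q by ring.
by ring.
Qed.

Lemma sum_mid n : \sum_(j < n) (j%:R + 2^-1 : C R) = n%:R ^+ 2 / 2.
Proof.
elim: n => [|n IH]; first by rewrite big_ord0 expr0n mul0r.
have E (x : C R) : x ^+ 2 / 2 + (x + 2^-1) = (x + 1) ^+ 2 / 2 by field.
by rewrite (csum_recr n (fun j => j%:R + 2^-1)) IH E natr1.
Qed.

Lemma midsum_affine a v n (c d : C R) : (0 < n)%N ->
  midsum (fun u => c + d * u) a v n = v * (c + d * (a + v / 2)).
Proof.
move=> n0; have n0' := natC_neq0 n0; rewrite /midsum.
rewrite (eq_bigr (fun j : 'I_n => (c + d * a) + (j%:R + 2^-1) * (d / n%:R * v))).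
  2: by move=> j _; field.
rewrite csum_split csum_const -mulr_suml sum_mid.
by field.
Qed.

Lemma rectsum_affine a w h n (c d : C R) : (0 < n)%N ->
  rectsum (fun u => c + d * u) a w h n = 0.
Proof. by move=> n0; rewrite /rectsum !midsum_affine //; field. Qed.

Lemma midsumB H1 H2 a v n :
  midsum (fun u => H1 u - H2 u) a v n = midsum H1 a v n - midsum H2 a v n.
Proof. by rewrite /midsum sumrB mulrBr. Qed.

Lemma rectsumB H1 H2 a w h n :
  rectsum (fun u => H1 u - H2 u) a w h n = rectsum H1 a w h n - rectsum H2 a w h n.
Proof. by rewrite /rectsum !midsumB; ring. Qed.

Lemma mid_in01 n (j : 'I_n) : exists2 t : R, 0 <= t <= 1 &
  (j%:R + 2^-1) / n%:R = toC t :> C R.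
Proof.
exists ((j%:R + 2^-1) / n%:R); last by rewrite toCM toCD !toCV !toC_nat.
have n0 : 0 < n%:R :> R by rewrite ltr0n (leq_ltn_trans _ (ltn_ord j)).
rewrite divr_ge0 ?addr_ge0 //= ler_pdivrMr // mul1r.
have : j.+1%:R <= n%:R :> R by rewrite ler_nat ltn_ord.
by rewrite -natr1; lra.
Qed.

Lemma midsum_bound H a v n (B : R) : (0 < n)%N ->
  (forall t : R, 0 <= t <= 1 -> cmod (H (a + toC t * v)) <= B) ->
  cmod (midsum H a v n) <= cmod v * B.
Proof.
move=> n0 hB; rewrite /midsum !cmodM cmodV cmod_nat -mulrA.
rewrite ler_wpM2l ?cmod_ge0 // mulrC ler_pdivrMr ?ltr0n //.
rewrite (le_trans (cmod_sum _ _ _)) // (le_trans (y := \sum_(j < n) B)) //.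
  by apply: ler_sum => j _; have [t t01 ->] := mid_in01 j; exact: hB.
by rewrite sumr_const card_ord mulr_natr.
Qed.

Lemma rectsum_bound H a w h n (B : R) : (0 < n)%N -> 0 <= w -> 0 <= h ->
  (forall u, inbox a w h u -> cmod (H u) <= B) ->
  cmod (rectsum H a w h n) <= 2 * (w + h) * B.
Proof.
move=> n0 w0 h0 hB.
have ch : cmod (mkC 0 h) = h :> R by rewrite cmodE /= expr0n add0r sqrtr_sqr ger0_norm.
have cw := cmod_toC_ge0 w0.
have e1 t u : toC t * mkC 0 u = mkC 0 (t * u) by rewrite /toC mkCM !mul0r mulr0 subr0 addr0.
have side t x : 0 <= x -> 0 <= t <= 1 -> 0 <= t * x <= x.
  by move=> x0 /andP[t0 t1]; rewrite mulr_ge0 //= ler_piMl.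
have S t := side t w w0; have T t := side t h h0.
have b1 : cmod (midsum H a (toC w) n) <= w * B.
  rewrite -{2}cw; apply: midsum_bound => // t /S ht; rewrite -toCM.
  by apply: hB; split; rewrite ?cReD ?cImD /=; lra.
have b2 : cmod (midsum H (a + toC w) (mkC 0 h) n) <= h * B.
  rewrite -{2}ch; apply: midsum_bound => // t /T ht; rewrite e1.
  by apply: hB; split; rewrite ?cReD ?cImD /= ?cReD ?cImD /=; lra.
have b3 : cmod (midsum H (a + mkC 0 h) (toC w) n) <= w * B.
  rewrite -{2}cw; apply: midsum_bound => // t /S ht; rewrite -toCM.
  by apply: hB; split; rewrite ?cReD ?cImD /= ?cReD ?cImD /=; lra.
have b4 : cmod (midsum H a (mkC 0 h) n) <= h * B.
  rewrite -{2}ch; apply: midsum_bound => // t /T ht; rewrite e1.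
  by apply: hB; split; rewrite ?cReD ?cImD /=; lra.
rewrite /rectsum.
have k1 := cmodB (midsum H a (toC w) n + midsum H (a + toC w) (mkC 0 h) n
  - midsum H (a + mkC 0 h) (toC w) n) (midsum H a (mkC 0 h) n).
have k2 := cmodB (midsum H a (toC w) n + midsum H (a + toC w) (mkC 0 h) n)
  (midsum H (a + mkC 0 h) (toC w) n).
have k3 := cmodD (midsum H a (toC w) n) (midsum H (a + toC w) (mkC 0 h) n).
lra.
Qed.

(** Goursat's bisection argument. Midpoint sums are exact on affine functions,
    hence the first order expansion at [z] bounds the sum over a small rectangle
    by [e] times its squared size, and these bounds add up in a bisection. Only
    differentiability at each point is used, and no integral has to be defined. *)
Lemma goursat H a0 w0 h0 : 0 <= w0 -> 0 <= h0 ->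
  (forall z, inbox a0 w0 h0 z -> exists l, cderiv H z l) ->
  forall e : R, 0 < e -> exists N0, forall N, (N0 <= N)%N ->
    cmod (rectsum H a0 w0 h0 (2 ^ N)) <= e * (w0 ^+ 2 + h0 ^+ 2).
Proof.
move=> w00 h00 hH e e0.
apply: (box_induction (P := fun a w h => exists N0, forall N, (N0 <= N)%N ->
    cmod (rectsum H a w h (2 ^ N)) <= e * (w ^+ 2 + h ^+ 2))) => //.
  move=> a w h _ _ [N1 H1] [N2 H2] [N3 H3] [N4 H4].
  exists (maxn (maxn N1 N2) (maxn N3 N4)).+1 => -[//|N].
  rewrite ltnS !geq_max => /andP[/andP[/H1 K1 /H2 K2] /andP[/H3 K3 /H4 K4]].
  rewrite expnS mul2n -addnn rectsum_split ?expn_gt0 //.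
  rewrite !expr_div_n in K1 K2 K3 K4.
  set r1 := rectsum _ a _ _ _ in K1 *; set r2 := rectsum _ _ _ _ _ in K2 *.
  set r3 := rectsum _ _ _ _ _ in K3 *; set r4 := rectsum _ _ _ _ _ in K4 *.
  have k1 := cmodD (r1 + r2 + r3) r4; have k2 := cmodD (r1 + r2) r3.
  have k3 := cmodD r1 r2; lra.
move=> z /hH[l dl].
have e4 : 0 < e / 4 by rewrite divr_gt0.
have [d d0 hd] := dl _ e4; exists (d / 2); first by rewrite divr_gt0.
move=> a w h w0' h0' [z1 z2] _ wd hd'; exists 0%N => N _.
have n0 : (0 < 2 ^ N)%N by rewrite expn_gt0.
pose L u := (H z - l * z) + l * u.
have -> : rectsum H a w h (2 ^ N) = rectsum (fun u => H u - L u) a w h (2 ^ N).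
  by rewrite rectsumB rectsum_affine // subr0.
have K : forall u, inbox a w h u -> cmod (H u - L u) <= e / 4 * (w + h).
  move=> u [u1 u2].
  have uz : cmod (u - z) <= w + h.
    rewrite (mkCE (u - z)) (le_trans (cmod_mkC _ _)) // lerD //.
      by rewrite cReB ler_norml; lra.
    by rewrite cImB ler_norml; lra.
  have uz' : cmod (u - z) < d by lra.
  have := hd _ uz'; rewrite [z + _]addrC subrK => K.
  have -> : H u - L u = H u - H z - l * (u - z) by rewrite /L; ring.
  by rewrite (le_trans K) // ler_pM2l.
rewrite (le_trans (rectsum_bound n0 w0' h0' K)) //.
have -> : 2 * (w + h) * (e / 4 * (w + h)) = e * ((w + h) ^+ 2 / 2) by field.
by rewrite ler_pM2l //; have := sqr_ge0 (w - h); rewrite !expr2; nra.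
Qed.

End Goursat.

Section CircleAverages.
Variable R : realType.
Implicit Types (x y : R) (z v : C R) (f : C R -> C R) (n : nat).

(** The [n]-th roots of [-1]: the midpoints of [n] equal arcs of the circle. *)
Definition croot n (j : nat) : C R := cexp (mkC 0 ((j%:R + 2^-1) / n%:R * (2 * pi))).

Definition cavg n f (rho : R) : C R :=
  n%:R^-1 * \sum_(j < n) f (toC rho * croot n j).

Lemma cmod_croot n j : cmod (croot n j) = 1.
Proof. by rewrite /croot cmod_cexp /= expR0. Qed.

Lemma cexp_2pi : cexp (mkC 0 (2 * pi)) = 1 :> C R.
Proof.
have -> : 2 * pi = pi *+ 2 :> R by rewrite mulr_natl.
by rewrite /cexp /= expR0 cos2pi sin2pi -[mkC 1 0]/(toC 1) toC1 mulr1.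
Qed.

(** [goursat] for [f (exp u)] on a rectangle of height [2 pi]: the horizontal sides
    cancel by periodicity, the vertical ones are the two averages. *)
Lemma cavg_const f (r1 r2 : R) : 0 < r1 -> r1 <= r2 ->
  (forall z, r1 <= cmod z <= r2 -> exists l, cderiv f z l) ->
  forall e : R, 0 < e -> exists N0, forall N, (N0 <= N)%N ->
    cmod (cavg (2 ^ N) f r1 - cavg (2 ^ N) f r2) <= e.
Proof.
move=> r10 r12 hf e e0.
have r20 : 0 < r2 by rewrite (lt_le_trans r10).
pose H u := f (cexp u).
pose w := ln r2 - ln r1.
have w0 : 0 <= w by rewrite subr_ge0 ler_ln ?posrE.
have p0 : 0 < 2 * pi :> R by rewrite mulr_gt0 // pi_gt0.
have hH z : inbox (toC (ln r1)) w (2 * pi) z -> exists l, cderiv H z l.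
  move=> [z1 _]; rewrite /= in z1.
  have [|l hl] := hf (cexp z).
    have b1 : expR (ln r1) <= expR (cRe z) by rewrite ler_expR; lra.
    have b2 : expR (cRe z) <= expR (ln r2) by rewrite ler_expR; move: z1; rewrite /w; lra.
    by rewrite cmod_cexp; rewrite !lnK ?posrE // in b1 b2; rewrite b1.
  exists (l * cexp z); exact: cderiv_comp (cderiv_cexp z) hl.
pose A := w ^+ 2 + (2 * pi) ^+ 2.
have A0 : 0 < A by rewrite ltr_wpDl ?sqr_ge0 // exprn_gt0.
have e'0 : 0 < e * (2 * pi) / A by rewrite divr_gt0 // mulr_gt0.
have [N0 hN0] := goursat w0 (ltW p0) hH e'0.
exists N0 => N /hN0; rewrite divfK; last by rewrite gt_eqF.
set n := (2 ^ N)%N; have n0 : (0 < n)%N by rewrite expn_gt0.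
have per u : H (u + mkC 0 (2 * pi)) = H u by rewrite /H cexpD cexp_2pi mulr1.
have top : midsum H (toC (ln r1) + mkC 0 (2 * pi)) (toC w) n =
    midsum H (toC (ln r1)) (toC w) n.
  by rewrite /midsum; congr (_ * _); apply: eq_bigr => j _; rewrite addrAC per.
have side (r' : R) : 0 < r' ->
    midsum H (toC (ln r')) (mkC 0 (2 * pi)) n = mkC 0 (2 * pi) * cavg n f r'.
  move=> r'0; rewrite /midsum /cavg mulrA; congr (_ * _).
  apply: eq_bigr => j _; rewrite /H cexpD cexp_toC lnK ?posrE //.
  congr (f (_ * cexp _)).
  have [t _ E] := @mid_in01 R _ j; rewrite E /toC mkCM !mul0r mulr0 subr0 addr0.
  congr (mkC 0 (_ * _)); apply: (@toC_inj R).
  by rewrite -E toCM toCD !toCV !toC_nat.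
have -> : rectsum H (toC (ln r1)) w (2 * pi) n =
  mkC 0 (2 * pi) * (cavg n f r2 - cavg n f r1).
  rewrite /rectsum top -toCD /w [ln r1 + _]addrC subrK !side //; ring.
rewrite cmodM cmod_distC.
have -> : cmod (mkC 0 (2 * pi)) = 2 * pi :> R.
  by rewrite cmodE /= expr0n add0r sqrtr_sqr ger0_norm // ltW.
by rewrite [X in _ <= X]mulrC ler_pM2l.
Qed.

End CircleAverages.

(** * Cauchy's estimate and coefficient extraction *)

Section Cauchy.
Variable R : realType.
Implicit Types (x y : R) (z v w : C R) (f g h : C R -> C R) (n : nat).

Lemma cexp_im x y : cexp (mkC 0 (x + y)) = cexp (mkC 0 x) * cexp (mkC 0 y) :> C R.
Proof. by rewrite -cexpD mkCD addr0. Qed.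

Lemma cexp_imX k x : cexp (mkC 0 x) ^+ k = cexp (mkC 0 (k%:R * x)) :> C R.
Proof.
elim: k => [|k IH]; first by rewrite expr0 mul0r -[mkC 0 0]/(toC 0) toC0 cexp0.
by rewrite exprSr IH -cexp_im -natr1 mulrDl mul1r.
Qed.

Lemma croot_neq0 n j : croot R n j != 0.
Proof. exact: cexp_neq0. Qed.

Lemma crootXn n j : (0 < n)%N -> croot R n j ^+ n = -1.
Proof.
move=> n0; have n0' : n%:R != 0 :> R by rewrite pnatr_eq0 -lt0n.
rewrite /croot cexp_imX.
have -> : n%:R * ((j%:R + 2^-1) / n%:R * (2 * pi)) = j%:R * (2 * pi) + pi :> R by field.
rewrite cexp_im -cexp_imX cexp_2pi expr1n mul1r.
by rewrite /cexp /= expR0 cospi sinpi toC1 mul1r -[mkC _ _]/(toC _) toCN toC1.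
Qed.

Lemma cexp_im_neq1 x : 0 < x < pi -> cexp (mkC 0 (2 * x)) != 1 :> C R.
Proof.
move=> x01; apply/eqP => /(congr1 (@cRe R)).
rewrite -toC1 /cexp cReM /= expR0 mul1r mul0r subr0 mulr_natl cos_mulr2n => h.
have := sin_gt0_pi x01; have := cos2Dsin2 x; rewrite !expr2 in h *; nra.
Qed.

Lemma sum_crootX n k : (0 < k < n)%N -> \sum_(j < n) croot R n j ^+ k = 0.
Proof.
move=> /andP[k0 kn]; have n0 : (0 < n)%N by apply: leq_trans kn.
have n0' : n%:R != 0 :> R by rewrite pnatr_eq0 -lt0n.
pose q : C R := cexp (mkC 0 (2 * (k%:R * pi / n%:R))).
have q1 : q != 1.
  apply: cexp_im_neq1; rewrite divr_gt0 ?mulr_gt0 ?ltr0n ?pi_gt0 //=.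
  by rewrite ltr_pdivrMr ?ltr0n // mulrC ltr_pM2l ?pi_gt0 // ltr_nat.
have qn : q ^+ n = 1.
  rewrite cexp_imX.
  have -> : n%:R * (2 * (k%:R * pi / n%:R)) = k%:R * (2 * pi) :> R by field.
  by rewrite -cexp_imX cexp_2pi expr1n.
rewrite (eq_bigr (fun j : 'I_n => cexp (mkC 0 (k%:R * pi / n%:R)) * q ^+ j)).
  2: move=> j _; rewrite /croot /q !cexp_imX -cexp_im; congr (cexp (mkC 0 _)); by field.
rewrite -mulr_sumr; have : (q - 1) * (\sum_(i < n) q ^+ i) = 0.
  by rewrite -subrX1 qn subrr.
move=> /eqP; rewrite mulf_eq0 subr_eq0 (negbTE q1) /= => /eqP ->.
by rewrite mulr0.
Qed.

Lemma sum_croot_orth n k l : (k < n)%N -> (l < n)%N ->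
  \sum_(j < n) croot R n j ^+ k / croot R n j ^+ l = if k == l then n%:R else 0.
Proof.
move=> kn ln; have n0 : (0 < n)%N by apply: leq_ltn_trans kn.
have cn0 j : croot R n j ^+ l != 0 by rewrite expf_neq0 // croot_neq0.
case: eqP => [->|/eqP kl].
  rewrite (eq_bigr (fun=> 1)); first by rewrite csum_const mulr1.
  by move=> j _; rewrite divff.
case: (ltngtP k l) kl => // kl _.
  rewrite (eq_bigr (fun j : 'I_n => - croot R n j ^+ (k + n - l)%N)); last first.
    move=> j _; apply: (mulIf (cn0 j)); rewrite divfK // mulNr -exprD subnK.
      by rewrite exprD crootXn // mulrN1 opprK.
    by rewrite (leq_trans (ltnW ln)) // leq_addl.
  rewrite sumrN sum_crootX ?oppr0 // subn_gt0 (leq_trans ln) ?leq_addl //=.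
  by rewrite ltn_subLR ?ltn_add2r // (leq_trans (ltnW ln)) // leq_addl.
rewrite (eq_bigr (fun j : 'I_n => croot R n j ^+ (k - l)%N)); last first.
  by move=> j _; apply: (mulIf (cn0 j)); rewrite divfK // -exprD subnK // ltnW.
by rewrite sum_crootX // subn_gt0 kl /= (leq_ltn_trans (leq_subr _ _)).
Qed.

Lemma cavg_bound n f (rho B : R) : (0 < n)%N ->
  (forall z, cmod z = rho -> cmod (f z) <= B) -> 0 <= rho ->
  cmod (cavg n f rho) <= B.
Proof.
move=> n0 hB r0; rewrite /cavg cmodM cmodV cmod_nat mulrC ler_pdivrMr ?ltr0n //.
rewrite (le_trans (cmod_sum _ _ _)) // (le_trans (y := \sum_(j < n) B)) //.
  by apply: ler_sum => j _; apply: hB; rewrite cmodM cmod_croot cmod_toC_ge0 // mulr1.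
by rewrite sumr_const card_ord mulr_natr.
Qed.

Lemma cavgD n f g (rho : R) :
  cavg n (fun z => f z + g z) rho = cavg n f rho + cavg n g rho.
Proof. by rewrite /cavg csum_split mulrDr. Qed.

Lemma cavgZ n (c : C R) f (rho : R) :
  cavg n (fun z => c * f z) rho = c * cavg n f rho.
Proof. by rewrite /cavg -mulr_sumr mulrCA. Qed.

Lemma cavg_eq n f g (rho : R) : 0 <= rho ->
  (forall z, cmod z = rho -> f z = g z) -> cavg n f rho = cavg n g rho.
Proof.
move=> r0 fg; congr (_ * _); apply: eq_bigr => j _; apply: fg.
by rewrite cmodM cmod_croot cmod_toC_ge0 // mulr1.
Qed.

Lemma cavg_monom n k l (rho : R) : 0 < rho -> (k < n)%N -> (l < n)%N ->
  cavg n (fun z => z ^+ k / z ^+ l) rho = (k == l)%:R.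
Proof.
move=> r0 kn ln; have n0 : (0 < n)%N by apply: leq_ltn_trans kn.
have rn0 : toC rho != 0 by rewrite -cmod_gt0 cmod_toC_ge0 // ltW.
rewrite /cavg (eq_bigr (fun j : 'I_n =>
   (toC rho ^+ k / toC rho ^+ l) * (croot R n j ^+ k / croot R n j ^+ l))).
  rewrite -mulr_sumr sum_croot_orth //; case: eqP => [->|_].
    by rewrite divff ?expf_neq0 // mul1r mulVf ?natC_neq0.
  by rewrite !mulr0.
by move=> j _; rewrite !exprMn invfM mulrACA.
Qed.

(** The average of [h (w + z) / z] is bounded by [B / r1] on a circle of radius
    [r1] close to [rho], and tends to [l] on small circles by the definition of the
    derivative. *)
Lemma cauchy_estimate h w l (rho B : R) : 0 < rho ->
  (forall z, cmod (z - w) < rho -> cmod (h z) <= B) ->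
  (forall z, cmod (z - w) < rho -> exists l', cderiv h z l') ->
  cderiv h w l -> cmod l <= B / rho.
Proof.
move=> rho0 hB hd hl.
have B0 : 0 <= B.
  by apply: le_trans (cmod_ge0 _) (hB w _); rewrite subrr cmod0.
suff key (r1 : R) : 0 < r1 -> r1 < rho -> cmod l * r1 <= B.
  rewrite ler_pdivlMr //; apply/ler_addgt0Pr => e e0.
  have [l0|l0] := leP (cmod l) 0.
    by rewrite (le_trans (mulr_le0_ge0 l0 (ltW rho0))) // addr_ge0 // ltW.
  pose r1 := Num.max (rho / 2) (rho - e / cmod l).
  have el0 : 0 < e / cmod l by rewrite divr_gt0.
  have r10 : 0 < r1 by rewrite lt_max divr_gt0.
  have r1r : r1 < rho by rewrite gt_max; apply/andP; split; lra.
  have := key _ r10 r1r; rewrite -lerBlDr => /(le_trans _); apply.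
  have -> : cmod l * rho - e = cmod l * (rho - e / cmod l) by field; rewrite gt_eqF.
  by rewrite ler_pM2l // le_max lexx orbT.
move=> r10 r1r; rewrite -ler_pdivlMr //; apply/ler_addgt0Pr => e e0.
have e2 : 0 < e / 2 by rewrite divr_gt0.
have [d d0 hd'] := hl _ e2.
pose s := Num.min (d / 2) r1.
have s0 : 0 < s by rewrite lt_min r10 divr_gt0.
have sd : s < d by rewrite gt_min; apply/orP; left; lra.
have sr1 : s <= r1 by rewrite ge_min lexx orbT.
pose f z := h (w + z) / z.
have fd z : s <= cmod z <= r1 -> exists l, cderiv f z l.
  move=> /andP[z1 z2]; have z0 : z != 0 by rewrite -cmod_gt0 (lt_le_trans s0).
  have [|l' hl'] := hd (w + z).
    by rewrite addrAC subrr add0r (le_lt_trans z2).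
  by eexists; exact: cderivM (cderiv_shift hl') (cderivV z0).
have [N0 hN] := cavg_const s0 sr1 fd e2.
have := hN (maxn N0 1) (leq_maxl _ _); set n := (2 ^ _)%N => K.
have n2 : (1 < n)%N by apply: (leq_ltn_trans (leq_maxr N0 1)); rewrite ltn_expl.
have n1 : (0 < n)%N by rewrite ltnW.
have K1 : cmod (cavg n f r1) <= B / r1.
  apply: cavg_bound => // [z zr|]; last exact: ltW.
  by rewrite cmodM cmodV zr ler_pM2r ?invr_gt0 // hB // addrAC subrr add0r zr.
have K2 : cmod (cavg n f s - l) <= e / 2.
  pose r z := (h (w + z) - h w - l * z) / z.
  have -> : cavg n f s - l = cavg n r s.
    rewrite (@cavg_eq n f (fun z => (h w * (z ^+ 0 / z ^+ 1) + l * (z ^+ 0 / z ^+ 0)) + r z)).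
    - rewrite !cavgD (cavgZ n (h w)) (cavgZ n l) !cavg_monom // mulr0 add0r mulr1; ring.
    - exact: ltW.
    - move=> z zs; have z0 : z != 0 by rewrite -cmod_gt0 zs.
      by rewrite /f /r expr1 expr0; field.
  apply: cavg_bound => // [z zs|]; last exact: ltW.
  have zp : 0 < cmod z by rewrite zs.
  by rewrite /r cmodM cmodV ler_pdivrMr // hd' // zs.
have -> : l = - (cavg n f s - l) + ((cavg n f s - cavg n f r1) + cavg n f r1) by ring.
rewrite (le_trans (cmodD _ _)) // cmodN.
have := cmodD (cavg n f s - cavg n f r1) (cavg n f r1); lra.
Qed.

(** ** Power series *)

(** Completeness of the complex numbers, from nested intervals for the real and
    the imaginary parts. *)
Lemma complete_rate (s : nat -> C R) (r : nat -> R) :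
  (forall n m, (n <= m)%N -> cmod (s m - s n) <= r n) ->
  exists l, forall n, cmod (l - s n) <= 2 * r n.
Proof.
move=> h.
have r0 n : 0 <= r n by apply: le_trans (cmod_ge0 _) (h n n (leqnn n)).
have hRe n m : (n <= m)%N -> `|cRe (s m) - cRe (s n)| <= r n.
  by move=> /h; apply: le_trans; rewrite -cReB cRe_le.
have hIm n m : (n <= m)%N -> `|cIm (s m) - cIm (s n)| <= r n.
  by move=> /h; apply: le_trans; rewrite -cImB cIm_le.
have [x hx] : exists x, forall n, cRe (s n) - r n <= x <= cRe (s n) + r n.
  apply: nested_sup => m n; have := r0 m; have := r0 n; case: (leqP m n) => [|/ltnW] /hRe.
    by rewrite ler_norml => /andP[]; lra.
  by rewrite ler_norml => /andP[]; lra.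
have [y hy] : exists x, forall n, cIm (s n) - r n <= x <= cIm (s n) + r n.
  apply: nested_sup => m n; have := r0 m; have := r0 n; case: (leqP m n) => [|/ltnW] /hIm.
    by rewrite ler_norml => /andP[]; lra.
  by rewrite ler_norml => /andP[]; lra.
exists (mkC x y) => n; rewrite (mkCE (_ - _)) (le_trans (cmod_mkC _ _)) //.
have := hx n; have := hy n; rewrite cReB cImB /= => h1 h2.
by rewrite mulr2n mulrDl mul1r lerD // ler_norml; lra.
Qed.

Definition psum (a : nat -> C R) (t : C R) (n : nat) := \sum_(k < n) a k * t ^+ k.

Lemma psumS a t n : psum a t n.+1 = psum a t n + a n * t ^+ n.
Proof. exact: (csum_recr n (fun k => a k * t ^+ k)). Qed.

Lemma psum_tail (a : nat -> C R) t (B x : R) n m : 0 <= x -> x < 1 ->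
  (forall k, cmod (a k * t ^+ k) <= B * x ^+ k) -> (n <= m)%N ->
  cmod (psum a t m - psum a t n) <= B * x ^+ n / (1 - x).
Proof.
move=> x0 x1 hB /subnKC <-.
have x1' : 0 < 1 - x by rewrite subr_gt0.
have B0 : 0 <= B.
  by have := hB 0%N; rewrite !expr0 !mulr1; apply: le_trans; exact: cmod_ge0.
move: (m - n)%N => k; elim: k n => [n|k IH n].
  rewrite addn0 subrr cmod0 divr_ge0 ?mulr_ge0 ?exprn_ge0 // ltW //.
rewrite addnS -addSn.
have -> : psum a t (n.+1 + k) - psum a t n =
   (psum a t (n.+1 + k) - psum a t n.+1) + a n * t ^+ n by rewrite psumS; ring.
rewrite (le_trans (cmodD _ _)) // (le_trans (lerD (IH n.+1) (hB n))) //.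
rewrite exprS le_eqVlt; apply/orP; left; apply/eqP; field.
by rewrite gt_eqF.
Qed.

Lemma psum_lim_tail (a : nat -> C R) t l (B x : R) n : 0 <= x -> x < 1 ->
  (forall k, cmod (a k * t ^+ k) <= B * x ^+ k) -> cconv (psum a t) l ->
  cmod (l - psum a t n) <= B * x ^+ n / (1 - x).
Proof.
move=> x0 x1 hB hl; apply/ler_addgt0Pr => e /hl[N hN].
have := hN (maxn N n) (leq_maxl _ _); rewrite cmod_distC => H1.
have H2 := psum_tail x0 x1 hB (leq_maxr N n).
have -> : l - psum a t n = (l - psum a t (maxn N n)) + (psum a t (maxn N n) - psum a t n) by ring.
by rewrite (le_trans (cmodD _ _)) // addrC lerD.
Qed.

Lemma geo_cvg0 (B x : R) : 0 <= x -> x < 1 -> forall e : R, 0 < e ->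
  exists N, forall n, (N <= n)%N -> B * x ^+ n <= e.
Proof.
move=> x0 x1 e e0.
have [B0|B0] := leP B 0.
  by exists 0%N => n _; rewrite (le_trans (mulr_le0_ge0 B0 _)) ?exprn_ge0 // ltW.
have := @cvg_expr R x; rewrite ger0_norm // => /(_ x1) /cvgrPdist_le/(_ _ (divr_gt0 e0 B0)).
move=> [N _ hN]; exists N => n /hN /=; rewrite sub0r normrN ger0_norm ?exprn_ge0 //.
by rewrite ler_pdivlMr // mulrC.
Qed.

Lemma psum_conv (a : nat -> C R) t (B x : R) : 0 <= x -> x < 1 ->
  (forall k, cmod (a k * t ^+ k) <= B * x ^+ k) -> exists l, cconv (psum a t) l.
Proof.
move=> x0 x1 hB.
have [l hl] := complete_rate (fun n m => psum_tail x0 x1 hB (n := n) (m := m)).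
exists l => e e0.
have [N hN] := geo_cvg0 (2 * B / (1 - x)) x0 x1 e0.
exists N => n /hN H; rewrite cmod_distC (le_trans (hl n)) // (le_trans _ H) //.
by rewrite le_eqVlt; apply/orP; left; apply/eqP; ring.
Qed.

(** Only the germ of [f] at [0] has to be the sum of the series: on a small circle
    the mean of [f z / z ^+ n] is [a n] up to aliasing, and by [cavg_const] it is
    the same on the large circle. No analytic continuation is involved. *)
Lemma coef_cavg (a : nat -> C R) f (d A rho : R) n : 0 < d -> 0 < rho ->
  (forall k, cmod (a k) * d ^+ k <= A) ->
  (forall t, cmod t < d -> cconv (psum a t) (f t)) ->
  (forall z, 0 < cmod z <= rho -> exists l, cderiv f z l) ->
  forall e : R, 0 < e -> exists N0, forall N, (N0 <= N)%N ->
    cmod (cavg (2 ^ N) (fun z => f z / z ^+ n) rho - a n) <= e.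
Proof.
move=> d0 rho0 hA hf df e e0; have e2 : 0 < e / 2 by rewrite divr_gt0.
pose s := Num.min (d / 2) rho.
have s0 : 0 < s by rewrite lt_min rho0 divr_gt0.
have sd : s <= d / 2 by rewrite ge_min lexx.
have sr1 : s <= rho by rewrite ge_min lexx orbT.
have fd z : s <= cmod z <= rho -> exists l, cderiv (fun z => f z / z ^+ n) z l.
  move=> /andP[z1 z2]; have z0 : 0 < cmod z by rewrite (lt_le_trans s0).
  have z0' : z ^+ n != 0 by rewrite expf_neq0 // -cmod_gt0.
  have [|l hl] := df z; first by rewrite z0.
  by eexists; exact: cderivM hl (cderiv_comp (cderivX n z) (cderivV z0')).
have [N1 hN1] := cavg_const s0 sr1 fd e2.
have [N2 hN2] := @geo_cvg0 (A / (1 - 2^-1) / s ^+ n) 2^-1 ltac:(lra) ltac:(lra) _ e2.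
exists (maxn N1 (maxn N2 n.+1)) => N; rewrite !geq_max => /andP[/hN1 K1 /andP[Na Nb]].
have nN : (N < 2 ^ N)%N by rewrite ltn_expl.
have n0 : (0 < 2 ^ N)%N by rewrite expn_gt0.
have K2 := hN2 _ (leq_trans Na (ltnW nN)).
move: n0 nN K1 K2; set M := (2 ^ N)%N => n0 nN K1 K2.
have K3 : cmod (cavg M (fun z => f z / z ^+ n) s - a n) <= e / 2.
  have Pn : cavg M (fun z => psum a z M / z ^+ n) s = a n.
    have -> : cavg M (fun z => psum a z M / z ^+ n) s =
       \sum_(k < M) a k * cavg M (fun z => z ^+ k / z ^+ n) s.
      rewrite /cavg.
      rewrite (eq_bigr (fun j : 'I_M => \sum_(k < M) a k *
         ((toC s * croot R M j) ^+ k / (toC s * croot R M j) ^+ n))).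
        rewrite exchange_big mulr_sumr; apply: eq_bigr => k _.
        by rewrite mulrCA -mulr_sumr.
      by move=> j _; rewrite /psum mulr_suml; apply: eq_bigr => k _; rewrite mulrA.
    have nM : (n < M)%N by rewrite (leq_ltn_trans _ nN) // ltnW.
    rewrite (bigD1 (Ordinal nM)) // cavg_monom // eqxx mulr1 big1.
      exact: addr0.
    move=> k kn; by rewrite cavg_monom // (negbTE (_ : (k : nat) != n)) ?mulr0.
  rewrite -Pn.
  rewrite (@cavg_eq M (fun z => f z / z ^+ n)
     (fun z => (f z - psum a z M) / z ^+ n + psum a z M / z ^+ n)); last 2 first.
  - exact: ltW.
  - by move=> z _; rewrite -mulrDl subrK.
  rewrite cavgD addrK; apply: cavg_bound => // [z zs|]; last exact: ltW.
  rewrite cmodM cmodV cmodX zs.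
  rewrite (le_trans _ K2) // mulrAC ler_pM2r ?invr_gt0 ?exprn_gt0 //.
  rewrite mulrAC; apply: psum_lim_tail => [| |k|].
  - lra.
  - lra.
  - rewrite cmodM cmodX zs (le_trans (y := cmod (a k) * (d / 2) ^+ k)) //.
      rewrite ler_wpM2l ?cmod_ge0 // lerXn2r // nnegrE; first exact: ltW.
      by rewrite divr_ge0 // ltW.
    by rewrite exprMn mulrA ler_wpM2r // exprn_ge0 // invr_ge0.
  - by apply: hf; rewrite zs (le_lt_trans sd) //; lra.
have -> : cavg M (fun z => f z / z ^+ n) rho - a n =
  (cavg M (fun z => f z / z ^+ n) s - a n) -
  (cavg M (fun z => f z / z ^+ n) s - cavg M (fun z => f z / z ^+ n) rho) by ring.
by rewrite (le_trans (cmodB _ _)) // (splitr e) lerD.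
Qed.

End Cauchy.

(** * Mean squares and finite differences *)

Section Parseval.
Variable R : realType.
Implicit Types (x y : R) (z v w u : C R) (f g h : C R -> C R) (n : nat).

Lemma csum_exchange I J (s : seq I) (t : seq J) (F : I -> J -> C R) :
  \sum_(i <- s) \sum_(j <- t) F i j = \sum_(j <- t) \sum_(i <- s) F i j.
Proof. exact: exchange_big. Qed.

Lemma csum_single n (k : 'I_n) (F : 'I_n -> C R) :
  (forall i, i != k -> F i = 0) -> \sum_(i < n) F i = F k.
Proof.
move=> F0; have : \sum_(i < n) F i = F k + \sum_(i < n | i != k) F i by exact: bigD1.
by rewrite [X in _ = _ + X]big1 // addr0.
Qed.

Lemma conj_toC x : (toC x)^* = toC x.
Proof.
apply: conj_Creal; have [x0|x0] := leP 0 x.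
  by apply: ger0_real; rewrite -toC0 le_toC.
by apply: ler0_real; rewrite -toC0 le_toC ltW.
Qed.

Lemma conjM z w : (z * w)^* = z^* * w^*.
Proof. exact: rmorphM. Qed.

Lemma conjX z n : (z ^+ n)^* = z^* ^+ n.
Proof. exact: rmorphXn. Qed.

Lemma conj_sum n (F : 'I_n -> C R) : (\sum_(i < n) F i)^* = \sum_(i < n) (F i)^*.
Proof. exact: rmorph_sum. Qed.

Lemma sqr_cmod_conj z : toC (cmod z ^+ 2) = z * z^*.
Proof. by rewrite toCX -normE normCK. Qed.

Lemma conj_croot n j : (croot R n j)^* = (croot R n j)^-1.
Proof.
apply: (mulfI (croot_neq0 R n j)).
by rewrite -sqr_cmod_conj cmod_croot expr1n toC1 divff ?croot_neq0.
Qed.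

(** Parseval's identity: by [sum_croot_orth] the cross terms cancel. *)
Lemma parseval_geo n (rho : R) :
  \sum_(j < n) cmod (\sum_(k < n) (toC rho * croot R n j) ^+ k) ^+ 2 =
  n%:R * \sum_(k < n) (rho ^+ 2) ^+ k.
Proof.
apply: (@toC_inj R); rewrite toCM toC_nat !toC_sum.
rewrite (eq_bigr (fun j : 'I_n => \sum_(k < n) \sum_(l < n)
   toC rho ^+ k * toC rho ^+ l * (croot R n j ^+ k / croot R n j ^+ l))).
  rewrite csum_exchange mulr_sumr; apply: eq_bigr => k _.
  rewrite csum_exchange (@csum_single n k).
    by rewrite -mulr_sumr sum_croot_orth // eqxx mulrC !toCX -expr2 -!exprM mulnC.
  move=> l lk; rewrite -mulr_sumr sum_croot_orth //.
  by rewrite (negbTE (_ : (k : nat) != l)) ?mulr0 // eq_sym.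
move=> j _; rewrite sqr_cmod_conj conj_sum mulr_suml; apply: eq_bigr => k _.
rewrite mulr_sumr; apply: eq_bigr => l _.
by rewrite conjX conjM conj_toC conj_croot !(exprMn _ (toC rho)) exprVn mulrACA.
Qed.

(** As [z ^+ n = - rho ^+ n], the geometric sum gives [1 <= |z - 1| |sum_k z^k|], so
    that the mean of [|z - 1|^-2] is at most a mean square known by
    [parseval_geo]. *)
Lemma sum_pole_le n (rho : R) : (0 < n)%N -> 0 < rho < 1 ->
  \sum_(j < n) (cmod (toC rho * croot R n j - 1) ^+ 2)^-1 <= n%:R / (1 - rho).
Proof.
move=> n0 /andP[r0 r1].
have K (j : 'I_n) : (cmod (toC rho * croot R n j - 1) ^+ 2)^-1 <=
    cmod (\sum_(k < n) (toC rho * croot R n j) ^+ k) ^+ 2.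
  set z := toC rho * croot R n j.
  have zn : z ^+ n = - toC (rho ^+ n) by rewrite /z exprMn crootXn // mulrN1 toCX.
  have := subrX1 z n; rewrite zn => /(congr1 (@cmod R)); rewrite cmodM.
  have rn0 : 0 <= rho ^+ n by rewrite exprn_ge0 // ltW.
  rewrite -opprD cmodN -{1}toC1 -toCD cmod_toC_ge0; last by rewrite addr_ge0 // ltW.
  set p := cmod (z - 1); set q := cmod _ => E.
  have p0 : 0 < p.
    rewrite lt_def cmod_ge0 andbT; apply/eqP => p0; move: E; rewrite p0 mul0r => /eqP.
    by rewrite gt_eqF // ltr_wpDl.
  have pq : 1 <= p * q by rewrite -E lerDr.
  rewrite -exprVn lerXn2r ?nnegrE ?invr_ge0 ?cmod_ge0 //.
  by rewrite -(ler_pM2l p0) divff // gt_eqF.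
rewrite (le_trans (ler_sum _ (fun j _ => K j))) // parseval_geo ler_pM2l ?ltr0n //.
have rho1 : rho ^+ 2 <= rho by rewrite expr2 ler_piMl // ltW.
have r10 : 0 < 1 - rho by rewrite subr_gt0.
rewrite -[X in _ <= X]mul1r ler_pdivlMr //.
rewrite (le_trans (y := (\sum_(k < n) rho ^+ k) * (1 - rho))) //.
  rewrite ler_wpM2r //; first exact: ltW. 
  apply: ler_sum => k _.
  by rewrite lerXn2r ?nnegrE // ?exprn_ge0 // ltW.
have := subrX1 rho n; set S := \sum_(k < n) _ => E.
have -> : S * (1 - rho) = 1 - rho ^+ n by rewrite -[1 - rho ^+ n]opprB E; ring.
by rewrite lerBlDr lerDl exprn_ge0 // ltW.
Qed.

(** ** Finite differences *)

Definition fdiff (s : C R) h u := h u - h (u + s).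
(** A multiplicative difference, which multiplies the coefficient of [z ^+ k] by
    [1 - l ^+ k]. *)
Definition mdiff (l : C R) f z := f z - f (l * z).

(** Each difference costs a radius [2 sigma] and gains [cmod s / sigma], by Cauchy's
    estimate and the mean value inequality. *)
Lemma fdiff_bound m h (M sigma : R) (s : C R) : 0 < sigma -> cmod s <= sigma ->
  (forall u, cmod u < m.*2.+1%:R * sigma -> cmod (h u) <= M /\ exists l, cderiv h u l) ->
  cmod (iter m (fdiff s) h 0) <= M * (cmod s / sigma) ^+ m.
Proof.
move=> sg0 ss; elim: m h M => [|m IH] h M hh.
  by rewrite expr0 mulr1; have [] := hh 0; rewrite ?cmod0 ?mul1r.
rewrite iterSr exprS mulrA; apply: IH => u hu.
have E : m.+1.*2.+1%:R * sigma = m.*2.+1%:R * sigma + 2 * sigma.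
  by rewrite doubleS -[m.*2.+3]addn2 natrD mulrDl.
have us : cmod (u + s) < m.+1.*2.+1%:R * sigma.
  by rewrite (le_lt_trans (cmodD _ _)) // E; lra.
have u1 : cmod u < m.+1.*2.+1%:R * sigma by rewrite E; lra.
have [_ [l1 dl1]] := hh _ u1; have [_ [l2 dl2]] := hh _ us.
split; last first.
  rewrite /fdiff; exists (l1 - l2); apply: cderivB => //.
  have := @cderiv_shift R h u s l2; rewrite addrC => /(_ dl2).
  by apply: cderiv_ext ltr01 _ => w _; rewrite addrC.
have seg (t : R) : 0 <= t <= 1 -> exists2 l, cderiv h (u + toC t * s) l & cmod l <= M / sigma.
  move=> t01.
  have ts : cmod (toC t * s) <= sigma.
    rewrite cmodM cmod_toC_ge0; last by case/andP: t01.
    by rewrite (le_trans _ ss) // ler_piMl ?cmod_ge0 //; case/andP: t01.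
  have bd z : cmod (z - (u + toC t * s)) < sigma -> cmod z < m.+1.*2.+1%:R * sigma.
    move=> hz; rewrite -[z](subrK (u + toC t * s)) (le_lt_trans (cmodD _ _)) //.
    by have := cmodD u (toC t * s); rewrite E; lra.
  have [|_ [l dl]] := hh (u + toC t * s); first by apply: bd; rewrite subrr cmod0.
  exists l => //; apply: (cauchy_estimate (h := h) sg0) dl => z /bd /hh [] //.
by rewrite /fdiff cmod_distC mulrCA mulrC; apply: mean_value_ineq.
Qed.

End Parseval.

(** * The transfer theorem *)

Section Transfer.
Variable R : realType.
Implicit Types (x y : R) (z v w u : C R) (f g h : C R -> C R) (n m : nat).

Lemma iter_fdiff_cexp m f z (s : C R) u :
  iter m (fdiff s) (fun v => f (z * cexp (- v))) u =
  iter m (mdiff (cexp (- s))) f (z * cexp (- u)).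
Proof.
elim: m u => [//|m IH] u; rewrite !iterS /fdiff /mdiff !IH opprD cexpD.
by rewrite mulrA [z * _ * cexp (- s)]mulrC.
Qed.

Lemma mdiff_psum (a : nat -> C R) f (d : R) (l : C R) : cmod l <= 1 ->
  (forall t, cmod t < d -> cconv (psum a t) (f t)) ->
  forall t, cmod t < d -> cconv (psum (fun k => a k * (1 - l ^+ k)) t) (mdiff l f t).
Proof.
move=> l1 hf t td e e0; have e2 : 0 < e / 2 by rewrite divr_gt0.
have [N1 h1] := hf _ td _ e2.
have ltd : cmod (l * t) < d by rewrite cmodM (le_lt_trans _ td) // ler_piMl ?cmod_ge0.
have [N2 h2] := hf _ ltd _ e2.
exists (maxn N1 N2) => n; rewrite geq_max => /andP[/h1 K1 /h2 K2].
have -> : psum (fun k => a k * (1 - l ^+ k)) t n = psum a t n - psum a (l * t) n.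
  rewrite /psum -sumrB; apply: eq_bigr => k _.
  by rewrite (exprMn _ l); ring.
rewrite /mdiff.
have -> : psum a t n - psum a (l * t) n - (f t - f (l * t)) =
  (psum a t n - f t) - (psum a (l * t) n - f (l * t)) by ring.
by rewrite (le_trans (cmodB _ _)) // (splitr e) lerD.
Qed.

Lemma iter_mdiff_psum m (a : nat -> C R) f (d : R) (l : C R) : cmod l <= 1 ->
  (forall t, cmod t < d -> cconv (psum a t) (f t)) ->
  forall t, cmod t < d ->
  cconv (psum (fun k => a k * (1 - l ^+ k) ^+ m) t) (iter m (mdiff l) f t).
Proof.
move=> l1; elim: m a f => [|m IH] a f hf t td.
  rewrite (_ : (fun k => _) = a); first exact: hf.
  by apply/funext => k; rewrite expr0 mulr1.
rewrite iterSr.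
rewrite (_ : (fun k => _) = (fun k => a k * (1 - l ^+ k) * (1 - l ^+ k) ^+ m)).
  by apply: IH => //; exact: mdiff_psum.
by apply/funext => k; rewrite exprS mulrA.
Qed.

Lemma iter_mdiff_deriv m f (l : C R) (rho : R) : l != 0 -> cmod l <= 1 ->
  (forall z, 0 < cmod z <= rho -> exists l', cderiv f z l') ->
  forall z, 0 < cmod z <= rho -> exists l', cderiv (iter m (mdiff l) f) z l'.
Proof.
move=> l0 l1 hf; elim: m => [//|m IH] z zr; rewrite iterS /mdiff.
have [a ha] := IH z zr.
have [|b hb] := IH (l * z).
  case/andP: zr => z0 zr; rewrite cmodM mulr_gt0 ?cmod_gt0 -?cmod_gt0 //=.
    by rewrite (le_trans _ zr) // ler_piMl // ltW.
  by rewrite cmod_gt0.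
eexists; apply: cderivB ha (cderiv_comp (cderivZ l (cderiv_id z)) hb).
Qed.

Lemma powRE x (a : R) : 0 < x -> x `^ a = expR (a * ln x).
Proof. by move=> x0; rewrite /powR gt_eqF. Qed.

Lemma powR_ratio_le x y c (a : R) : 0 < x -> 0 < y -> 1 <= c ->
  x <= c * y -> y <= c * x -> x `^ a <= c `^ `|a| * y `^ a.
Proof.
move=> x0 y0 c1 xy yx; have c0 : 0 < c by apply: lt_le_trans c1.
rewrite !powRE // -expRD ler_expR.
have l1 : ln x <= ln c + ln y by rewrite -lnM ?posrE // ler_ln ?posrE ?mulr_gt0.
have l2 : ln y <= ln c + ln x by rewrite -lnM ?posrE // ler_ln ?posrE ?mulr_gt0.
have [a0|a0] := leP 0 a.
  by rewrite ger0_norm // -mulrDr ler_wpM2l.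
have l3 : 0 <= ln c + ln x - ln y by lra.
by rewrite ltr0_norm //; have := mulr_le0_ge0 (ltW a0) l3; lra.
Qed.

Lemma powR_le_neg x y (a : R) : 0 < x -> x <= y -> a <= 0 -> y `^ a <= x `^ a.
Proof.
move=> x0 xy a0; have y0 : 0 < y by apply: lt_le_trans xy.
by rewrite !powRE // ler_expR ler_wnM2l // ler_ln ?posrE.
Qed.

Lemma cexp_lip : exists2 d : R, 0 < d & forall h : C R, cmod h < d -> cmod (cexp h - 1) <= 2 * cmod h.
Proof.
have [d d0 hd] := cderiv_lip (@cderiv_cexp0 R); exists d => // h /hd.
by rewrite add0r cexp0 cmod1.
Qed.

(** The domain [Delta0 1 R1 phi] with [kappa = cos phi]: the condition on the
    argument becomes one on the cosine, and excludes [1] by strictness. *)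
Definition indented (R1 kappa : R) z :=
  cmod z < R1 /\ cRe (z - 1) < kappa * cmod (z - 1).

Lemma indented_disc (R1 kappa : R) z : 1 < R1 -> 0 < kappa -> cmod z < 1 -> indented R1 kappa z.
Proof.
move=> R11 k0 z1; split; first exact: lt_trans R11.
rewrite (lt_le_trans (y := 0)) ?mulr_ge0 ?cmod_ge0 ?(ltW k0) //.
rewrite cReB -toC1 /=; have := cRe_le z; have := ler_norm (cRe z); lra.
Qed.

(** Inside the unit disc [Re (z - 1) <= 0], whereas the domain also allows small
    positive values of [Re (z - 1) / |z - 1|]; this leaves room for a disc of
    radius proportional to [cmod (z - 1)]. *)
Lemma indented_ball (R1 kappa : R) : 1 < R1 -> 0 < kappa < 1 ->
  exists2 c : R, 0 < c <= 1/2 & forall z w, cmod z < 1 ->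
    cmod (w - z) <= c * cmod (z - 1) ->
    indented R1 kappa w /\ cmod (w - 1) <= 2 * cmod (z - 1) /\ cmod (z - 1) <= 2 * cmod (w - 1).
Proof.
move=> R11 /andP[k0 k1].
pose c := Num.min (kappa / 4) ((R1 - 1) / 4).
have c0 : 0 < c by rewrite lt_min !divr_gt0 // subr_gt0.
have c1 : c <= kappa / 4 by rewrite ge_min lexx.
have c2 : c <= (R1 - 1) / 4 by rewrite ge_min lexx orbT.
exists c; first by rewrite c0; lra.
move=> z w z1 hw.
have q0 : 0 < cmod (z - 1).
  by rewrite cmod_gt0 subr_eq0; apply/eqP => E; rewrite E cmod1 ltxx in z1.
set q := cmod (z - 1) in hw q0 *.
have q2 : q <= 2 by rewrite /q (le_trans (cmodB _ _)) // cmod1; lra.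
have E : w - 1 = (w - z) + (z - 1) by ring.
have E' : z - 1 = (w - 1) - (w - z) by ring.
have a1 : cmod (w - 1) <= c * q + q by rewrite E (le_trans (cmodD _ _)) // lerD2r.
have a2 : q <= cmod (w - 1) + c * q by rewrite /q {1}E' (le_trans (cmodB _ _)) // lerD2l.
have cq : c * q <= 1/4 * q by rewrite ler_wpM2r ?ltW //; lra.
have cR : c * q <= (R1 - 1) / 4 * 2 by rewrite ler_pM // ltW.
split; last by split; lra.
split.
  by rewrite -[w](subrK z) (le_lt_trans (cmodD _ _)) //; lra.
have r1 : cRe (w - 1) <= c * q.
  rewrite E cReD; have := cRe_le (w - z); have := ler_norm (cRe (w - z)).
  have := cRe_le z; have := ler_norm (cRe z); rewrite [cRe (z - 1)]cReB -[in cRe 1]toC1 /=; lra.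
rewrite (le_lt_trans r1) //.
have kw : kappa * (q * (3/4)) <= kappa * cmod (w - 1) by rewrite ler_pM2l //; lra.
have : c * q <= kappa / 4 * q by rewrite ler_wpM2r // ltW.
have : 0 < kappa * q by rewrite mulr_gt0.
lra.
Qed.

(** The [m]-th multiplicative difference with ratio [exp (- s)], [s = c1 / (2 n)],
    multiplies [a n] by the constant [(1 - exp (- c1 / 2)) ^+ m], while by
    [fdiff_bound] its values are [O(n^-m |z - 1|^(alpha - m))]. On the circle of radius
    [n / (n + 1)], where [|z - 1| >= 1 / (2 n)], this is at most
    [O(n^(- alpha - 2)) |z - 1|^-2], whose mean is [O(n^(- alpha - 1))]. Bounding [a n]
    by this mean needs no contour leaving the unit disc. *)
Lemma transfer (a : nat -> C R) f (R1 kappa M alpha d A : R) :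
  1 < R1 -> 0 < kappa < 1 -> 0 < d ->
  (forall k, cmod (a k) * d ^+ k <= A) ->
  (forall t, cmod t < d -> cconv (psum a t) (f t)) ->
  (forall z, indented R1 kappa z -> exists l, cderiv f z l) ->
  (forall z, indented R1 kappa z -> cmod (f z) <= M * cmod (z - 1) `^ alpha) ->
  exists B : R, forall n, (0 < n)%N -> cmod (a n) <= B * n%:R `^ (- alpha - 1).
Proof.
move=> R11 k01 d0 hA hf hd hM; have k0 : 0 < kappa by case/andP: k01.
have [c /andP[c0 c12] hc] := indented_ball R11 k01.
have [de de0 hde] := cexp_lip.
have M0 : 0 <= M.
  have : 0 <= M * cmod (0 - 1 : C R) `^ alpha.
    by apply: le_trans (hM _ (indented_disc R11 k0 _)); rewrite ?cmod_ge0 ?cmod0.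
  by rewrite sub0r cmodN cmod1 powR1 mulr1.
(* With this many differences the exponent [alpha - m] is at most [-2], so that
   [sum_pole_le] applies. *)
pose m := Num.bound (`|alpha| + 2).
have hm : alpha - m%:R + 2 <= 0.
  have := archi_boundP (addr_ge0 (normr_ge0 alpha) (ler0n R 2)); rewrite -/m.
  by have := ler_norm alpha; lra.
pose mm : R := m.*2.+1%:R; have mm0 : 0 < mm by rewrite ltr0Sn.
pose c1 := Num.min (c / 2) (de / 2) / mm.
have c10 : 0 < c1 by rewrite divr_gt0 // lt_min !divr_gt0.
have mc1 : mm * c1 = Num.min (c / 2) (de / 2) by rewrite /c1 mulrC divfK // gt_eqF.
have c1c : mm * c1 * 2 <= c by rewrite mc1 -ler_pdivlMr // ge_min lexx.
have c1d : mm * c1 * 2 <= de by rewrite mc1 -ler_pdivlMr // ge_min lexx orbT.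
pose M' := M * 2 `^ `|alpha|.
have M'0 : 0 <= M' by rewrite mulr_ge0 // powR_ge0.
(* In the variable [u] of [z * cexp (- u)] the differences are additive, and the
   domain contains a disc of radius proportional to [cmod (z - 1)]. *)
have diff_le z (s : R) : cmod z < 1 -> 0 < s -> s <= c1 * cmod (z - 1) ->
    cmod (iter m (mdiff (toC (expR (- s)))) f z) <=
      M' * cmod (z - 1) `^ alpha * (s / (c1 * cmod (z - 1))) ^+ m.
  move=> z1 s0 hs.
  have q0 : 0 < cmod (z - 1).
    by rewrite cmod_gt0 subr_eq0; apply/eqP => E; rewrite E cmod1 ltxx in z1.
  have q2 : cmod (z - 1) <= 2 by rewrite (le_trans (cmodB _ _)) // cmod1; lra.
  have := iter_fdiff_cexp m f z (toC s) 0.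
  rewrite oppr0 cexp0 mulr1 -toCN cexp_toC => <-.
  have cs : cmod (toC s) = s by rewrite cmod_toC_ge0 // ltW.
  rewrite -{2}cs; apply: fdiff_bound; [by rewrite mulr_gt0|by rewrite cs|].
  move=> u hu.
  have uc : cmod (cexp (- u) - 1) <= c * cmod (z - 1).
    have ude : cmod (- u) < de.
      rewrite cmodN (lt_le_trans hu) // (le_trans _ c1d) // -/mm mulrA.
      by rewrite ler_wpM2l // mulr_ge0 // ltW.
    rewrite (le_trans (hde _ ude)) // cmodN.
    rewrite (le_trans (y := 2 * (mm * (c1 * cmod (z - 1))))) //.
      by rewrite ler_pM2l // ltW.
    have -> : 2 * (mm * (c1 * cmod (z - 1))) = mm * c1 * 2 * cmod (z - 1) by ring.
    by rewrite ler_wpM2r ?cmod_ge0.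
  have hz : cmod (z * cexp (- u) - z) <= c * cmod (z - 1).
    have -> : z * cexp (- u) - z = z * (cexp (- u) - 1) by ring.
    by rewrite cmodM (le_trans _ uc) // ler_piMl ?cmod_ge0 // ltW.
  have [D1 [D2 D3]] := hc z (z * cexp (- u)) z1 hz.
  split; last first.
    have [l hl] := hd _ D1.
    have dN : cderiv (fun v => - v) u (-1) by exact: cderivN (cderiv_id u).
    eexists; exact: cderiv_comp (cderivZ z (cderiv_comp dN (cderiv_cexp (- u)))) hl.
  have w0 : 0 < cmod (z * cexp (- u) - 1) by lra.
  rewrite (le_trans (hM _ D1)) // /M' -mulrA ler_wpM2l // powR_ratio_le //.
  by rewrite (ler_nat _ 1).
pose E := (1 - expR (- (c1 / 2))) ^+ m.
have E0 : 0 < E by rewrite exprn_gt0 // subr_gt0 -expR0 ltr_expR oppr_lt0 divr_gt0.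
exists (expR 1 * M' / E * 2 `^ (- alpha - 1)) => n n0.
have n0' : 0 < n%:R :> R by rewrite ltr0n.
pose rho := n%:R / (n%:R + 1) : R.
have n20 : 0 < 2 * n%:R :> R by rewrite mulr_gt0.
have n1 : 0 < n%:R + 1 :> R by rewrite ltr_wpDr.
have rho01 : 0 < rho < 1 by rewrite divr_gt0 //= ltr_pdivrMr // mul1r ltrDl.
have [rho0 rho1] := andP rho01.
have rhoE : 1 - rho = (n%:R + 1)^-1 by rewrite /rho; field; rewrite gt_eqF.
pose s := c1 / (2 * n%:R) : R.
have s0 : 0 < s by rewrite divr_gt0 // mulr_gt0.
pose l := toC (expR (- s)) : C R.
have l0 : l != 0 by rewrite -cmod_gt0 cmod_toC_ge0 ?expR_ge0 // expR_gt0.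
have l1 : cmod l <= 1.
  by rewrite cmod_toC_ge0 ?expR_ge0 // -expR0 ler_expR oppr_le0 ltW.
have n2 : (2 * n%:R)^-1 <= (n%:R + 1)^-1 :> R.
  rewrite lef_pV2 ?posrE ?mulr_gt0 //; have : 1 <= n%:R :> R by rewrite ler1n.
  lra.
have far z : cmod z = rho -> (2 * n%:R)^-1 <= cmod (z - 1).
  move=> zr; rewrite (le_trans n2) // -rhoE cmod_distC.
  by have := cmodB_ge 1 z; rewrite cmod1 zr.
pose g z := iter m (mdiff l) f z.
have gle z : cmod z = rho -> cmod (g z) <=
    M' * (2 * n%:R) `^ (- alpha - 2) * (cmod (z - 1) ^+ 2)^-1.
  move=> zr; have fz := far _ zr.
  have nn0 : 0 < (2 * n%:R)^-1 :> R by rewrite invr_gt0 mulr_gt0.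
  have q0 : 0 < cmod (z - 1) by apply: lt_le_trans fz.
  rewrite (le_trans (diff_le z s _ s0 _)) ?zr //.
    by rewrite /s ler_pM2l.
  rewrite -(mulrA M') -(mulrA M' (_ `^ (- alpha - 2))) ler_wpM2l //.
  have -> : s / (c1 * cmod (z - 1)) = (2 * n%:R)^-1 / cmod (z - 1).
    by rewrite /s; field; rewrite !gt_eqF.
  set y := (2 * n%:R)^-1 in nn0 fz *; set q := cmod (z - 1) in fz q0 *.
  have -> : (2 * n%:R) `^ (- alpha - 2) = y `^ (alpha + 2).
    have yV : 2 * n%:R = y^-1 by rewrite invrK.
    by rewrite yV !powRE ?invr_gt0 // lnV ?posrE // mulrN -mulNr opprD !opprK.
  have -> : q `^ alpha * (y / q) ^+ m = y ^+ m * q `^ (alpha - m%:R + 2) / q ^+ 2.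
    rewrite powRD; last by rewrite (gt_eqF q0) implybT.
    rewrite powRB; last by rewrite (gt_eqF q0) implybT.
    rewrite !powR_mulrn ?ltW // expr_div_n; field; rewrite expf_neq0 ?gt_eqF //.
  rewrite ler_pM2r ?invr_gt0 ?exprn_gt0 //.
  rewrite (le_trans (ler_wpM2l _ (powR_le_neg nn0 fz hm))) ?exprn_ge0 ?(ltW nn0) //.
  rewrite -powR_mulrn ?(ltW nn0) // -powRD; last by rewrite (gt_eqF nn0) implybT.
  by rewrite le_eqVlt; apply/orP; left; apply/eqP; congr powR; ring.
pose b k := a k * (1 - l ^+ k) ^+ m.
have bA k : cmod (b k) * d ^+ k <= A * 2 ^+ m.
  have lk : cmod (l ^+ k) <= 1 by rewrite cmodX exprn_ile1 ?cmod_ge0.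
  rewrite /b cmodM cmodX mulrAC ler_pM ?mulr_ge0 ?exprn_ge0 ?cmod_ge0 ?(ltW d0) //.
  rewrite lerXn2r ?nnegrE ?cmod_ge0 // (le_trans (cmodB _ _)) // cmod1; lra.
have fd z : 0 < cmod z <= rho -> exists l, cderiv f z l.
  move=> /andP[_ zr]; apply: hd; apply: indented_disc => //; exact: le_lt_trans rho1.
have bn : cmod (b n) <= expR 1 * M' * (2 * n%:R) `^ (- alpha - 1).
  apply/ler_addgt0Pr => e e0.
  have [N0 hN0] := @coef_cavg R b g d (A * 2 ^+ m) rho n d0 rho0 bA
    (iter_mdiff_psum m l1 hf) (iter_mdiff_deriv m l0 l1 fd) e e0.
  have K := hN0 _ (leqnn N0); set Q := (2 ^ N0)%N in K.
  have Q0 : (0 < Q)%N by rewrite expn_gt0.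
  rewrite -(subrK (cavg Q (fun z => g z / z ^+ n) rho) (b n)) (le_trans (cmodD _ _)) //.
  rewrite cmod_distC addrC lerD //.
  have rn : (rho ^+ n)^-1 <= expR 1.
    rewrite -exprVn /rho invf_div.
    have -> : (n%:R + 1) / n%:R = 1 + n%:R^-1 :> R by field; rewrite gt_eqF.
    have -> : expR 1 = expR (n%:R^-1) ^+ n :> R.
      by rewrite -expRM_natl divff // gt_eqF.
    by rewrite lerXn2r ?nnegrE ?expR_ge0 ?expR_ge1Dx // addr_ge0 // invr_ge0 ltW.
  pose W := M' * (2 * n%:R) `^ (- alpha - 2).
  have W0 : 0 <= W by rewrite mulr_ge0 // powR_ge0.
  rewrite /cavg cmodM cmodV cmod_nat mulrC ler_pdivrMr ?ltr0n //.
  rewrite (le_trans (cmod_sum _ _ _)) //.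
  rewrite (le_trans (y := \sum_(j < Q) expR 1 * W * (cmod (toC rho * croot R Q j - 1) ^+ 2)^-1)) //.
    apply: ler_sum => j _.
    have zr : cmod (toC rho * croot R Q j) = rho.
      by rewrite cmodM cmod_croot mulr1 cmod_toC_ge0 // ltW.
    rewrite cmodM cmodV cmodX zr mulrC -mulrA ler_pM ?invr_ge0 ?exprn_ge0 ?cmod_ge0 ?(ltW rho0) //.
    exact: gle.
  rewrite -mulr_sumr (le_trans (ler_wpM2l _ (sum_pole_le Q0 rho01))) //.
    by rewrite mulr_ge0 // expR_ge0.
  have key : W * (n%:R + 1) <= M' * (2 * n%:R) `^ (- alpha - 1).
    have -> : - alpha - 1 = (- alpha - 2) + 1 by ring.
    rewrite powRD; last by rewrite (gt_eqF n20) implybT.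
    rewrite powRr1 ?(ltW n20) // mulrA ler_wpM2l //.
    have : 1 <= n%:R :> R by rewrite ler1n.
    lra.
  rewrite rhoE invrK.
  have -> : expR 1 * W * (Q%:R * (n%:R + 1)) = expR 1 * Q%:R * (W * (n%:R + 1)) by ring.
  have -> : expR 1 * M' * (2 * n%:R) `^ (- alpha - 1) * Q%:R =
    expR 1 * Q%:R * (M' * (2 * n%:R) `^ (- alpha - 1)) by ring.
  by rewrite ler_wpM2l // mulr_ge0 // expR_ge0.
have bnE : cmod (b n) = cmod (a n) * E.
  rewrite /b cmodM cmodX /E; congr (_ * _ ^+ _).
  have -> : l ^+ n = toC (expR (- (c1 / 2))).
    rewrite -toCX -expRM_natl; congr (toC (expR _)).
    by rewrite /s; field; rewrite gt_eqF.
  rewrite -toC1 -toCB cmod_toC_ge0 // subr_ge0 -expR0 ler_expR oppr_le0.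
  by rewrite divr_ge0 // ltW.
move: bn; rewrite bnE -ler_pdivlMr // => /le_trans; apply.
rewrite powRM ?(ltW n0') //.
by rewrite le_eqVlt; apply/orP; left; apply/eqP; ring.
Qed.

End Transfer.

(** * Differentiation and exponentials of power series *)

Section PowerSeries.
Variable R : realType.
Implicit Types (x y : R) (z v w u t : C R) (f g h : C R -> C R) (n m : nat).

Definition dcoef (a : nat -> C R) (k : nat) : C R := k.+1%:R * a k.+1.

Lemma psum0 (a : nat -> C R) t : psum a t 0 = 0.
Proof. exact: big_ord0. Qed.

Lemma cderiv_psum (a : nat -> C R) n t :
  cderiv (fun u => psum a u n.+1) t (psum (dcoef a) t n).
Proof.
elim: n => [|n IH].
  rewrite psum0; apply: cderiv_ext ltr01 _ (cderiv_cst (a 0%N) t) => w _.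
  by rewrite psumS psum0 add0r expr0 mulr1.
rewrite psumS; apply: cderiv_ext ltr01 _ (cderivD IH (cderiv_eq (cderivZ (a n.+1) (cderivX n.+1 t)) _)).
  by move=> w _; rewrite [RHS]psumS.
by rewrite /dcoef mulrCA mulrA.
Qed.

Lemma psum_bound (a : nat -> C R) t (B x : R) n : 0 <= x -> x < 1 ->
  (forall k, cmod (a k * t ^+ k) <= B * x ^+ k) ->
  cmod (psum a t n) <= B / (1 - x).
Proof.
move=> x0 x1 hB; have := psum_tail x0 x1 hB (leq0n n).
by rewrite psum0 subr0 expr0 mulr1.
Qed.

Lemma coef_geo (a : nat -> C R) (rho B : R) t (s : R) k : 0 < rho ->
  (forall k, cmod (a k) * rho ^+ k <= B) -> cmod t <= s ->
  cmod (a k * t ^+ k) <= B * (s / rho) ^+ k.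
Proof.
move=> r0 hB ts; have s0 : 0 <= s by apply: le_trans ts; exact: cmod_ge0.
rewrite cmodM cmodX (le_trans (y := cmod (a k) * s ^+ k)) //.
  by rewrite ler_wpM2l ?cmod_ge0 // lerXn2r ?nnegrE ?cmod_ge0.
have -> : cmod (a k) * s ^+ k = cmod (a k) * rho ^+ k * (s / rho) ^+ k.
  by rewrite -mulrA -exprMn mulrCA divff ?mulr1 // gt_eqF.
by rewrite ler_wpM2r // exprn_ge0 // divr_ge0 // ltW.
Qed.

(** The partial sums are uniformly bounded on a slightly larger disc, so Cauchy's
    estimate bounds their second derivatives; the first order expansions then hold
    with an error uniform in [n], and pass to the limit. *)
Lemma psum_deriv (a : nat -> C R) f (rho B : R) : 0 < rho ->
  (forall k, cmod (a k) * rho ^+ k <= B) ->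
  (forall t, cmod t < rho -> cconv (psum a t) (f t)) ->
  forall t, cmod t < rho ->
  exists2 l, cconv (psum (dcoef a) t) l & cderiv f t l.
Proof.
move=> r0 hB hf t tr.
pose d := (rho - cmod t) / 2; have d0 : 0 < d by rewrite divr_gt0 // subr_gt0.
pose x := (cmod t + d) / rho.
have x0 : 0 <= x by rewrite divr_ge0 ?addr_ge0 ?cmod_ge0 ?ltW.
have x1 : x < 1 by rewrite ltr_pdivrMr // mul1r /d; lra.
have B0 : 0 <= B by apply: le_trans (hB 0%N); rewrite mulr_ge0 ?cmod_ge0.
have x1' : 0 < 1 - x by rewrite subr_gt0.
pose S := B / (1 - x); have S0 : 0 <= S by rewrite divr_ge0 // ltW.
have near u : cmod (u - t) < d -> cmod u <= cmod t + d.
  by move=> ut; rewrite -[u](subrK t) (le_trans (cmodD _ _)) // addrC lerD2l ltW.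
have geo u : cmod (u - t) < d -> forall k, cmod (a k * u ^+ k) <= B * x ^+ k.
  by move=> /near hu k; exact: coef_geo.
have tail n m : (n <= m)%N -> cmod (psum (dcoef a) t m - psum (dcoef a) t n)
    <= B * x ^+ n.+1 / (1 - x) / d.
  move=> nm.
  apply: (@cauchy_estimate R (fun u => psum a u m.+1 - psum a u n.+1) t) => //.
  - by move=> z zt; apply: psum_tail => //; exact: geo.
  - by move=> z zt; eexists; exact: cderivB (cderiv_psum _ _ _) (cderiv_psum _ _ _).
  - exact: cderivB (cderiv_psum _ _ _) (cderiv_psum _ _ _).
have [l hl] := complete_rate tail.
have cl : cconv (psum (dcoef a) t) l.
  move=> e e0; have [N hN] := geo_cvg0 (2 * B * x / (1 - x) / d) x0 x1 e0.
  exists N => n /hN H; rewrite cmod_distC (le_trans (hl n)) // (le_trans _ H) //.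
  by rewrite exprS le_eqVlt; apply/orP; left; apply/eqP; ring.
exists l => //.
have d2 : 0 < d / 2 by rewrite divr_gt0.
have d4 : 0 < d / 4 by rewrite divr_gt0.
pose K := S / (d / 2) / (d / 4).
have K0 : 0 <= K by apply: divr_ge0; [apply: divr_ge0 => //|]; exact: ltW.
have D1 n u : cmod (u - t) < d / 2 -> cmod (psum (dcoef a) u n) <= S / (d / 2).
  move=> ut; apply: (@cauchy_estimate R (fun w => psum a w n.+1) u) => //.
  - move=> z zu; apply: psum_bound => //; apply: geo.
    by rewrite -[z](subrK u) -addrA (le_lt_trans (cmodD _ _)) //; lra.
  - by move=> z _; eexists; exact: cderiv_psum.
  - exact: cderiv_psum.
have D2 n u l' : cmod (u - t) < d / 4 ->
    cderiv (fun w => psum (dcoef a) w n) u l' -> cmod l' <= K.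
  move=> ut; apply: (@cauchy_estimate R (fun w => psum (dcoef a) w n) u) => //.
  - move=> z zu; apply: D1.
    by rewrite -[z](subrK u) -addrA (le_lt_trans (cmodD _ _)) //; lra.
  - move=> z _; case: n => [|n]; last by eexists; exact: cderiv_psum.
    exists 0; apply: cderiv_ext ltr01 _ (cderiv_cst 0 z) => w _; by rewrite psum0.
have D2' n u : cmod (u - t) < d / 4 ->
    exists2 l', cderiv (fun w => psum (dcoef a) w n) u l' & cmod l' <= K.
  move=> ut.
  suff [l' hl'] : exists l', cderiv (fun w => psum (dcoef a) w n) u l'.
    by exists l' => //; exact: D2 ut hl'.
  case: n => [|n]; last by eexists; exact: cderiv_psum.
  exists 0; apply: cderiv_ext ltr01 _ (cderiv_cst 0 u) => w _; by rewrite psum0.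
have segt (h : C R) (s : R) : cmod h < d / 4 -> 0 <= s <= 1 ->
    cmod (t + toC s * h - t) <= cmod h.
  move=> hh /andP[s0 s1]; rewrite addrAC subrr add0r cmodM cmod_toC_ge0 //.
  by rewrite ler_piMl ?cmod_ge0.
have E n (h : C R) : cmod h < d / 4 ->
    cmod (psum a (t + h) n.+1 - psum a t n.+1 - psum (dcoef a) t n * h) <= K * cmod h * cmod h.
  move=> hh.
  have -> : psum a (t + h) n.+1 - psum a t n.+1 - psum (dcoef a) t n * h =
    (psum a (t + h) n.+1 - psum (dcoef a) t n * (t + h)) -
    (psum a t n.+1 - psum (dcoef a) t n * t) by ring.
  apply: (@mean_value_ineq R (fun u => psum a u n.+1 - psum (dcoef a) t n * u)) => s s01.
  exists (psum (dcoef a) (t + toC s * h) n - psum (dcoef a) t n * 1).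
    exact: cderivB (cderiv_psum _ _ _) (cderivZ _ (cderiv_id _)).
  rewrite mulr1 (le_trans (y := K * cmod (toC s * h))) //.
    apply: (@mean_value_ineq R (fun u => psum (dcoef a) u n)) => s' s'01.
    apply: D2'; rewrite mulrA -toCM.
    apply: (le_lt_trans (segt _ _ hh _)) => //.
    case/andP: s01 => ? ?; case/andP: s'01 => ? ?.
    by rewrite mulr_ge0 //= mulr_ile1.
  rewrite ler_wpM2l //; have := segt _ _ hh s01; by rewrite addrAC subrr add0r.
move=> e e0; exists (Num.min (d / 4) (e / (K + 1))).
  by rewrite lt_min d4 divr_gt0 // ltr_wpDl.
move=> h; rewrite lt_min => /andP[h1 h2].
suff H : cmod (f (t + h) - f t - l * h) <= K * cmod h * cmod h.
  rewrite (le_trans H) // ler_wpM2r ?cmod_ge0 // (le_trans (y := (K + 1) * cmod h)) //.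
    by rewrite ler_wpM2r ?cmod_ge0 // lerDl.
  by rewrite mulrC -ler_pdivlMr ?ltW // ltr_wpDl.
apply/ler_addgt0Pr => e' e'0; have e3 : 0 < e' / 3 by rewrite divr_gt0.
have th : cmod (t + h) < rho.
  by rewrite (le_lt_trans (cmodD _ _)) //; rewrite /d in h1; lra.
have e3h : 0 < e' / 3 / (cmod h + 1) by rewrite divr_gt0 // ltr_wpDl ?cmod_ge0.
have [N1 c1] := hf _ th _ e3; have [N2 c2] := hf _ tr _ e3.
have [N3 c3] := cl _ e3h.
pose n := maxn N1 (maxn N2 N3).
have n1 : (N1 <= n.+1)%N by rewrite leqW // leq_maxl.
have n2 : (N2 <= n.+1)%N by rewrite leqW // leq_max leq_maxl orbT.
have n3 : (N3 <= n)%N by rewrite leq_max leq_maxr orbT.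
have k1 := c1 _ n1; have k2 := c2 _ n2; have k3 := c3 _ n3.
have k3' : cmod ((psum (dcoef a) t n - l) * h) <= e' / 3.
  rewrite cmodM (le_trans (ler_wpM2r (cmod_ge0 _) k3)) //.
  rewrite mulrAC ler_pdivrMr ?ltr_wpDl ?cmod_ge0 // ler_wpM2l ?(ltW e3) // lerDl //.
have k4 := E n _ h1.
have -> : f (t + h) - f t - l * h =
  (psum a (t + h) n.+1 - psum a t n.+1 - psum (dcoef a) t n * h)
  + ((psum (dcoef a) t n - l) * h
  + ((psum a t n.+1 - f t) - (psum a (t + h) n.+1 - f (t + h)))) by ring.
rewrite (le_trans (cmodD _ _)) // lerD //.
rewrite (le_trans (cmodD _ _)) //.
by have := cmodB (psum a t n.+1 - f t) (psum a (t + h) n.+1 - f (t + h)); lra.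
Qed.

(** ** The exponential of a power series *)

(** Comparing coefficients in [t Q' = (sum_k a_k t^k) Q], this says that the [q n]
    are the coefficients of [exp (sum_k (a_k / k) t^k)]. *)
Definition exp_rec (a q : nat -> C R) :=
  q 0%N = 1 /\ forall n, n.+1%:R * q n.+1 = \sum_(j < n.+1) q j * a (n - j).+1.

Lemma exp_rec_bound (a q : nat -> C R) (rho B : R) : 0 < rho -> 0 <= B -> exp_rec a q ->
  (forall k, (0 < k)%N -> cmod (a k) * rho ^+ k <= B) ->
  forall n, cmod (q n) * (rho / (B + 1)) ^+ n <= 1.
Proof.
move=> r0 B0 [q0 qS] hB.
have B1 : 0 < B + 1 by rewrite ltr_wpDl.
set r' := rho / (B + 1); have r'0 : 0 < r' by rewrite divr_gt0.
have aB k : cmod (a k.+1) * r' ^+ k.+1 <= 1.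
  rewrite /r' expr_div_n mulrA ler_pdivrMr ?exprn_gt0 // mul1r.
  rewrite (le_trans (hB _ _)) // (le_trans (y := B + 1)) ?lerDl //.
  by rewrite ler_eXnr // lerDr.
move=> n; have [k] := ubnP n; elim: k n => // k IH [|n] nk.
  by rewrite q0 cmod1 mul1r expr0.
rewrite -(ler_pM2l (ltr0Sn R n)) mulr1 mulrA.
rewrite -(cmod_nat R n.+1) -cmodM qS cmod_nat.
rewrite (le_trans (ler_wpM2r _ (cmod_sum _ _ _))) ?exprn_ge0 ?(ltW r'0) //.
rewrite mulr_suml (le_trans (y := \sum_(j < n.+1) (1 : R))) //; last first.
  by rewrite sumr_const card_ord.
apply: ler_sum => j _.
have jn : (j <= n)%N by rewrite -ltnS.
have -> : cmod (q j * a (n - j).+1) * r' ^+ n.+1 =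
   (cmod (q j) * r' ^+ j) * (cmod (a (n - j).+1) * r' ^+ (n - j).+1).
  have E : r' ^+ n.+1 = r' ^+ j * r' ^+ (n - j).+1 by rewrite -exprD addnS subnKC.
  by rewrite cmodM E; ring.
rewrite mulr_ile1 ?mulr_ge0 ?exprn_ge0 ?cmod_ge0 ?(ltW r'0) // IH //.
exact: (leq_ltn_trans jn).
Qed.

(** The defect of the differential equation [Q' = A' Q] for the truncated series is
    made of tails of [A']. *)
Lemma exp_rec_deriv (a q : nat -> C R) t N : exp_rec a q ->
  psum (dcoef q) t N =
  \sum_(j < N.+1) q j * t ^+ j * psum (fun k => a k.+1) t (N - j).
Proof.
move=> [q0 qS]; elim: N => [|N IH].
  by rewrite psum0 (csum_recr 0 (fun j => q j * t ^+ j * psum (fun k => a k.+1) t (0 - j)))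
    big_ord0 psum0 mulr0 addr0.
rewrite psumS IH (csum_recr N.+1 (fun j => q j * t ^+ j * psum (fun k => a k.+1) t (N.+1 - j))).
rewrite subnn psum0 mulr0 addr0 /dcoef qS mulr_suml -csum_split.
apply: eq_bigr => j _; have jn : (j <= N)%N by rewrite -ltnS.
have E : t ^+ N = t ^+ j * t ^+ (N - j) by rewrite -exprD subnKC.
by rewrite subSn // psumS E; ring.
Qed.

(** The derivative of [Q_N exp (- A)] is [exp (- A)] times the defect in
    [exp_rec_deriv], which is [O(2^-N)] near [0]; hence [Q_N exp (- A)] tends to its
    value [1] at [0]. *)
Lemma exp_psum (a q : nat -> C R) (A A' : C R -> C R) (rho B : R) : 0 < rho ->
  exp_rec a q -> (forall k, (0 < k)%N -> cmod (a k) * rho ^+ k <= B) ->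
  A 0 = 0 ->
  (forall t, cmod t < rho -> cderiv A t (A' t)) ->
  (forall t, cmod t < rho -> cconv (psum (fun k => a k.+1) t) (A' t)) ->
  exists2 d : R, 0 < d & (forall k, cmod (q k) * d ^+ k <= 1) /\
    (forall t, cmod t < d -> cconv (psum q t) (cexp (A t))).
Proof.
move=> r0 qa hB A0 dA cA.
have B0 : 0 <= B by apply: le_trans (hB 1%N isT); rewrite mulr_ge0 ?cmod_ge0 ?exprn_ge0 ?(ltW r0).
have B1 : 0 < B + 1 by rewrite ltr_wpDl.
have qB := exp_rec_bound r0 B0 qa hB.
set r' := rho / (B + 1) in qB; have r'0 : 0 < r' by rewrite divr_gt0.
have r'r : r' <= rho by rewrite ler_pdivrMr // ler_peMr ?lerDr // ltW.
exists (r' / 4); first by rewrite divr_gt0.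
split=> [i|t td].
  have h : r' / 4 <= r' by lra.
  have h0 : 0 <= r' / 4 by lra.
  by apply: le_trans (qB i); rewrite ler_wpM2l ?cmod_ge0 // lerXn2r // nnegrE ltW.
have small u : cmod u <= r' / 4 -> cmod u < rho by lra.
have tail u n : cmod u <= r' / 4 ->
    cmod (A' u - psum (fun k => a k.+1) u n) <= 2 * B / rho * 2^-1 ^+ n.
  move=> ur; have -> : 2 * B / rho * 2^-1 ^+ n = B / rho * 2^-1 ^+ n / (1 - 2^-1) by field; rewrite gt_eqF.
  apply: psum_lim_tail; [lra|lra| |exact/cA/small].
  move=> k; rewrite (le_trans (y := B / rho * (r' / 4 / rho) ^+ k)) //.
    apply: (@coef_geo (fun k => a k.+1)) => // j.
    by rewrite ler_pdivlMr // -mulrA -exprSr hB.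
  have h : r' / 4 / rho <= 2^-1 by rewrite ler_pdivrMr //; lra.
  have h0 : 0 <= r' / 4 / rho by rewrite !divr_ge0 // ltW.
  have h1 : 0 <= B / rho by rewrite divr_ge0 // ltW.
  by rewrite ler_wpM2l // lerXn2r // nnegrE invr_ge0.
have A'B u : cmod u <= r' / 4 -> cmod (A' u) <= 2 * B / rho.
  by move=> /(tail _ 0%N); rewrite psum0 subr0 expr0 mulr1.
have seg (s : R) u : 0 <= s <= 1 -> cmod u <= r' / 4 -> cmod (0 + toC s * u) <= r' / 4.
  move=> /andP[s0 s1] hu; rewrite add0r cmodM cmod_toC_ge0 // (le_trans _ hu) //.
  by rewrite ler_piMl ?cmod_ge0.
have AB u : cmod u <= r' / 4 -> cmod (A u) <= B.
  move=> hu; have := @mean_value_ineq R A 0 u (2 * B / rho) _.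
  rewrite add0r A0 subr0 => /(_ _) H; apply: (le_trans (H _)).
    move=> s s01; have sr := seg _ _ s01 hu; exists (A' (0 + toC s * u)); last exact: A'B.
    by apply: dA; exact: small.
  rewrite mulrAC ler_pdivrMr //.
  by rewrite mulrAC mulrC ler_wpM2l //; lra.
have eB (u : C R) : cmod u <= B -> cmod (cexp u) <= expR B.
  move=> uB; rewrite cmod_cexp ler_expR (le_trans _ uB) //.
  by apply: le_trans (ler_norm _) (cRe_le _).
pose M := 4 * B / rho * expR B * cmod t.
have main N : cmod (psum q t N.+1 * cexp (- A t) - 1) <= M * 2^-1 ^+ N.
  pose F u := psum q u N.+1 * cexp (- A u).
  have F0 : F 0 = 1.
    rewrite /F A0 oppr0 cexp0 mulr1 /psum (csum_single (k := ord0)).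
      by rewrite expr0 mulr1; case: qa.
    by move=> [[|i] //= hi _]; rewrite expr0n mulr0.
  rewrite -F0 -/(F t) -[in F t](add0r t).
  rewrite /M mulrAC; apply: mean_value_ineq => s s01.
  set u := 0 + toC s * t.
  have ur : cmod u <= r' / 4 by apply: seg => //; exact: ltW.
  have dF := cderivM (cderiv_psum q N u)
     (cderiv_comp (cderivN (dA _ (small _ ur))) (cderiv_cexp _)).
  eexists; first exact: dF.
  have -> : psum (dcoef q) u N * cexp (- A u) + psum q u N.+1 * (cexp (- A u) * - A' u) =
     (psum (dcoef q) u N - psum q u N.+1 * A' u) * cexp (- A u) by ring.
  have -> : psum (dcoef q) u N - psum q u N.+1 * A' u =
    - \sum_(j < N.+1) q j * u ^+ j * (A' u - psum (fun k => a k.+1) u (N - j)).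
    rewrite (exp_rec_deriv _ _ qa) /psum mulr_suml -sumrB -sumrN.
    by apply: eq_bigr => j _; rewrite -/(psum _ _ _); ring.
  rewrite cmodM cmodN mulrAC ler_pM ?cmod_ge0 //; last first.
    by apply: eB; rewrite cmodN; exact: AB.
  rewrite (le_trans (cmod_sum _ _ _)) //.
  rewrite (le_trans (y := \sum_(j < N.+1) 2 * B / rho * 2^-1 ^+ N * 2^-1 ^+ j)) //.
    apply: ler_sum => j _; have jn : (j <= N)%N by rewrite -ltnS.
    rewrite cmodM.
    have -> : 2 * B / rho * 2^-1 ^+ N * 2^-1 ^+ j =
       4^-1 ^+ j * (2 * B / rho * 2^-1 ^+ (N - j)).
      have -> : 4^-1 = 2^-1 * 2^-1 :> R by field.
      have E : 2^-1 ^+ N = 2^-1 ^+ j * 2^-1 ^+ (N - j) :> R by rewrite -exprD subnKC.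
      by rewrite exprMn E; ring.
    rewrite ler_pM ?cmod_ge0 ?tail //.
    have := @coef_geo q r' 1 u (r' / 4) j r'0 qB ur.
    by rewrite mul1r (_ : r' / 4 / r' = 4^-1) //; field; rewrite gt_eqF.
  rewrite -mulr_sumr.
  have -> : 4 * B / rho * 2^-1 ^+ N = 2 * B / rho * 2^-1 ^+ N * 2 by ring.
  rewrite ler_wpM2l ?mulr_ge0 ?exprn_ge0 ?invr_ge0 ?(ltW r0) //.
  have := subrX1 (2^-1 : R) N.+1; set S := \sum_(i < _) _ => E.
  have p0 : 0 <= 2^-1 ^+ N.+1 :> R by rewrite exprn_ge0 // invr_ge0.
  lra.
move=> e e0.
have [N hN] := @geo_cvg0 R (M * expR B) 2^-1 ltac:(lra) ltac:(lra) e e0.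
exists N.+1 => -[//|n] /hN; apply: le_trans.
have -> : psum q t n.+1 - cexp (A t) = (psum q t n.+1 * cexp (- A t) - 1) * cexp (A t).
  by rewrite mulrBl -mulrA cexpNM mulr1 mul1r.
rewrite cmodM mulrAC ler_pM ?cmod_ge0 ?main // eB // AB // ltW //.
Qed.

End PowerSeries.

(** * The reciprocal Gamma function and binomial coefficients *)

Section Gamma.
Variable R : realType.
Implicit Types (x y : R) (z v w u t b : C R) (n m : nat).

Lemma cexp_lip_le z : cmod (cexp z - 1) <= expR (cmod z) * cmod z.
Proof.
have := @mean_value_ineq R (@cexp R) 0 z (expR (cmod z)) _.
rewrite add0r cexp0; apply=> s /andP[s0 s1].
exists (cexp (0 + toC s * z)); first exact: cderiv_cexp.
rewrite cmod_cexp ler_expR add0r (le_trans (ler_norm _)) // (le_trans (cRe_le _)) //.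
by rewrite cmodM cmod_toC_ge0 // ler_piMl ?cmod_ge0.
Qed.

Lemma cexp_quad z : cmod (cexp z - 1 - z) <= expR (cmod z) * cmod z * cmod z.
Proof.
have := @mean_value_ineq R (fun u => cexp u - u) 0 z (expR (cmod z) * cmod z) _.
rewrite add0r cexp0 subr0 => /(_ _) H.
have -> : cexp z - 1 - z = cexp z - z - 1 by ring.
apply: H => s /andP[s0 s1].
exists (cexp (0 + toC s * z) - 1).
  by apply: cderivB; [exact: cderiv_cexp|exact: cderiv_id].
rewrite add0r; have sz : cmod (toC s * z) <= cmod z.
  by rewrite cmodM cmod_toC_ge0 // ler_piMl ?cmod_ge0.
rewrite (le_trans (cexp_lip_le _)) // ler_pM ?expR_ge0 ?cmod_ge0 //.
by rewrite ler_expR.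
Qed.

Lemma cpow_neq0 x z : cpow x z != 0.
Proof. exact: cexp_neq0. Qed.

Lemma cpowB x z w : cpow x (z - w) = cpow x z / cpow x w.
Proof. by rewrite /cpow mulrBl cexpB. Qed.

Lemma cpow1 x : 0 < x -> cpow x 1 = toC x.
Proof. by move=> x0; rewrite /cpow mul1r cexp_toC lnK ?posrE. Qed.

Lemma cmod_cpow x z : 0 < x -> cmod (cpow x z) = x `^ cRe z.
Proof.
by move=> x0; rewrite /cpow cmod_cexp cReM /= mulr0 subr0 powRE.
Qed.

(** Since [(n+1)^-2 <= 1/n - 1/(n+1)], the product of the factors [1 + K/(n+1)^2]
    is controlled by a telescoping sum in the exponent. The same control from
    below keeps the limit away from [0]. *)
Lemma slow_sequence (b : nat -> C R) (K : R) : 0 <= K ->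
  (forall n, (0 < n)%N -> cmod (b n.+1 - b n) <= K * cmod (b n) * n.+1%:R ^- 2) ->
  exists l, (exists D : R, forall n, (0 < n)%N -> cmod (b n - l) <= D / n%:R) /\
    ((forall n, (0 < n)%N -> b n != 0) -> l != 0).
Proof.
move=> K0 hb.
have step n : (0 < n)%N -> n.+1%:R ^- 2 <= n%:R^-1 - n.+1%:R^-1 :> R.
  move=> n0; have n0' : 0 < n%:R :> R by rewrite ltr0n.
  have n1' : 0 < n.+1%:R :> R by rewrite ltr0n.
  have -> : n%:R^-1 - n.+1%:R^-1 = n%:R^-1 * n.+1%:R^-1 :> R.
    by rewrite -natr1; field; rewrite natr1 !gt_eqF.
  rewrite expr2 invfM ler_pM2r ?invr_gt0 // lef_pV2 ?posrE // ler_nat //.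
have grow n k : (0 < n)%N ->
    cmod (b (n + k)%N) <= cmod (b n) * expR (K * (n%:R^-1 - (n + k)%:R^-1)).
  move=> n0; elim: k => [|k IH]; first by rewrite addn0 subrr mulr0 expR0 mulr1.
  have m0 : (0 < n + k)%N by rewrite addn_gt0 n0.
  rewrite addnS -(subrK (b (n + k)%N) (b _.+1)) (le_trans (cmodD _ _)) //.
  rewrite (le_trans (lerD (hb _ m0) (lexx _))) //.
  have -> : K * (n%:R^-1 - (n + k).+1%:R^-1) = K * (n%:R^-1 - (n + k)%:R^-1)
     + K * ((n + k)%:R^-1 - (n + k).+1%:R^-1) by ring.
  rewrite expRD mulrA -[X in _ + X]mul1r mulrAC -mulrDl mulrC.
  rewrite ler_pM ?cmod_ge0 // ?addr_ge0 ?mulr_ge0 ?invr_ge0 ?exprn_ge0 //.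
  rewrite (le_trans _ (expR_ge1Dx _)) // addrC lerD2l ler_wpM2l //.
  exact: step.
have grow' n m : (0 < n)%N -> (n <= m)%N -> cmod (b m) <= cmod (b n) * expR K.
  move=> n0 /subnKC <-; rewrite (le_trans (grow _ _ n0)) // ler_wpM2l ?cmod_ge0 // ler_expR.
  rewrite ler_piMr // lerBlDr (le_trans (y := 1)) ?lerDl ?invr_ge0 //.
  by rewrite invf_le1 ?ltr0n // ler1n.
have incr n k : (0 < n)%N -> cmod (b (n + k)%N - b n) <=
    K * expR K * cmod (b n) * (n%:R^-1 - (n + k)%:R^-1).
  move=> n0; elim: k => [|k IH]; first by rewrite addn0 !subrr cmod0 mulr0.
  have m0 : (0 < n + k)%N by rewrite addn_gt0 n0.
  have -> : b (n + k.+1)%N - b n = (b (n + k).+1 - b (n + k)%N) + (b (n + k)%N - b n).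
    by rewrite addnS; ring.
  rewrite (le_trans (cmodD _ _)) // addnS.
  have -> : K * expR K * cmod (b n) * (n%:R^-1 - (n + k).+1%:R^-1) =
    K * (cmod (b n) * expR K) * ((n + k)%:R^-1 - (n + k).+1%:R^-1)
    + K * expR K * cmod (b n) * (n%:R^-1 - (n + k)%:R^-1) by ring.
  rewrite lerD // (le_trans (hb _ m0)) // ler_pM ?mulr_ge0 ?cmod_ge0 ?invr_ge0 ?exprn_ge0 //.
    by rewrite ler_wpM2l // grow' // leq_addr.
  exact: step.
have incr' n m : (0 < n)%N -> (n <= m)%N -> cmod (b m - b n) <= K * expR K * cmod (b n) / n%:R.
  move=> n0 /subnKC <-; rewrite (le_trans (incr _ _ n0)) // ler_wpM2l ?mulr_ge0 ?expR_ge0 ?cmod_ge0 //.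
  by rewrite lerBlDr lerDl invr_ge0.
pose S := cmod (b 1%N) * expR K.
have S0 : 0 <= S by rewrite mulr_ge0 ?cmod_ge0 ?expR_ge0.
have [l hl] := @complete_rate R (fun n => b n.+1) (fun n => K * expR K * S / n.+1%:R) (fun n m nm =>
  le_trans (incr' n.+1 m.+1 isT nm) (ler_wpM2r (ltac:(by rewrite invr_ge0) : 0 <= n.+1%:R^-1)
   (ler_wpM2l (mulr_ge0 K0 (expR_ge0 K)) (grow' 1%N n.+1 isT isT)))).
have hl' n : (0 < n)%N -> cmod (b n - l) <= 2 * (K * expR K * S) / n%:R.
  by case: n => // n _; rewrite cmod_distC; apply: (le_trans (hl n)); rewrite mulrA.
exists l; split; first by exists (2 * (K * expR K * S)).
move=> bn0; apply/eqP => l0.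
have H n : (0 < n)%N -> cmod (b n) <= K * expR K * cmod (b n) / n%:R.
  move=> n0; apply/ler_addgt0Pr => e e0.
  pose T := 2 * (K * expR K * S).
  have T0 : 0 <= T by rewrite !mulr_ge0 ?expR_ge0 ?cmod_ge0.
  have := archi_boundP (divr_ge0 T0 (ltW e0)); set N := Num.bound _ => hN.
  pose m := maxn n N.
  have m0 : (0 < m)%N by rewrite leq_max n0.
  have k1 := hl' m m0; rewrite l0 subr0 -/T in k1.
  have k2 := incr' n m n0 (leq_maxl _ _).
  have k3 : T / m%:R <= e.
    rewrite ler_pdivrMr ?ltr0n // mulrC -ler_pdivrMr // (le_trans (ltW hN)) // ler_nat leq_maxr //.
  by rewrite -[b n](subrK (b m)) (le_trans (cmodD _ _)) // cmod_distC subrK lerD // (le_trans k1 k3).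
have KK0 : 0 <= K * expR K by rewrite mulr_ge0 ?expR_ge0.
have := archi_boundP KK0; set N := Num.bound _ => hN.
have Np : 0 < N%:R :> R by apply: le_lt_trans hN.
have N0 : (0 < N)%N by rewrite -(ltr0n R).
have bp : 0 < cmod (b N) by rewrite cmod_gt0 bn0.
have := H N N0; rewrite mulrAC -ler_pdivrMr // divff ?gt_eqF // ler_pdivlMr // mul1r.
by rewrite leNgt hN.
Qed.

(** The sequence whose limit is [rgamma z]. *)
Definition gauss_seq z n : C R :=
  (\prod_(j < n.+1) (z + j%:R)) / (n`!%:R * cpow n%:R z).

Lemma cprod_recr n (F : nat -> C R) :
  \prod_(j < n.+1) F j = \prod_(j < n) F j * F n.
Proof. exact: big_ord_recr. Qed.

Lemma ln_natS n : (0 < n)%N ->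
  - (n%:R^-1) <= ln (n%:R : R) - ln (n.+1%:R : R) <= - (n.+1%:R^-1).
Proof.
move=> n0; have n0' : 0 < n%:R :> R by rewrite ltr0n.
have n1' : 0 < n.+1%:R :> R by rewrite ltr0n.
apply/andP; split.
  rewrite lerNl opprB -ln_div ?posrE //.
  have -> : n.+1%:R / n%:R = 1 + n%:R^-1 :> R by rewrite -natr1; field; rewrite gt_eqF.
  by rewrite le_ln1Dx // (lt_trans (ltrN10 _)) // invr_gt0.
rewrite -ln_div ?posrE //.
have -> : n%:R / n.+1%:R = 1 + - n.+1%:R^-1 :> R.
  by rewrite -natr1; field; rewrite natr1 gt_eqF.
by rewrite le_ln1Dx // ltrN2 invf_lt1 // (ltr_nat _ 1).
Qed.

(** With [x = 1 / (n + 1)] the ratio of consecutive terms is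
    [(1 + z x) exp (z ln (1 - x)) = 1 + O(x^2)]. *)
Lemma gauss_seq_step z : exists2 K : R, 0 <= K & forall n, (0 < n)%N ->
  cmod (gauss_seq z n.+1 - gauss_seq z n) <= K * cmod (gauss_seq z n) * n.+1%:R ^- 2.
Proof.
pose B := cmod z; have B0 : 0 <= B := cmod_ge0 z.
pose K := (1 + B) * (expR B * (4 * B ^+ 2)) + (2 * B + 2 * B ^+ 2).
have K0 : 0 <= K.
  by rewrite /K !addr_ge0 ?mulr_ge0 ?addr_ge0 ?expR_ge0 ?exprn_ge0.
exists K => // n n0; have n0' : 0 < n%:R :> R by rewrite ltr0n.
have n1' : 0 < n.+1%:R :> R by rewrite ltr0n.
pose x : R := n.+1%:R^-1; pose y : R := ln n%:R - ln n.+1%:R.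
have x0 : 0 < x by rewrite invr_gt0.
have nE : n%:R^-1 = x + n%:R^-1 * x :> R.
  by rewrite /x -natr1; field; rewrite natr1 !gt_eqF.
have n2x : n%:R^-1 <= 2 * x.
  rewrite /x -[2]invrK -invfM lef_pV2 ?posrE ?mulr_gt0 ?invr_gt0 //.
  rewrite mulrC ler_pdivrMr // -natr1 mulr_natr mulr2n lerD2l ler1n //.
have /andP[y1 y2] := ln_natS n0; rewrite -/x -/y in y1 y2.
have nx : n%:R^-1 * x <= 2 * x ^+ 2 by rewrite expr2 mulrA ler_pM2r.
have x1 : 2 * x <= 1.
  rewrite /x mulrC ler_pdivrMl // mulr1 ler_nat //.
have yx : `|x + y| <= 2 * x ^+ 2 by rewrite ler_norml; lra.
have yy : `|y| <= 2 * x by rewrite ler_norml; lra.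
pose h := z * toC y.
have hB : cmod h <= 2 * B * x.
  have -> : 2 * B * x = B * (2 * x) by ring.
  by rewrite /h cmodM cmod_toC ler_wpM2l.
have hB1 : cmod h <= B.
  have -> : B = B * 1 by rewrite mulr1.
  by rewrite (le_trans hB) // [2 * B]mulrC -mulrA ler_wpM2l.
have gS : gauss_seq z n.+1 = gauss_seq z n * ((1 + z * toC x) * cexp h).
  rewrite /gauss_seq (cprod_recr n.+1 (fun j => z + j%:R)) factS natrM.
  have -> : cexp h = cpow n%:R z / cpow n.+1%:R z.
    by rewrite /h /y toCB mulrBr cexpB.
  have fn0 : n`!%:R != 0 :> C R by rewrite natC_neq0 // fact_gt0.
  have nn0 : n.+1%:R != 0 :> C R by rewrite natC_neq0.
  have -> : toC x = n.+1%:R^-1 by rewrite /x toCV toC_nat.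
  move: (n.+1%:R : C R) nn0 => p nn0; field; rewrite ?fn0 ?nn0 ?cpow_neq0 //.
have -> : gauss_seq z n.+1 - gauss_seq z n = gauss_seq z n *
   ((1 + z * toC x) * (cexp h - 1 - h) + (z * toC (x + y) + z * z * (toC x * toC y))).
  by rewrite gS /h toCD; ring.
rewrite -exprVn -/x cmodM [K * _]mulrC -(mulrA _ K) ler_wpM2l ?cmod_ge0 //.
have b1 : cmod (1 + z * toC x) <= 1 + B.
  rewrite (le_trans (cmodD _ _)) // cmod1 lerD2l cmodM cmod_toC_ge0 ?(ltW x0) //.
  by rewrite ler_piMr //; lra.
have b2 : cmod (cexp h - 1 - h) <= expR B * (4 * B ^+ 2) * x ^+ 2.
  have -> : expR B * (4 * B ^+ 2) * x ^+ 2 = expR B * ((2 * B * x) * (2 * B * x)) by ring.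
  rewrite (le_trans (cexp_quad _)) // -mulrA.
  by rewrite ler_pM ?expR_ge0 ?mulr_ge0 ?cmod_ge0 ?ler_expR // ler_pM ?cmod_ge0.
have b3 : cmod (z * toC (x + y)) <= 2 * B * x ^+ 2.
  have -> : 2 * B * x ^+ 2 = B * (2 * x ^+ 2) by ring.
  by rewrite cmodM cmod_toC ler_wpM2l.
have b4 : cmod (z * z * (toC x * toC y)) <= 2 * B ^+ 2 * x ^+ 2.
  rewrite !cmodM !cmod_toC (ger0_norm (ltW x0)).
  have -> : 2 * B ^+ 2 * x ^+ 2 = B * B * (x * (2 * x)) by ring.
  by rewrite ler_wpM2l ?mulr_ge0 // ler_wpM2l // ltW.
have -> : K * x ^+ 2 = (1 + B) * (expR B * (4 * B ^+ 2) * x ^+ 2) +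
    (2 * B * x ^+ 2 + 2 * B ^+ 2 * x ^+ 2) by rewrite /K; ring.
rewrite (le_trans (cmodD _ _)) // lerD //.
  by rewrite cmodM ler_pM ?cmod_ge0.
by rewrite (le_trans (cmodD _ _)) // lerD.
Qed.

Lemma gauss_seq_lim z : exists D : R, forall n, (0 < n)%N ->
  cmod (gauss_seq z n - rgamma z) <= D / n%:R.
Proof.
have [K K0 hK] := gauss_seq_step z.
have [l [[D hD] _]] := slow_sequence K0 hK.
suff -> : rgamma z = l by exists D.
apply: cconv_lim => e e0.
pose N := Num.bound (`|D| / e).
have hN : `|D| / e < N%:R := archi_boundP (divr_ge0 (normr_ge0 D) (ltW e0)).
exists (maxn N 1) => n; rewrite geq_max => /andP[Nn n0].
rewrite -/(gauss_seq z n) (le_trans (hD _ n0)) // ler_pdivrMr ?ltr0n //.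
rewrite mulrC -ler_pdivrMr // (le_trans _ (le_trans (ltW hN) _)) ?ler_nat //.
by rewrite ler_wpM2r ?invr_ge0 ?(ltW e0) // ler_norm.
Qed.

Lemma rgamma_neq0 x : 0 < x -> rgamma (toC x) != 0.
Proof.
move=> x0.
have [K K0 hK] := gauss_seq_step (toC x).
have [l [[D hD] hl]] := slow_sequence K0 hK.
have [D' hD'] := gauss_seq_lim (toC x).
have fz n : gauss_seq (toC x) n != 0.
  have d0 : n`!%:R * cpow n%:R (toC x) != 0.
    by apply: mulf_neq0; [rewrite natC_neq0 // fact_gt0|exact: cpow_neq0].
  apply: mulf_neq0; last by rewrite invr_neq0.
  apply/prodf_neq0 => j _; rewrite -toC_nat -toCD -toC0 (inj_eq (@toC_inj R)).
  by rewrite gt_eqF // ltr_wpDr.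
suff -> : rgamma (toC x) = l by apply: hl.
apply/eqP; rewrite -subr_eq0 -cmod_eq0 eq_le cmod_ge0 andbT.
apply/ler_addgt0Pr => e e0; rewrite add0r.
pose N := Num.bound (`|D' + D| / e).
have hN : `|D' + D| / e < N%:R := archi_boundP (divr_ge0 (normr_ge0 _) (ltW e0)).
pose n := maxn N 1; have n0 : (0 < n)%N by rewrite leq_maxr.
have -> : rgamma (toC x) - l = (gauss_seq (toC x) n - l) - (gauss_seq (toC x) n - rgamma (toC x)).
  by ring.
rewrite (le_trans (cmodB _ _)) // (le_trans (lerD (hD _ n0) (hD' _ n0))) //.
rewrite -mulrDl ler_pdivrMr ?ltr0n // mulrC -ler_pdivrMr // addrC.
rewrite (le_trans _ (le_trans (ltW hN) _)) ?ler_nat ?leq_maxl //.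
by rewrite ler_wpM2r ?invr_ge0 ?(ltW e0) // ler_norm.
Qed.

(** The coefficients of [(1 - t)^(- z)]. *)
Definition negbin z n : C R := \prod_(j < n) (z + j%:R) / n`!%:R.

Lemma negbinS z n : n.+1%:R * negbin z n.+1 = (z + n%:R) * negbin z n.
Proof.
have fn0 : n`!%:R != 0 :> C R by rewrite natC_neq0 // fact_gt0.
have nn0 : n.+1%:R != 0 :> C R by rewrite natC_neq0.
rewrite /negbin (cprod_recr n (fun j => z + j%:R)) factS natrM.
by move: (n.+1%:R : C R) nn0 => p nn0; field; rewrite fn0 nn0.
Qed.

Lemma negbin_rec z : exp_rec (fun=> z) (negbin z).
Proof.
have c0 : negbin z 0 = 1 by rewrite /negbin big_ord0 fact0 divr1.
split=> // n; rewrite negbinS; elim: n => [|n IH].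
  by rewrite (csum_recr 0 (fun j => negbin z j * z)) big_ord0 c0 addr0 add0r mulrC.
by rewrite (csum_recr n.+1 (fun j => negbin z j * z)) -IH -(negbinS z n); ring.
Qed.

(** [negbin z n / n^(z - 1)] is [gauss_seq z n] times [n / (z + n)]. *)
Lemma negbin_asymp z : exists D : R, exists N, forall n, (N <= n)%N -> (0 < n)%N ->
  cmod (negbin z n / cpow n%:R (z - 1) - rgamma z) <= D / n%:R.
Proof.
have [D hD] := gauss_seq_lim z.
pose N := Num.bound (2 * cmod z).
have hN : 2 * cmod z < N%:R := archi_boundP (mulr_ge0 (ler0n _ 2) (cmod_ge0 z)).
exists (D + cmod z * (2 * (cmod (rgamma z) + `|D|))), N => n Nn n0.
have n0' : 0 < n%:R :> R by rewrite ltr0n.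
have nz : n%:R / 2 <= cmod (z + n%:R).
  have := cmodB_ge (n%:R) (- z); rewrite opprK cmodN [n%:R + z]addrC cmod_nat.
  have : N%:R <= n%:R :> R by rewrite ler_nat.
  lra.
have zn0 : z + n%:R != 0 by rewrite -cmod_gt0 (lt_le_trans _ nz) // divr_gt0.
have fn0 : n`!%:R != 0 :> C R by rewrite natC_neq0 // fact_gt0.
have nn0 : n%:R != 0 :> C R by rewrite natC_neq0.
have E : negbin z n / cpow n%:R (z - 1) = gauss_seq z n - z / (z + n%:R) * gauss_seq z n.
  rewrite /gauss_seq (cprod_recr n (fun j => z + j%:R)) /negbin cpowB cpow1 // toC_nat.
  by field; rewrite fn0 zn0 nn0 cpow_neq0.
have gb : cmod (gauss_seq z n) <= cmod (rgamma z) + `|D|.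
  rewrite -[gauss_seq z n](subrK (rgamma z)) (le_trans (cmodD _ _)) // addrC lerD2l.
  rewrite (le_trans (hD _ n0)) // (le_trans (y := `|D| / n%:R)) //.
    by rewrite ler_wpM2r ?invr_ge0 ?(ltW n0') // ler_norm.
  by rewrite ler_pdivrMr // ler_peMr // ler1n.
rewrite E addrAC (le_trans (cmodB _ _)) // mulrDl lerD ?hD //.
rewrite cmodM cmodM cmodV -[leLHS]mulrA.
have -> : cmod z * (2 * (cmod (rgamma z) + `|D|)) / n%:R =
    cmod z * ((n%:R / 2)^-1 * (cmod (rgamma z) + `|D|)).
  by field; rewrite gt_eqF.
rewrite ler_wpM2l ?cmod_ge0 // ler_pM ?cmod_ge0 ?invr_ge0 ?cmod_ge0 //.
by rewrite lef_pV2 ?posrE ?divr_gt0 // (lt_le_trans _ nz) // divr_gt0.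
Qed.

End Gamma.

(** * The principal logarithm *)

Section Clog.
Variable R : realType.
Implicit Types (x y : R) (z v w u t p : C R).

Lemma cRe_ratio z : z != 0 -> -1 <= cRe z / cmod z <= 1.
Proof.
move=> z0; have zp : 0 < cmod z by rewrite cmod_gt0.
have := cRe_le z; rewrite ler_norml => /andP[a b].
by rewrite ler_pdivlMr // ler_pdivrMr // mulN1r mul1r a.
Qed.

Lemma carg_polar x y : 0 < x -> - pi < y < pi -> carg (toC x * cexp (mkC 0 y)) = y.
Proof.
move=> x0 /andP[y1 y2]; rewrite /carg.
have -> : cmod (toC x * cexp (mkC 0 y)) = x.
  by rewrite cmodM cmod_cexp /= expR0 mulr1 cmod_toC_ge0 // ltW.
have -> : cRe (toC x * cexp (mkC 0 y)) = x * cos y.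
  by rewrite cReM /cexp cReM cImM /= expR0; ring.
have -> : cIm (toC x * cexp (mkC 0 y)) = x * sin y.
  by rewrite cImM /cexp cReM cImM /= expR0; ring.
rewrite [x * cos y]mulrC mulfK ?gt_eqF // pmulr_rge0 //.
have [y0|y0] := leP 0 y.
  by rewrite sin_ge0_pi ?y0 ?(ltW y2) // cosK // in_itv /= y0 ltW.
have : 0 < sin (- y) by apply: sin_gt0_pi; lra.
rewrite sinN oppr_gt0 => /lt_geF ->.
by rewrite cosKN ?opprK // (ltW y0) ltW.
Qed.

Lemma cexp_clog z : z != 0 -> cexp (clog z) = z.
Proof.
move=> z0; have zp : 0 < cmod z by rewrite cmod_gt0.
have hr := cRe_ratio z0.
rewrite /clog /cexp /= lnK ?posrE // /carg.
set a := cRe z / cmod z in hr *.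
have ca : cos (acos a) = a by rewrite acosK // in_itv.
have az : cmod z * a = cRe z by rewrite /a mulrCA divff ?mulr1 // gt_eqF.
have sa : cmod z * sin (acos a) = `|cIm z|.
  rewrite sin_acos // -[X in X * _](ger0_norm (ltW zp)) -sqrtr_sqr -sqrtrM ?sqr_ge0 //.
  rewrite -[RHS]sqrtr_sqr; congr Num.sqrt.
  by rewrite mulrBr mulr1 -exprMn az sqr_cmod; ring.
rewrite [RHS]mkCE /toC mkCM !mul0r subr0 addr0.
case: leP => [i0|i0].
  by rewrite ca az sa ger0_norm.
by rewrite cosN sinN ca az mulrN sa ltr0_norm // opprK.
Qed.

Lemma carg_lepi z : z != 0 -> `|carg z| <= pi.
Proof.
move=> /cRe_ratio hr; rewrite /carg.
have h : `|acos (cRe z / cmod z)| <= pi by rewrite ger0_norm ?acos_ge0 ?acos_lepi.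
by case: ifP => _; rewrite ?normrN.
Qed.

Lemma norm_carg z : z != 0 -> `|carg z| = acos (cRe z / cmod z).
Proof.
move=> /cRe_ratio hr; rewrite /carg.
by case: ifP => _; rewrite ?normrN ger0_norm // acos_ge0.
Qed.

Lemma slit_neq0 z : - cmod z < cRe z -> z != 0.
Proof. by move=> h; apply/eqP => z0; move: h; rewrite z0 cmod0 oppr0 -toC0 /= ltxx. Qed.

Lemma carg_ltpi z : - cmod z < cRe z -> `|carg z| < pi.
Proof.
move=> h; have z0 := slit_neq0 h; have zp : 0 < cmod z by rewrite cmod_gt0.
rewrite norm_carg // acos_ltpi //; have /andP[_ ->] := cRe_ratio z0.
by rewrite andbT ltr_pdivlMr // mulN1r.
Qed.

Lemma polar z : z != 0 -> z = toC (cmod z) * cexp (mkC 0 (carg z)).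
Proof.
move=> z0; rewrite -{1}(cexp_clog z0) /clog.
have -> : mkC (ln (cmod z)) (carg z) = toC (ln (cmod z)) + mkC 0 (carg z).
  by rewrite /toC mkCD addr0 add0r.
by rewrite cexpD cexp_toC lnK // posrE cmod_gt0.
Qed.

Lemma polar_atan p : 0 < cRe p ->
  p = toC (cmod p) * cexp (mkC 0 (atan (cIm p / cRe p))).
Proof.
move=> p0; set x := cIm p / cRe p.
have s0 : 0 < Num.sqrt (1 + x ^+ 2) by rewrite sqrtr_gt0 ltr_wpDr ?sqr_ge0.
have pE : cmod p = cRe p * Num.sqrt (1 + x ^+ 2).
  rewrite cmodE -[X in X * _](ger0_norm (ltW p0)) -sqrtr_sqr -sqrtrM ?sqr_ge0 //.
  by congr Num.sqrt; rewrite /x; field; rewrite gt_eqF.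
have cx := cos_atan x.
have sx : sin (atan x) = x / Num.sqrt (1 + x ^+ 2).
  have e : sin (atan x) / cos (atan x) = x := atanK x.
  have ne : cos (atan x) != 0 by rewrite cx gt_eqF // invr_gt0.
  by rewrite -(divfK ne (sin (atan x))) e cx.
rewrite /cexp /= expR0 toC1 mul1r cx sx [LHS]mkCE /toC mkCM !mul0r subr0 addr0 pE.
congr mkC; first by rewrite mulfK // gt_eqF.
by rewrite mulrA mulrAC mulfK ?gt_eqF // /x mulrC divfK // gt_eqF.
Qed.

Lemma ln_near1 x : `|x - 1| <= 2^-1 -> `|ln x| <= 2 * `|x - 1|.
Proof.
move=> h; have := h; rewrite ler_norml => /andP[h1 h2].
have x0 : 0 < x by lra.
have l1 : ln x <= x - 1.
  by have := @le_ln1Dx R (x - 1); rewrite [1 + _]addrC subrK; apply; lra.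
have l2 : - ln x <= x^-1 - 1.
  rewrite -lnV ?posrE //; have := @le_ln1Dx R (x^-1 - 1); rewrite [1 + _]addrC subrK; apply.
  have xV : 0 < x^-1 by rewrite invr_gt0.
  lra.
have x2 : x^-1 <= 2 by rewrite -[2]invrK lef_pV2 ?posrE ?invr_gt0 //; lra.
have e1 : x^-1 - 1 = x^-1 * (1 - x) by field; rewrite gt_eqF.
have l3 : x^-1 * (1 - x) <= 2 * `|x - 1|.
  rewrite (le_trans (ler_norm _)) // normrM distrC ler_wpM2r //.
  by rewrite ger0_norm // invr_ge0 ltW.
have := ler_norm (x - 1); have := normr_ge0 (x - 1).
by rewrite ler_norml; lra.
Qed.

(** Off the negative axis the argument of [z + h] is that of [z] plus the arc
    tangent for [1 + h / z], as long as the sum stays in [(- pi, pi)]. *)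
Lemma clog_cont z : - cmod z < cRe z -> forall e : R, 0 < e ->
  exists2 d : R, 0 < d & forall h : C R, cmod h < d ->
    cmod (clog (z + h) - clog z) <= e /\ z + h != 0.
Proof.
move=> hz e e0; have z0 := slit_neq0 hz; have zp : 0 < cmod z by rewrite cmod_gt0.
have cpi := carg_ltpi hz.
pose e1 := Num.min (e / 2) (pi - `|carg z|).
have e10 : 0 < e1 by rewrite lt_min divr_gt0 //= subr_gt0.
have at0 : atan x @[x --> (0 : R)] --> atan (0 : R) by exact: continuous_atan.
move: at0; rewrite atan0 => /cvgrPdist_lt /(_ _ e10).
move=> /nbhs_ballP[d1 /= d10 hd1].
pose d2 := Num.min (Num.min 2^-1 (d1 / 2)) (e / 4).
have d20 : 0 < d2 by rewrite !lt_min -!andbA; apply/and3P; split; lra.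
exists (d2 * cmod z); first by rewrite mulr_gt0.
move=> h; rewrite -ltr_pdivrMr // -cmodV -cmodM => hh.
have [u uE] : exists u : C R, u = (h : C R) / z by exists ((h : C R) / z).
rewrite -uE in hh; pose p := 1 + u.
have u1 : cmod u <= 2^-1.
  by rewrite (le_trans (ltW hh)) // !ge_min lexx.
have u2 : 2 * cmod u < d1.
  by rewrite mulrC -ltr_pdivlMr // (lt_le_trans hh) // !ge_min lexx ?orbT.
have u3 : cmod u <= e / 4 by rewrite (le_trans (ltW hh)) // ge_min lexx orbT.
have pu : p - 1 = u by rewrite /p addrAC subrr add0r.
have rp : 2^-1 <= cRe p.
  rewrite /p cReD -toC1 /=; have := cRe_le u; rewrite ler_norml => /andP[]; lra.
have rp0 : 0 < cRe p by lra.
have p0 : p != 0 by apply/eqP => E; move: rp0; rewrite E -toC0 /= ltxx.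
have cp : 0 < cmod p by rewrite cmod_gt0.
set x := cIm p / cRe p.
have xu : `|x| <= 2 * cmod u.
  rewrite /x normrM normfV (ger0_norm (ltW rp0)) ler_pdivrMr //.
  have : `|cIm p| <= cmod u.
    by rewrite /p cImD -toC1 /= add0r cIm_le.
  move=> H; rewrite (le_trans H) // -[X in X <= _]mulr1 -[2 * _ * _]mulrAC mulrC.
  by rewrite ler_wpM2r ?cmod_ge0 //; lra.
have ax : `|atan x| < e1.
  by have := hd1 x; rewrite /ball /= !sub0r !normrN; apply; exact: le_lt_trans u2.
have zhE : z + h = z * p by rewrite /p uE; field.
have zh0 : z + h != 0 by rewrite zhE mulf_neq0.
split=> //.
have ang : - pi < carg z + atan x < pi.
  have : `|carg z + atan x| < pi.
    rewrite (le_lt_trans (ler_normD _ _)) // -ltrBrDl (lt_le_trans ax) //.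
    by rewrite ge_min lexx orbT.
  by rewrite ltr_norml.
have E : z + h = toC (cmod z * cmod p) * cexp (mkC 0 (carg z + atan x)).
  rewrite zhE {1}(polar z0) {1}(polar_atan rp0) -/x toCM cexp_im; ring.
have carE : carg (z + h) = carg z + atan x.
  by rewrite E carg_polar // mulr_gt0.
have -> : clog (z + h) - clog z = mkC (ln (cmod p)) (atan x).
  rewrite /clog carE zhE cmodM lnM ?posrE // mkCN mkCD; congr mkC; ring.
rewrite (le_trans (cmod_mkC _ _)) // (splitr e) lerD //; last first.
  by rewrite (le_trans (ltW ax)) // ge_min lexx.
have np : `|cmod p - 1| <= cmod u.
  rewrite -pu ler_norml; have := cmodB_ge p 1; have := cmodB_ge 1 p.
  by rewrite [cmod (1 - p)]cmod_distC cmod1; lra.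
rewrite (le_trans (ln_near1 _)) ?(le_trans np) //.
lra.
Qed.

(** A continuous inverse of [cexp] is differentiable. *)
Lemma cderiv_clog z : - cmod z < cRe z -> cderiv (@clog R) z z^-1.
Proof.
move=> hz e e0; have z0 := slit_neq0 hz; have zp : 0 < cmod z by rewrite cmod_gt0.
pose e1 := Num.min 2^-1 (e * cmod z / 2).
have e10 : 0 < e1 by rewrite lt_min; apply/andP; split; [lra|rewrite divr_gt0 ?mulr_gt0].
have [d1 d10 hd1] := @cderiv_cexp0 R e1 e10.
have d12 : 0 < d1 / 2 by rewrite divr_gt0.
have [d d0 hd] := clog_cont hz d12.
exists d => // h /hd[hk zh0].
pose k := clog (z + h) - clog z; rewrite -/k in hk *.
have kd1 : cmod k < d1 by rewrite (le_lt_trans hk) //; lra.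
have := hd1 _ kd1; rewrite add0r cexp0 mul1r.
have -> : cexp k - 1 = z^-1 * h.
  by rewrite /k cexpB !cexp_clog //; field.
set u := z^-1 * h => H.
have cu : cmod u = cmod h / cmod z by rewrite /u cmodM cmodV mulrC.
have k2 : cmod k <= 2 * cmod u.
  have e12 : e1 <= 2^-1 by rewrite ge_min lexx.
  have := cmodB u (u - k); have -> : u - (u - k) = k by ring.
  have := ler_wpM2r (cmod_ge0 k) e12; lra.
rewrite cmod_distC (le_trans H) // (le_trans (ler_wpM2l (ltW e10) k2)) //.
rewrite cu (le_trans (y := e * cmod z / 2 * (2 * (cmod h / cmod z)))) //.
  have e13 : e1 <= e * cmod z / 2 by rewrite ge_min lexx orbT.
  by apply: ler_wpM2r e13; rewrite mulr_ge0 // divr_ge0 ?cmod_ge0.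
by rewrite le_eqVlt; apply/orP; left; apply/eqP; field; rewrite gt_eqF.
Qed.

End Clog.

(** * Sums over permutations by cycles *)

Section Orbits.
Import boot.fintype boot.finset.
Local Open Scope set_scope.
Variable T : finType.
Implicit Types (s : {perm T}) (x y z i : T) (A : {set T}).

Lemma porbit_sub s A x : (forall z, z \in A -> s z \in A) -> x \in A ->
  porbit s x \subset A.
Proof.
move=> hA xA; apply/subsetP => y /porbitP[k ->].
by elim: k => [|k IH]; rewrite ?expg0 ?perm1 // expgSr permM hA.
Qed.

Lemma porbit_step s x z : z \in porbit s x -> s z \in porbit s x.
Proof.
by move=> /porbitP[k ->]; rewrite -permM -expgSr mem_porbit.
Qed.

(** [tperm i y * s] sends [y] to [i] and [i] to [s y]: it inserts [i] after [y]. *)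
Lemma porbit_insert s i y : s i = i -> y != i ->
  porbit (tperm i y * s) i = i |: porbit s y.
Proof.
move=> si yi; set t := (tperm i y * s)%g.
have ti : t i = s y by rewrite permM tpermL.
have ty : t y = i by rewrite permM tpermR.
have tz z : z != i -> z != y -> t z = s z.
  by move=> zi zy; rewrite permM tpermD // eq_sym.
have i_notin : i \notin porbit s y.
  apply/negP => /porbitP[k]; elim: k => [|k IH].
    by rewrite expg0 perm1 => E; move: yi; rewrite E eqxx.
  rewrite expgSr permM => E; apply: IH; apply: (@perm_inj _ s).
  by rewrite -E.
apply/eqP; rewrite eqEsubset; apply/andP; split.
  apply: porbit_sub; last by rewrite setU11.
  move=> z /setU1P[->|zs]; first by rewrite ti setU1r // porbit_step // porbit_id.
  have [->|zy] := eqVneq z y; first by rewrite ty setU11.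
  have zi : z != i by apply: contraNneq i_notin => <-.
  by rewrite tz // setU1r // porbit_step.
have yt : y \in porbit t i by rewrite porbit_sym -ty porbit_step ?porbit_id.
rewrite subUset sub1set porbit_id /=.
suff : porbit s y \subset porbit t i :\ i.
  by move=> /subset_trans; apply; exact: subsetDl.
apply: porbit_sub; last by rewrite in_setD1 yi yt.
move=> z; rewrite !in_setD1 => /andP[zi zt].
have -> : s z != i by rewrite -si (inj_eq perm_inj).
have [->|zy] := eqVneq z y; first by rewrite -ti porbit_step ?porbit_id.
by rewrite -tz // porbit_step.
Qed.

Lemma porbit_insert_other s i y z : s i = i -> y != i ->
  z != i -> z \notin porbit s y -> porbit (tperm i y * s) z = porbit s z.
Proof.
move=> si yi zi zy; set t := (tperm i y * s)%g.
have pt := porbit_insert si yi; rewrite -/t in pt.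
have tE u : u != i -> u != y -> t u = s u.
  by move=> ui uy; rewrite permM tpermD // eq_sym.
have i_notin : i \notin porbit s z.
  apply/negP; rewrite porbit_sym => /(subsetP (porbit_sub (A := [set i]) _ (set11 i))).
  by rewrite inE (negbTE zi) => /(_ _) H; have := H (fun u => ltac:(by move=> /set1P ->; rewrite si inE)).
have y_notin : y \notin porbit s z by rewrite porbit_sym.
have zt : z \notin porbit t i by rewrite pt in_setU1 negb_or zi.
have i_notin' : i \notin porbit t z by rewrite porbit_sym.
have y_notin' : y \notin porbit t z.
  apply: contra zt => h; rewrite porbit_sym.
  have /eqP <- : porbit t y == porbit t z by rewrite eq_porbit_mem.
  by rewrite porbit_sym pt setU1r // porbit_id.
apply/eqP; rewrite eqEsubset; apply/andP; split; apply: porbit_sub; rewrite ?porbit_id //.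
  move=> u us; rewrite tE ?porbit_step //.
    by apply: contraNneq i_notin => <-.
  by apply: contraNneq y_notin => <-.
move=> u ut; rewrite -tE ?porbit_step //.
  by apply: contraNneq i_notin' => <-.
by apply: contraNneq y_notin' => <-.
Qed.

End Orbits.

Section Lift.
Import boot.fintype boot.finset.
Local Open Scope set_scope.
Variable n : nat.
Implicit Types (s : 'S_n) (i : 'I_n.+1).

Lemma porbit_lift_fix i s : porbit (lift_perm i i s) i = [set i].
Proof.
apply/eqP; rewrite eqEsubset sub1set porbit_id andbT.
by apply: porbit_sub; rewrite ?set11 // => z /set1P ->; rewrite lift_perm_id set11.
Qed.

Lemma porbit_lift i s k :
  porbit (lift_perm i i s) (lift i k) = lift i @: porbit s k.
Proof.
apply/setP => z; apply/porbitP/imsetP => [[m ->]|[k' /porbitP[m ->] ->]].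
  exists ((s ^+ m)%g k); first exact: mem_porbit.
  elim: m => [|m IH]; first by rewrite !expg0 !perm1.
  by rewrite !expgSr !permM IH lift_perm_lift.
exists m; elim: m => [|m IH]; first by rewrite !expg0 !perm1.
by rewrite !expgSr !permM -IH lift_perm_lift.
Qed.

Definition insert_perm i (p : 'I_n.+1 * 'S_n) : 'S_n.+1 :=
  (tperm i p.1 * lift_perm i i p.2)%g.

(** The permutation determines [y] as the preimage of [i]. *)
Lemma insert_perm_bij i : bijective (insert_perm i).
Proof.
apply: inj_card_bij; last first.
  by rewrite card_prod card_ord !card_Sn factS.
move=> [y s] [y' s']; rewrite /insert_perm /= => E.
have fixL (t : 'S_n) : lift_perm i i t i = i by exact: lift_perm_id.
have yy : y = y'.
  apply: (@perm_inj _ (tperm i y * lift_perm i i s)).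
  by rewrite {2}E !permM !tpermR !fixL.
subst y'; congr (_, _); have {}E : lift_perm i i s = lift_perm i i s'.
  by move: E => /mulgI.
apply/permP => k; have := congr1 (fun p : 'S_n.+1 => p (lift i k)) E.
by rewrite !lift_perm_lift => /lift_inj.
Qed.

End Lift.

Section CycleIndex.
Import boot.fintype boot.finset.
Local Open Scope set_scope.
Variable F : comNzRingType.
Variable a : nat -> F.

Definition cycle_sum n : F := \sum_(s : 'S_n) \prod_(c in porbits s) a #|c|.

(** The cycle through [y] is weighted as if it had [j] more elements. This extra
    parameter closes the recursion [marked_sumS]: deleting a marked point from its
    cycle marks its predecessor and adds one to [j]. *)
Definition marked n (s : 'S_n) j (y : 'I_n) : F :=
  a (#|porbit s y| + j)%N * \prod_(c in porbits s | y \notin c) a #|c|.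

Definition marked_sum n j : F := \sum_(s : 'S_n) \sum_(y < n) marked s j y.

Lemma marked0 n (s : 'S_n) y : marked s 0%N y = \prod_(c in porbits s) a #|c|.
Proof.
rewrite /marked addn0 [RHS](bigD1 (porbit s y)) /=; last by apply/imsetP; exists y.
congr (_ * _); apply: eq_bigl => c; case: (boolP (c \in porbits s)) => //= /imsetP[z _ ->].
by rewrite eq_porbit_mem porbit_sym.
Qed.

Lemma marked_sum0 n : marked_sum n 0%N = n%:R * cycle_sum n.
Proof.
rewrite /marked_sum /cycle_sum mulr_sumr; apply: eq_bigr => s _.
rewrite [LHS](eq_bigr (fun=> \prod_(c in porbits s) a #|c|))  => [|y _]; last exact: marked0.
by rewrite sumr_const card_ord mulr_natl.
Qed.

(** Covers both the insertion of [i] as a fixed point ([A] empty) and into the cycle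
    [A]. *)
Lemma porbits_insert n (i : 'I_n.+1) (s : 'S_n) (A : {set 'I_n}) (y : 'I_n.+1) :
  (porbit (insert_perm i (y, s)) i = i |: (lift i @: A)) ->
  (forall k, k \notin A -> porbit (insert_perm i (y, s)) (lift i k) = lift i @: porbit s k) ->
  \prod_(c in porbits (insert_perm i (y, s)) | i \notin c) a #|c| =
  \prod_(c in [set porbit s k | k in ~: A]) a #|c|.
Proof.
move=> hi hk; set t := insert_perm i (y, s) in hi hk *.
have inj : injective (fun c : {set 'I_n} => lift i @: c) by apply: imset_inj; exact: lift_inj.
transitivity (\prod_(c in (fun c : {set 'I_n} => lift i @: c) @: [set porbit s k | k in ~: A]) a #|c|).
  apply: eq_bigl => c; apply/andP/imsetP => [[/imsetP[z _ ->] iz]|[c' /imsetP[k kA ->] ->]].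
    have zi : i != z by apply: contraNneq iz => <-; rewrite porbit_id.
    have [k zk _] := unlift_some zi; rewrite zk in iz *.
    have kA : k \notin A.
      apply: contra iz => kA; rewrite porbit_sym hi setU1r //.
      by apply/imsetP; exists k.
    exists (porbit s k); last exact: hk.
    by apply/imsetP; exists k => //; rewrite inE.
  rewrite inE in kA; split; first by apply/imsetP; exists (lift i k) => //; rewrite hk.
  by apply/negP => /imsetP[k' _ /eqP]; rewrite (negbTE (neq_lift _ _)).
rewrite big_imset /=; last by move=> c d _ _; exact: inj.
by apply: eq_bigr => c _; rewrite card_imset //; exact: lift_inj.
Qed.

Lemma marked_insert_fix n (i : 'I_n.+1) (s : 'S_n) j :
  marked (insert_perm i (i, s)) j i = a j.+1 * \prod_(c in porbits s) a #|c|.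
Proof.
have tE : insert_perm i (i, s) = lift_perm i i s by rewrite /insert_perm tperm1 mul1g.
rewrite /marked (@porbits_insert _ i s set0 i) tE.
- rewrite porbit_lift_fix cards1 add1n; congr (_ * _); apply: eq_bigl => c.
  by apply/imsetP/imsetP => -[k _ ->]; exists k; rewrite // !inE.
- by rewrite porbit_lift_fix imset0 setU0.
- by move=> k _; rewrite porbit_lift.
Qed.

Lemma marked_insert n (i : 'I_n.+1) (s : 'S_n) j (k : 'I_n) :
  marked (insert_perm i (lift i k, s)) j i = marked s j.+1 k.
Proof.
have fi : lift_perm i i s i = i by exact: lift_perm_id.
have ki : lift i k != i by rewrite eq_sym neq_lift.
have pi : porbit (insert_perm i (lift i k, s)) i = i |: (lift i @: porbit s k).
  by rewrite /insert_perm porbit_insert // porbit_lift.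
rewrite /marked (@porbits_insert _ i s (porbit s k) (lift i k)) //.
  rewrite pi cardsU1 card_imset; last exact: lift_inj.
  have -> : i \notin lift i @: porbit s k.
    by apply/negP => /imsetP[k' _ /eqP]; rewrite (negbTE (neq_lift _ _)).
  rewrite add1n addSnnS; congr (_ * _); apply: eq_bigl => c.
  apply/imsetP/andP => [[z zk ->]|[/imsetP[z _ ->] zk]].
    by rewrite inE in zk; rewrite porbit_sym; split=> //; exact: imset_f.
  by exists z => //; rewrite inE porbit_sym.
move=> z zk; rewrite /insert_perm porbit_insert_other ?porbit_lift // ?(eq_sym _ i) ?neq_lift //.
apply/negP => /imsetP[z' z'k /lift_inj zz]; by move: zk; rewrite zz z'k.
Qed.

Lemma marked_sumS n j :
  marked_sum n.+1 j = n.+1%:R * (a j.+1 * cycle_sum n + marked_sum n j.+1).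
Proof.
rewrite /marked_sum exchange_big /=.
rewrite [LHS](eq_bigr (fun=> a j.+1 * cycle_sum n + marked_sum n j.+1)) => [|i _].
  by rewrite sumr_const card_ord mulr_natl.
rewrite (reindex (insert_perm i)); last exact/onW_bij/insert_perm_bij.
rewrite (eq_bigr (fun p : 'I_n.+1 * 'S_n => marked (insert_perm i (p.1, p.2)) j i)); last by case.
rewrite -(pair_bigA _ (fun y s => marked (insert_perm i (y, s)) j i)) /=.
rewrite (bigD1_ord i) //=; congr (_ + _).
  by rewrite /cycle_sum mulr_sumr; apply: eq_bigr => s _; exact: marked_insert_fix.
rewrite exchange_big /marked_sum; apply: eq_bigr => s _; apply: eq_bigr => k _.
exact: marked_insert.
Qed.

End CycleIndex.

Section Normalized.
Variable F : numFieldType.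
Variable a : nat -> F.

(** The exponential formula for permutations, as the recurrence that
    characterizes the coefficients of [exp (sum_k (a k / k) t^k)]. *)
Lemma cycle_sum_rec n :
  n.+1%:R * (cycle_sum a n.+1 / n.+1`!%:R) =
  \sum_(j < n.+1) cycle_sum a j / j`!%:R * a (n - j).+1.
Proof.
have V m j : marked_sum a m j / m`!%:R =
    \sum_(i < m) cycle_sum a i / i`!%:R * a (j + (m - i))%N.
  elim: m j => [|m IH] j.
    rewrite big_ord0 /marked_sum big1 ?mul0r // => s _; exact: big_ord0.
  have m0 : m.+1%:R != 0 :> F by rewrite pnatr_eq0.
  have f0 : m`!%:R != 0 :> F by rewrite pnatr_eq0 -lt0n fact_gt0.
  rewrite marked_sumS factS natrM big_ord_recr /= subSnn addn1 -mulf_div divff // mul1r.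
  rewrite mulrDl IH addrC [a _ * _]mulrC mulrAC; congr (_ + _).
  apply: eq_bigr => i _; rewrite subSn; last exact: ltnW.
  by rewrite addnS addSn.
rewrite mulrA -marked_sum0 V; apply: eq_bigr => i _.
by rewrite add0n subSn // -ltnS.
Qed.

End Normalized.

(** * Exponentials of a logarithmic singularity *)

Section Core.
Variable R : realType.
Implicit Types (x y : R) (z v w u t : C R) (n : nat).

Lemma cRe_inv w : cRe w^-1 = cRe w / cmod w ^+ 2.
Proof.
have [->|w0] := eqVneq w 0.
  by rewrite invr0 -toC0 /= mul0r.
have n0 : cmod w ^+ 2 != 0 by rewrite expf_neq0 // cmod_eq0.
suff -> : w^-1 = mkC (cRe w / cmod w ^+ 2) (- cIm w / cmod w ^+ 2) by [].
have c0 : cmod w != 0 by rewrite cmod_eq0.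
apply: (mulfI w0); rewrite divff // {1}(mkCE w) mkCM -toC1 /toC; congr mkC; last by field.
by rewrite -[LHS](divff n0) {1}sqr_cmod; field.
Qed.

Definition clogV z : C R := clog (1 - z)^-1.

Lemma indented_neq1 (R1 kappa : R) z : indented R1 kappa z -> z - 1 != 0.
Proof.
by move=> [_ h]; apply/eqP => E; move: h; rewrite E cmod0 mulr0 -toC0 /= ltxx.
Qed.

(** On the indented disc [1 / (1 - z)] avoids the cut of the logarithm. *)
Lemma indented_slit (R1 kappa : R) z : kappa <= 1 -> indented R1 kappa z ->
  - cmod (1 - z)^-1 < cRe (1 - z)^-1.
Proof.
move=> k1 hz; have z1 := indented_neq1 hz; case: hz => _ hz.
have E : 1 - z = - (z - 1) by rewrite opprB.
have cp : 0 < cmod (1 - z) by rewrite cmod_distC cmod_gt0.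
have re : - cmod (1 - z) < cRe (1 - z).
  rewrite E cmodN cReN ltrN2 (lt_le_trans hz) // ler_piMl ?cmod_ge0 //.
rewrite cRe_inv cmodV ltr_pdivlMr ?exprn_gt0 //.
by have -> : - (cmod (1 - z))^-1 * cmod (1 - z) ^+ 2 = - cmod (1 - z) by field; rewrite gt_eqF.
Qed.

Lemma cderiv_clogV (R1 kappa : R) z : kappa <= 1 -> indented R1 kappa z ->
  cderiv clogV z (1 - z)^-1.
Proof.
move=> k1 hz; have sl := indented_slit k1 hz.
have z1 : 1 - z != 0 by rewrite -oppr_eq0 opprB (indented_neq1 hz).
have h := cderiv_comp (cderiv_comp (cderivB (cderiv_cst 1 z) (cderiv_id z)) (cderivV z1))
  (cderiv_clog sl).
by apply: (cderiv_eq h); field.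
Qed.

Lemma clogV0 : clogV 0 = 0.
Proof.
rewrite /clogV subr0 invr1 /clog /carg cmod1 ln1 -toC1 /= divr1 acos1 lexx.
exact: toC0.
Qed.

Lemma cmod_cexp_clogV (beta : C R) z : z - 1 != 0 ->
  cmod (cexp (beta * clogV z)) <= expR (`|cIm beta| * pi) * cmod (z - 1) `^ (- cRe beta).
Proof.
move=> z1; have z1' : (1 - z)^-1 != 0 by rewrite invr_neq0 // -oppr_eq0 opprB.
have cp : 0 < cmod (z - 1) by rewrite cmod_gt0.
rewrite cmod_cexp cReM /clogV /clog /= cmodV cmod_distC lnV ?posrE // powRE // -expRD ler_expR.
have h := carg_lepi z1'.
have : - (cIm beta * carg (1 - z)^-1) <= `|cIm beta| * pi.
  rewrite (le_trans (ler_norm _)) // normrN normrM ler_wpM2l //.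
lra.
Qed.

Lemma geo_psum (beta : C R) t : cmod t < 1 -> cconv (psum (fun=> beta) t) (beta * (1 - t)^-1).
Proof.
move=> t1 e e0.
have t1' : 1 - t != 0.
  by rewrite subr_eq0; apply/eqP => E; move: t1; rewrite -E cmod1 ltxx.
have cp : 0 < cmod (1 - t) by rewrite cmod_gt0.
have [N hN] := geo_cvg0 (cmod beta / cmod (1 - t)) (cmod_ge0 t) t1 e0.
exists N => n /hN; apply: le_trans.
have -> : psum (fun=> beta) t n - beta * (1 - t)^-1 = - (beta * t ^+ n / (1 - t)).
  rewrite /psum -mulr_sumr; have := subrX1 t n; set S := \sum_(i < n) _ => E.
  have -> : t ^+ n = 1 + (t - 1) * S by rewrite -E; ring.
  by field.
by rewrite cmodN !cmodM cmodV cmodX mulrAC.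
Qed.

Lemma negbin_psum (beta : C R) : exists2 d : R, 0 < d &
  (forall k, cmod (negbin beta k) * d ^+ k <= 1) /\
  (forall t, cmod t < d -> cconv (psum (negbin beta) t) (cexp (beta * clogV t))).
Proof.
have h2 : 1 < (2 : R) by rewrite ltr1n.
have h1 : 0 < (2^-1 : R) by rewrite invr_gt0.
apply: (@exp_psum R (fun=> beta) (negbin beta) _ (fun t => beta * (1 - t)^-1) 1 (cmod beta)) => //.
- exact: negbin_rec.
- by move=> k _; rewrite expr1n mulr1.
- by rewrite clogV0 mulr0.
- move=> t t1; apply: cderivZ; apply: (@cderiv_clogV 2 2^-1); first lra.
  exact: indented_disc.
- by move=> t t1; exact: geo_psum.
Qed.

(** Away from its corner [1] the closed indented disc is compact. *)
Lemma indented_bounded (R1 kappa d : R) (f : C R -> C R) : 0 < R1 -> 0 < d -> 0 <= kappa <= 1 ->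
  (forall z, cmod z <= R1 -> cRe (z - 1) <= kappa * cmod (z - 1) -> d <= cmod (z - 1) ->
     exists l, cderiv f z l) ->
  exists B : R, forall z, cmod z <= R1 -> cRe (z - 1) <= kappa * cmod (z - 1) ->
     d <= cmod (z - 1) -> cmod (f z) <= B.
Proof.
move=> R10 d0 /andP[k0 k1] hf.
pose S z := [/\ cmod z <= R1, cRe (z - 1) <= kappa * cmod (z - 1) & d <= cmod (z - 1)].
have [|||B hB] := @box_bounded R S f (mkC (- R1) (- R1)) (2 * R1) (2 * R1).
- by rewrite mulr_ge0 // ltW.
- by rewrite mulr_ge0 // ltW.
- move=> z; have [[s1 s2 s3]|nS] := pselect (S z).
    have [l hl] := hf z s1 s2 s3.
    have [e e0 he] := cderiv_cont hl ltr01.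
    exists e => //; exists (cmod (f z) + 1) => u uz _.
    have := he _ uz; rewrite [z + _]addrC subrK => H.
    by rewrite -[f u](subrK (f z)) (le_trans (cmodD _ _)) // addrC lerD2l.
  have lip u v : cmod u <= cmod v + cmod (u - v).
    by rewrite -{1}[u](subrK v) (le_trans (cmodD _ _)) // addrC.
  have lip1 u : cmod (u - 1) <= cmod (z - 1) + cmod (u - z).
    by have := lip (u - 1) (z - 1); rewrite opprB addrA subrK.
  have lip2 u : cmod (z - 1) <= cmod (u - 1) + cmod (u - z).
    by have := lip (z - 1) (u - 1); rewrite opprB addrA subrK (cmod_distC z u).
  suff [e e0 he] : exists2 e : R, 0 < e & forall u, cmod (u - z) < e -> ~ S u.
    by exists e => //; exists 0 => u /he.
  have [z1|z1] := ltP R1 (cmod z).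
    exists (cmod z - R1); first by rewrite subr_gt0.
    by move=> u uz [s1 _ _]; have := lip z u; rewrite cmod_distC; lra.
  have [z2|z2] := ltP (kappa * cmod (z - 1)) (cRe (z - 1)).
    exists ((cRe (z - 1) - kappa * cmod (z - 1)) / 2); first by rewrite divr_gt0 // subr_gt0.
    move=> u uz [_ s2 _].
    have E : cRe (z - 1) = cRe (u - 1) - cRe (u - z) by rewrite !cReB; ring.
    have := cRe_le (u - z); rewrite ler_norml => /andP[a1 _].
    have := ler_wpM2l k0 (lip1 u); rewrite mulrDr.
    have : kappa * cmod (u - z) <= cmod (u - z) by rewrite ler_piMl ?cmod_ge0.
    lra.
  have [z3|z3] := leP d (cmod (z - 1)); first by case: nS.
  exists (d - cmod (z - 1)); first by rewrite subr_gt0.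
  by move=> u uz [_ _ s3]; have := lip1 u; lra.
exists B => z s1 s2 s3; apply: hB => //.
have := cRe_le z; have := cIm_le z; rewrite !ler_norml => /andP[a1 a2] /andP[b1 b2].
split; rewrite /=; lra.
Qed.

Lemma cexpM_deriv (f : C R -> C R) z l : cderiv f z l -> exists l', cderiv (fun w => cexp (f w)) z l'.
Proof. by move=> h; eexists; exact: cderiv_comp h (cderiv_cexp _). Qed.

(** Subtracting [c (1 - z)^(- vartheta b)], with [c = exp (b K + D 1)], from
    [exp (b g + D)] leaves a function that is [O(|1 - z|^(1 - Re (vartheta b)))] in
    the indented disc; [transfer] makes its coefficients smaller by a factor
    [1/n] than those of the subtracted term, which [negbin_asymp] evaluates. *)
Lemma exp_log_asymp (R1 kappa vartheta d0 K0 rhoD rho0 B0 : R) (K b : C R)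
    (g D A' : C R -> C R) (a q : nat -> C R) :
  1 < R1 -> 0 < kappa < 1 -> 0 < d0 -> 1 < rhoD -> 0 < rho0 ->
  (forall z, indented R1 kappa z -> exists l, cderiv g z l) ->
  (forall z, indented R1 kappa z -> cmod (z - 1) < d0 ->
     cmod (g z - (toC vartheta * clogV z + K)) <= K0 * cmod (z - 1)) ->
  (forall z, cmod z < rhoD -> exists l, cderiv D z l) ->
  exp_rec a q -> (forall k, (0 < k)%N -> cmod (a k) * rho0 ^+ k <= B0) ->
  b * g 0 + D 0 = 0 ->
  (forall t, cmod t < rho0 -> cderiv (fun z => b * g z + D z) t (A' t)) ->
  (forall t, cmod t < rho0 -> cconv (psum (fun k => a k.+1) t) (A' t)) ->
  exists B : R, exists N, forall n, (N <= n)%N -> (0 < n)%N ->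
    cmod (q n / cpow n%:R (toC vartheta * b - 1) -
      cexp (b * K) * cexp (D 1) * rgamma (toC vartheta * b)) <= B / n%:R.
Proof.
move=> R11 /andP[k0 k1] d00 rhoD1 rho00 hg hsing hD qa aB A0 dA cA.
pose beta := toC vartheta * b.
pose c := cexp (b * K) * cexp (D 1).
pose f z := cexp (b * g z + D z) - c * cexp (beta * clogV z).
(* The disc is shrunk so that its closure, apart from [1], lies in the domain of
   [g] and of [D]. *)
pose R2 := Num.min ((1 + R1) / 2) ((1 + rhoD) / 2).
have R21 : 1 < R2 by rewrite lt_min; apply/andP; split; lra.
have R2R1 : R2 < R1 by rewrite gt_min; apply/orP; left; lra.
have R2D : R2 < rhoD by rewrite gt_min; apply/orP; right; lra.
pose k2 := kappa / 2.
have k20 : 0 < k2 < 1 by rewrite /k2; lra.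
have [k20' k21'] := andP k20.
have shrink z : indented R2 k2 z -> indented R1 kappa z.
  move=> [h1 h2]; split; first exact: lt_trans R2R1.
  by rewrite (lt_le_trans h2) // ler_wpM2r ?cmod_ge0 // /k2; lra.
have fd z : indented R1 kappa z -> cmod z < rhoD -> exists l, cderiv f z l.
  move=> hz zr; have [lg hlg] := hg z hz; have [lD hlD] := hD z zr.
  have [l1 h1] := cexpM_deriv (cderivD (cderivZ b hlg) hlD).
  have [l2 h2] := cexpM_deriv (cderivZ beta (cderiv_clogV (ltW k1) hz)).
  eexists; exact: cderivB h1 (cderivZ c h2).
(* The factor [cexp (beta * clogV z)] carries the singularity of both terms of [f],
   and what it multiplies vanishes at [1]. *)
have [dD dD0 hdD] : exists2 dD : R, 0 < dD & exists KD : R, 0 <= KD /\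
    forall z, cmod (z - 1) < dD -> cmod (D z - D 1) <= KD * cmod (z - 1).
  have [|l hl] := hD 1; first by rewrite cmod1.
  have [dD dD0 H] := cderiv_lip hl; exists dD => //.
  exists (cmod l + 1); split; first by rewrite addr_ge0 ?cmod_ge0.
  by move=> z /H; rewrite [1 + _]addrC subrK.
have [KD [KD0 {}hdD]] := hdD.
pose d := Num.min d0 dD; have dp : 0 < d by rewrite lt_min d00.
pose C2 := cmod b * `|K0| + KD.
have C20 : 0 <= C2 by rewrite addr_ge0 // mulr_ge0 ?cmod_ge0.
pose alpha : R := 1 - cRe beta.
pose M1 := expR (`|cIm beta| * pi) * cmod c * (expR (C2 * d) * C2).
have near1 z : indented R1 kappa z -> cmod (z - 1) < d ->
    cmod (f z) <= M1 * cmod (z - 1) `^ alpha.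
  move=> hz; rewrite lt_min => /andP[z1 z2].
  have z0 := indented_neq1 hz; have zp : 0 < cmod (z - 1) by rewrite cmod_gt0.
  pose h := b * (g z - (toC vartheta * clogV z + K)) + (D z - D 1).
  have hh : cmod h <= C2 * cmod (z - 1).
    rewrite (le_trans (cmodD _ _)) // mulrDl lerD ?hdD // cmodM -mulrA ler_wpM2l ?cmod_ge0 //.
    by rewrite (le_trans (hsing _ hz z1)) // ler_wpM2r ?cmod_ge0 // ler_norm.
  have -> : f z = c * cexp (beta * clogV z) * (cexp h - 1).
    rewrite /f mulrBr mulr1 /c -!cexpD; congr (cexp _ - _).
    by rewrite /h /beta; ring.
  rewrite (cmodM _ (cexp h - 1)) (cmodM c).
  have e1 : cmod (cexp h - 1) <= expR (C2 * d) * C2 * cmod (z - 1).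
    rewrite (le_trans (cexp_lip_le _)) // -mulrA ler_pM ?expR_ge0 ?cmod_ge0 // ler_expR.
    rewrite (le_trans hh) // ler_wpM2l // ltW // lt_min z1 //.
  have e2 := cmod_cexp_clogV beta z0.
  have -> : M1 * cmod (z - 1) `^ alpha = cmod c * (expR (`|cIm beta| * pi) * cmod (z - 1) `^ (- cRe beta))
      * (expR (C2 * d) * C2 * cmod (z - 1)).
    rewrite /M1 /alpha powRD; last by rewrite (gt_eqF zp) implybT.
    by rewrite powRr1 ?cmod_ge0 //; ring.
  by rewrite ler_pM ?mulr_ge0 ?cmod_ge0 // ler_wpM2l ?cmod_ge0.
have [M2 hM2] : exists M : R, forall z, cmod z <= R2 -> cRe (z - 1) <= k2 * cmod (z - 1) ->
     d <= cmod (z - 1) -> cmod (f z) <= M.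
  apply: indented_bounded => //; [lra|by rewrite !ltW|].
  move=> z s1 s2 s3; apply: fd; last exact: le_lt_trans R2D.
  split; first exact: le_lt_trans R2R1.
  by rewrite (le_lt_trans s2) // ltr_pM2r ?(lt_le_trans dp) // /k2; lra.
pose cc := Num.max d^-1 (R2 + 1).
have cc1 : 1 <= cc by rewrite le_max; apply/orP; right; lra.
pose M := Num.max M1 (`|M2| * cc `^ `|alpha|).
have fM z : indented R2 k2 z -> cmod (f z) <= M * cmod (z - 1) `^ alpha.
  move=> hz; have z0 := indented_neq1 (shrink _ hz); have zp : 0 < cmod (z - 1) by rewrite cmod_gt0.
  have [zd|zd] := ltP (cmod (z - 1)) d.
    rewrite (le_trans (near1 _ (shrink _ hz) zd)) // ler_wpM2r ?powR_ge0 //.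
    by rewrite le_max lexx.
  have [h1 h2] := hz.
  rewrite (le_trans (hM2 _ (ltW h1) (ltW h2) zd)) //.
  rewrite (le_trans (y := `|M2| * cc `^ `|alpha| * cmod (z - 1) `^ alpha)) //; last first.
    by rewrite ler_wpM2r ?powR_ge0 // le_max lexx orbT.
  have p1 : 1 `^ alpha = 1 by rewrite powR1.
  rewrite (le_trans (ler_norm _)) // -mulrA ler_peMr // -[X in X <= _]p1.
  apply: powR_ratio_le => //.
    rewrite -ler_pdivrMr // mul1r le_max; apply/orP; left.
    by rewrite lef_pV2 ?posrE.
  rewrite mulr1 le_max; apply/orP; right.
  by rewrite (le_trans (cmodB _ _)) // cmod1 lerD2r ltW.
have [d1 d10 [qB qc]] := exp_psum rho00 qa aB A0 dA cA.
have [d2 d20 [nB nc]] := negbin_psum beta.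
pose fn k := q k - c * negbin beta k.
pose d3 := Num.min d1 d2; have d30 : 0 < d3 by rewrite lt_min d10.
have fnc t : cmod t < d3 -> cconv (psum fn t) (f t).
  rewrite lt_min => /andP[t1 t2] e e0.
  have e2 : 0 < e / 2 by rewrite divr_gt0.
  have e3 : 0 < e / 2 / (cmod c + 1) by rewrite divr_gt0 // ltr_wpDl ?cmod_ge0.
  have [N1 h1] := qc _ t1 _ e2; have [N2 h2] := nc _ t2 _ e3.
  exists (maxn N1 N2) => n; rewrite geq_max => /andP[/h1 K1 /h2 K2].
  have -> : psum fn t n - f t = (psum q t n - cexp (b * g t + D t)) -
     c * (psum (negbin beta) t n - cexp (beta * clogV t)).
    have -> : psum fn t n = psum q t n - c * psum (negbin beta) t n.
      rewrite /psum mulr_sumr -sumrB; apply: eq_bigr => k _; rewrite /fn; ring.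
    rewrite /f; ring.
  rewrite (le_trans (cmodB _ _)) // (splitr e) lerD // cmodM.
  rewrite (le_trans (ler_wpM2l (cmod_ge0 _) K2)) // mulrA ler_pdivrMr ?ltr_wpDl ?cmod_ge0 //.
  by rewrite mulrC ler_wpM2l ?(ltW e2) // lerDl.
have fnB k : cmod (fn k) * d3 ^+ k <= 1 + cmod c.
  have p1 : d3 ^+ k <= d1 ^+ k by rewrite lerXn2r ?nnegrE ?(ltW d30) ?(ltW d10) // ge_min lexx.
  have p2 : d3 ^+ k <= d2 ^+ k by rewrite lerXn2r ?nnegrE ?(ltW d30) ?(ltW d20) // ge_min lexx orbT.
  rewrite (le_trans (ler_wpM2r _ (cmodB _ _))) ?exprn_ge0 ?(ltW d30) // mulrDl lerD //.
    by rewrite (le_trans _ (qB k)) // ler_wpM2l ?cmod_ge0.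
  rewrite cmodM -mulrA ler_piMr ?cmod_ge0 //.
  by rewrite (le_trans _ (nB k)) // ler_wpM2l ?cmod_ge0.
have [B hB] := transfer R21 k20 d30 fnB fnc
  (fun z hz => fd z (shrink z hz) (lt_trans hz.1 R2D)) fM.
have [E [N hN]] := negbin_asymp beta.
exists (B + cmod c * E), N => n Nn n0.
have n0' : 0 < n%:R :> R by rewrite ltr0n.
have -> : q n / cpow n%:R (beta - 1) - c * rgamma beta =
   fn n / cpow n%:R (beta - 1) + c * (negbin beta n / cpow n%:R (beta - 1) - rgamma beta).
  by rewrite /fn; ring.
have -> : (B + cmod c * E) / n%:R = B / n%:R + cmod c * (E / n%:R) by ring.
rewrite (le_trans (cmodD _ _)) // lerD //; last first.
  by rewrite (cmodM c) ler_wpM2l ?cmod_ge0 // hN.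
rewrite cmodM cmodV cmod_cpow // ler_pdivrMr ?powR_gt0 // (le_trans (hB _ n0)) //.
rewrite cReB -[cRe 1]/(cRe 1) -[in cRe 1]toC1 /= /alpha.
have -> : - (1 - cRe beta) - 1 = (cRe beta - 1) - 1 by ring.
rewrite (@powRB _ _ (cRe beta - 1) 1); last by rewrite (gt_eqF n0') implybT.
by rewrite powRr1 ?(ltW n0') // mulrA mulrAC.
Qed.

End Core.

(** * The generalized Ewens measure *)

Section EwensCycleSum.
Variable R : realType.

Lemma prod_porbits_count (F : comNzRingType) N (s : 'S_N) (a : nat -> F) :
  \prod_(c in porbits s) a #|c| = \prod_(1 <= k < N.+1) a k ^+ cycle_count s k.
Proof.
transitivity (\prod_(c in porbits s) \prod_(1 <= k < N.+1 | k == #|c|) a k).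
  apply: eq_bigr => c /imsetP[x _ ->]; rewrite big_mkcond.
  rewrite (bigD1_seq #|porbit s x|) ?iota_uniq //=.
    by rewrite eqxx big1 ?mulr1 // => k /negbTE ->.
  rewrite mem_index_iota lt0n card_porbit_neq0 ltnS /=.
  by rewrite -[X in (_ <= X)%N](card_ord N) max_card.
rewrite (exchange_big_dep xpredT) //=; apply: eq_bigr => k _.
rewrite /cycle_count -prodr_const; apply: eq_bigl => c; rewrite inE.
by rewrite eq_sym.
Qed.

Lemma ewens_expect_cycle_sum (theta : nat -> R) (P : {poly {poly C R}}) (x1 x2 : C R) N :
  ewens_expect theta (@W R P x1 x2 N) =
  (cycle_sum (fun k => toC (theta k) * bieval P (x1 ^+ k) (x2 ^+ k)) N / N`!%:R) /
  (cycle_sum (fun k => toC (theta k)) N / N`!%:R).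
Proof.
have wE (s : 'S_N) : toC (ewens_weight theta s) = \prod_(c in porbits s) toC (theta #|c|).
  rewrite (prod_porbits_count s (fun k => toC (theta k))) /ewens_weight toC_prod.
  by apply: eq_bigr => k _; rewrite toCX.
have hE : toC (ewens_h theta N) = cycle_sum (fun k => toC (theta k)) N / N`!%:R.
  rewrite /ewens_h toCM toCV toC_nat toC_sum; congr (_ / _).
  by apply: eq_bigr => s _; exact: wE.
have pE (s : 'S_N) : toC (ewens_prob theta s) =
    toC (ewens_weight theta s) / (toC (ewens_h theta N) * N`!%:R).
  by rewrite /ewens_prob; move: (ewens_h theta N) => h; rewrite toCM toCV toCM toC_nat.
rewrite -hE; move: (toC (ewens_h theta N)) pE => h pE.
rewrite /ewens_expect /cycle_sum !mulr_suml; apply: eq_bigr => s _.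
have -> : \prod_(c in porbits s) (toC (theta #|c|) * bieval P (x1 ^+ #|c|) (x2 ^+ #|c|)) =
    \prod_(c in porbits s) toC (theta #|c|) * W P x1 x2 s by exact: big_split.
by rewrite pE wE invfM; ring.
Qed.

Lemma cycle_sum_exp_rec (a : nat -> C R) :
  exp_rec a (fun n => cycle_sum a n / n`!%:R).
Proof.
split; last by move=> n; exact: cycle_sum_rec.
rewrite fact0 divr1 /cycle_sum (eq_bigr (fun=> 1)).
  by rewrite sumr_const card_Sn fact0.
by move=> s _; rewrite big_pred0 // => c; apply/negP => /imsetP[[]].
Qed.

Lemma exp_rec_scale (a q : nat -> C R) (c : C R) : exp_rec a q ->
  exp_rec (fun k => a k * c ^+ k) (fun n => q n * c ^+ n).
Proof.
move=> [q0 qS]; split=> [|n]; first by rewrite q0 expr0 mulr1.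
rewrite mulrA qS mulr_suml; apply: eq_bigr => j _.
have E : c ^+ n.+1 = c ^+ j * c ^+ (n - j).+1.
  by rewrite -exprD addnS subnKC // -ltnS.
by rewrite E; ring.
Qed.

End EwensCycleSum.

Section Singularity.
Variable R : realType.
Implicit Types (x y : R) (z v w u t : C R) (n : nat).

Lemma cconv_unique (u : nat -> C R) l l' : cconv u l -> cconv u l' -> l = l'.
Proof. by move=> /cconv_lim <- /cconv_lim. Qed.

(** The coefficients of [g_Theta (r z)]; the one of index [0] is [0] because
    [0^-1 = 0]. *)
Definition gcoef (theta : nat -> R) (r : R) (k : nat) : C R :=
  toC (theta k / k%:R * r ^+ k).

Lemma g_partial_psum (theta : nat -> R) (r : R) z n :
  g_partial theta (toC r * z) n = psum (gcoef theta r) z n.+1.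
Proof.
rewrite /psum -(big_mkord xpredT (fun k => gcoef theta r k * z ^+ k)) big_nat_recl //.
rewrite {1}/gcoef invr0 mulr0 mul0r toC0 mul0r add0r /g_partial big_add1.
apply: eq_bigr => k _; rewrite (exprMn _ (toC r)) /gcoef [toC (_ * r ^+ _)]toCM toCX.
by rewrite mulrA.
Qed.

Lemma conv_terms_bounded (a : nat -> C R) t l : cconv (psum a t) l ->
  exists A : R, forall k, cmod (a k * t ^+ k) <= A.
Proof.
move=> /(_ 1 ltr01)[N hN].
exists (2 + \sum_(k < N) cmod (a k * t ^+ k)) => k.
have s0 : 0 <= \sum_(k < N) cmod (a k * t ^+ k) by apply: sumr_ge0 => i _; exact: cmod_ge0.
have [Nk|kN] := leqP N k.
  have -> : a k * t ^+ k = (psum a t k.+1 - l) - (psum a t k - l) by rewrite psumS; ring.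
  rewrite (le_trans (cmodB _ _)) //.
  by have := hN _ Nk; have := hN _ (leqW Nk); lra.
rewrite (bigD1 (Ordinal kN)) //= -[X in X <= _]addr0 addrA lerD //; last first.
  by apply: sumr_ge0 => i _; exact: cmod_ge0.
by rewrite lerDr.
Qed.

(** Cauchy's bound, from the boundedness of [f] on the closed disc of radius
    [rho]: the series converges on the whole unit disc although it is only known to
    sum to [f] near [0]. *)
Lemma disc_coef_bound (a : nat -> C R) (f : C R -> C R) (d A rho : R) :
  0 < d -> 0 < rho < 1 -> (forall k, cmod (a k) * d ^+ k <= A) ->
  (forall t, cmod t < d -> cconv (psum a t) (f t)) ->
  (forall z, cmod z < 1 -> exists l, cderiv f z l) ->
  exists B : R, forall k, cmod (a k) * rho ^+ k <= B.
Proof.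
move=> d0 /andP[r0 r1] hA hf hd.
have [B hB] : exists B : R, forall z, inbox (mkC (- 1) (- 1)) 2 2 z -> cmod z <= rho ->
    cmod (f z) <= B.
  apply: (@box_bounded R (fun z => cmod z <= rho)); [lra|lra|] => z.
  have [zr|zr] := leP (cmod z) rho.
    have [l hl] := hd z (le_lt_trans zr r1).
    have [e e0 he] := cderiv_cont hl ltr01.
    exists e => //; exists (cmod (f z) + 1) => u uz _.
    have := he _ uz; rewrite [z + _]addrC subrK => H.
    by rewrite -[f u](subrK (f z)) (le_trans (cmodD _ _)) // addrC lerD2l.
  exists (cmod z - rho); first by rewrite subr_gt0.
  exists 0 => u uz ur; have := cmodD (z - u) u; rewrite subrK cmod_distC; lra.
exists B => k.
apply/ler_addgt0Pr => e e0.
have e1 : 0 < e / rho ^+ k by rewrite divr_gt0 // exprn_gt0.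
have [|N0 hN] := coef_cavg k d0 r0 hA hf _ e1.
  by move=> z /andP[_ zr]; apply: hd; exact: le_lt_trans r1.
have := hN _ (leqnn N0); set Q := (2 ^ N0)%N => K.
have Q0 : (0 < Q)%N by rewrite expn_gt0.
have K2 : cmod (cavg Q (fun z => f z / z ^+ k) rho) <= B / rho ^+ k.
  apply: cavg_bound => // [z zr|]; last exact: ltW.
  rewrite cmodM cmodV cmodX zr ler_pM2r ?invr_gt0 ?exprn_gt0 // hB ?zr //.
  have := cRe_le z; have := cIm_le z; rewrite !ler_norml zr => /andP[a1 a2] /andP[b1 b2].
  by split=> /=; lra.
rewrite -ler_pdivlMr ?exprn_gt0 // mulrDl.
rewrite -[a k](subrK (cavg Q (fun z => f z / z ^+ k) rho)) (le_trans (cmodD _ _)) // addrC.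
by rewrite lerD // cmod_distC.
Qed.

(** The rescaling [t = r z]. The bound on the coefficients comes from convergence
    at one positive point. *)
Lemma g_Theta_data (theta : nat -> R) (r vartheta : R) (K : C R) : 0 < r ->
  g_Theta_in_F theta r vartheta K ->
  exists (g : C R -> C R) (R1 kappa d0 K0 d A : R),
    [/\ 1 < R1, 0 < kappa < 1, 0 < d0 & 0 < d < 1] /\
    [/\ forall z, indented R1 kappa z -> exists l, cderiv g z l,
        forall z, indented R1 kappa z -> cmod (z - 1) < d0 ->
          cmod (g z - (toC vartheta * clogV z + K)) <= K0 * cmod (z - 1),
        forall k, cmod (gcoef theta r k) * d ^+ k <= A &
        forall t, cmod t < d -> cconv (psum (gcoef theta r) t) (g t)].
Proof.
move=> r0 [g [/nbhs_cmodP[e e0 he] [rho [phi [rrho /andP[phi0 phi1] hol sing]]]]].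
have rn0 : toC r != 0 by rewrite -toC0 (inj_eq (@toC_inj R)) gt_eqF.
have cr : cmod (toC r) = r by rewrite cmod_toC_ge0 // ltW.
have phipi : phi < pi by have := pi_gt0 R; lra.
have subr z : toC r * z - toC r = toC r * (z - 1) by ring.
have Delta z : indented (rho / r) (cos phi) z -> Delta0 r rho phi (toC r * z).
  move=> hz; have z1 := indented_neq1 hz; case: hz => h1 h2.
  have q0 : 0 < cmod (z - 1) by rewrite cmod_gt0.
  have w0 : toC r * (z - 1) != 0 by rewrite mulf_neq0.
  split.
  - by rewrite cmodM cr mulrC -ltr_pdivlMr.
  - by rewrite -subr_eq0 subr.
  - rewrite subr norm_carg // cmodM cr cReM /= mul0r subr0 -mulf_div divff ?gt_eqF // mul1r.
    have hr := cRe_ratio z1.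
    have lt : cRe (z - 1) / cmod (z - 1) < cos phi by rewrite ltr_pdivrMr.
    rewrite -ltr_cos; first by rewrite acosK // in_itv.
      by rewrite in_itv /= (ltW phi0) ltW.
    by rewrite in_itv /= acos_ge0 // acos_lepi.
have [C0 [C00 hC]] : exists C0 : R, 0 < C0 /\ exists2 d0 : R, 0 < d0 &
    forall w, cmod (w - toC r) < d0 -> Delta0 r rho phi w ->
    cmod (g w - (toC vartheta * clog (1 / (1 - w / toC r)) + K)) <= C0 * cmod (w - toC r).
  move/eqO_exP: sing => [k /gt0_toC[C0 C00 ->]].
  rewrite near_withinE => /nbhs_cmodP[d0 d00 hd].
  exists C0; split => //; exists d0 => // w wd Dw.
  by have := hd w wd Dw; rewrite !normE -toCM le_toC.
have [d0 d00 hd0] := hC.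
pose gh z := g (toC r * z).
have ghol z : indented (rho / r) (cos phi) z -> exists l, cderiv gh z l.
  move=> /Delta /hol /derivable_cderiv[l hl].
  exists (l * (toC r * 1)); exact: cderiv_comp (cderivZ (toC r) (cderiv_id z)) hl.
have conv t : cmod t < e / r -> cconv (psum (gcoef theta r) t) (gh t).
  rewrite ltr_pdivlMr // => te.
  have := he (toC r * t); rewrite subr0 cmodM cr mulrC => /(_ te) /cconvP H.
  move=> e' /H[N hN]; exists N.+1 => -[//|n] Nn.
  by rewrite -g_partial_psum hN.
pose d := Num.min (1 / 2) (e / r / 2).
have er : 0 < e / r by rewrite divr_gt0.
have dp : 0 < d by rewrite lt_min; apply/andP; split; lra.
have d1 : d < 1 by rewrite gt_min; apply/orP; left; lra.
have der : d < e / r by rewrite gt_min; apply/orP; right; lra.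
have [A hA] : exists A : R, forall k, cmod (gcoef theta r k * toC d ^+ k) <= A.
  by apply: conv_terms_bounded (conv _ _); rewrite cmod_toC_ge0 // ltW.
exists gh, (rho / r), (cos phi), (d0 / r), (C0 * r), d, A; split; first split.
- by rewrite ltr_pdivlMr // mul1r.
- apply/andP; split.
    by apply: cos_gt0_pihalf; rewrite phi1 andbT; have := pi_gt0 R; lra.
  rewrite -[X in _ < X](cos0 R) ltr_cos // in_itv /= ?lexx ?pi_ge0 //.
  by rewrite (ltW phi0) ltW.
- by rewrite divr_gt0.
- by rewrite dp.
split=> //.
- move=> z hz; rewrite ltr_pdivlMr // => zd.
  have := hd0 (toC r * z); rewrite subr cmodM cr mulrC => /(_ zd (Delta _ hz)).
  have -> : toC r * z / toC r = z by field.
  by rewrite div1r -/(clogV z) (_ : C0 * (cmod (z - 1) * r) = C0 * r * cmod (z - 1)) //; ring.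
- by move=> k; have := hA k; rewrite cmodM cmodX cmod_toC_ge0 // ltW.
- by move=> t td; apply: conv; exact: lt_trans der.
Qed.

End Singularity.

Section Coefficients.
Variable R : realType.
Implicit Types (x y : R) (z v w u t : C R) (n : nat).

Lemma dcoef_gcoef (theta : nat -> R) (r : R) k :
  dcoef (gcoef theta r) k = toC (theta k.+1) * toC r ^+ k.+1.
Proof.
rewrite /dcoef /gcoef -toC_nat -toCX -!toCM; congr toC.
have k0 : k.+1%:R != 0 :> R by rewrite pnatr_eq0.
by rewrite mulrA mulrCA divff // mulr1.
Qed.

Lemma cconvD (u v : nat -> C R) l m : cconv u l -> cconv v m ->
  cconv (fun n => u n + v n) (l + m).
Proof.
move=> hu hv e e0; have e2 : 0 < e / 2 by rewrite divr_gt0.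
have [N hN] := hu _ e2; have [N' hN'] := hv _ e2.
exists (maxn N N') => n; rewrite geq_max => /andP[/hN H /hN' H'].
have -> : u n + v n - (l + m) = (u n - l) + (v n - m) by ring.
by rewrite (le_trans (cmodD _ _)) // (splitr e) lerD.
Qed.

Lemma cconvZ (c : C R) (u : nat -> C R) l : cconv u l -> cconv (fun n => c * u n) (c * l).
Proof.
move=> hu e e0; have c0 : 0 < cmod c + 1 by rewrite ltr_wpDl ?cmod_ge0.
have [N hN] := hu _ (divr_gt0 e0 c0); exists N => n /hN; rewrite ler_pdivlMr // => H.
rewrite -mulrBr cmodM mulrC (le_trans _ H) // ler_wpM2l ?cmod_ge0 // lerDl //.
Qed.

Lemma cconv_sum I (s : seq I) (P : pred I) (u : I -> nat -> C R) (l : I -> C R) :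
  (forall i, P i -> cconv (u i) (l i)) ->
  cconv (fun n => \sum_(i <- s | P i) u i n) (\sum_(i <- s | P i) l i).
Proof.
move=> h; elim: s => [|i s IH].
  by move=> e e0; exists 0%N => n _; rewrite !big_nil subrr cmod0 ltW.
have E n : \sum_(j <- i :: s | P j) u j n =
    (if P i then u i n else 0) + \sum_(j <- s | P j) u j n.
  by rewrite big_cons; case: ifP => // _; rewrite add0r.
have E' : \sum_(j <- i :: s | P j) l j =
    (if P i then l i else 0) + \sum_(j <- s | P j) l j.
  by rewrite big_cons; case: ifP => // _; rewrite add0r.
rewrite E' (_ : (fun n => _) = (fun n => (if P i then u i n else 0) + \sum_(j <- s | P j) u j n)).
  apply: cconvD => //; case: ifP => Pi; first exact: h.
  by move=> e e0; exists 0%N => n _; rewrite subrr cmod0 ltW.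
by apply/funext => n; exact: E.
Qed.

(** The [q n] are the coefficients of
    [exp (b0 g_Theta t + sum_i bs_i g_Theta (ys_i t))]. As [cmod (ys i) <= eta < 1],
    only the first summand is singular on the circle [cmod t = r]; both the
    numerator and the denominator of the expectation have this form. *)
Lemma coef_asymp (theta : nat -> R) (r vartheta : R) (K : C R) (I : Type) (s : seq I)
    (P : pred I) (b0 : C R) (bs ys : I -> C R) (eta : R) (q : nat -> C R) :
  0 < r -> g_Theta_in_F theta r vartheta K -> eta < 1 ->
  (forall i, P i -> cmod (ys i) <= eta) ->
  exp_rec (fun k => toC (theta k) * (b0 + \sum_(i <- s | P i) bs i * ys i ^+ k)) q ->
  exists B : R, exists N, forall n, (N <= n)%N -> (0 < n)%N ->
    cmod (q n * toC r ^+ n / cpow n%:R (toC vartheta * b0 - 1) -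
      cexp (b0 * K) * cexp (\sum_(i <- s | P i) bs i * g_Theta theta (toC r * ys i)) *
      rgamma (toC vartheta * b0)) <= B / n%:R.
Proof.
move=> r0 hg eta1 hy qa.
have [g [R1 [kappa [d0 [K0 [d [A [[R11 k01 d00 d01] [ghol gsing gA gconv]]]]]]]]] :=
  g_Theta_data r0 hg.
have [dp d1] := andP d01; have [k0 k1] := andP k01.
set gm := gcoef theta r in gA gconv.
have bound rho : 0 < rho < 1 -> exists B : R, forall k, cmod (gm k) * rho ^+ k <= B.
  move=> hrho; apply: (disc_coef_bound dp hrho gA gconv) => z z1; apply: ghol.
  exact: indented_disc.
pose Gs t := g_Theta theta (toC r * t).
have Gc t : cmod t < 1 -> cconv (psum gm t) (Gs t).
  move=> t1; pose rho := (cmod t + 1) / 2.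
  have t0 := cmod_ge0 t.
  have rho01 : 0 < rho < 1 by rewrite /rho; apply/andP; split; lra.
  have [rho0 rho1] := andP rho01.
  have [B hB] := bound rho rho01.
  have x0 : 0 <= cmod t / rho by rewrite divr_ge0 // ltW.
  have x1 : cmod t / rho < 1 by rewrite ltr_pdivrMr // mul1r /rho; lra.
  have [l hl] := psum_conv x0 x1 (fun k => coef_geo k rho0 hB (lexx (cmod t))).
  suff -> : Gs t = l by [].
  apply: cconv_lim => e /hl[N hN]; exists N => n Nn.
  by rewrite g_partial_psum hN // leqW.
pose Gp t := lim (psum (dcoef gm) t @ \oo).
have GpE t l : cconv (psum (dcoef gm) t) l -> Gp t = l by exact: cconv_lim.
have Gd t : cmod t < 1 -> cderiv Gs t (Gp t) /\ cconv (psum (dcoef gm) t) (Gp t).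
  move=> t1; pose rho := (cmod t + 1) / 2.
  have t0 := cmod_ge0 t.
  have rho01 : 0 < rho < 1 by rewrite /rho; apply/andP; split; lra.
  have [rho0 rho1] := andP rho01.
  have [B hB] := bound rho rho01.
  have Gr u : cmod u < rho -> cconv (psum gm u) (Gs u).
    by move=> ur; apply: Gc; exact: lt_trans rho1.
  have tr : cmod t < rho by rewrite /rho; lra.
  have [l cl dl] := psum_deriv rho0 hB Gr tr.
  by rewrite (GpE _ _ cl).
have gd t : cmod t < d -> cderiv g t (Gp t).
  move=> td; have [l cl dl] := psum_deriv dp gA gconv td.
  by rewrite (GpE _ _ cl).
pose eta1' := Num.max eta (1 / 2).
have e0 : 0 < eta1' by rewrite lt_max; apply/orP; right; lra.
have e1 : eta1' < 1 by rewrite gt_max eta1; lra.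
have hy' i : P i -> cmod (ys i) <= eta1' by move=> /hy h; rewrite le_max h.
pose rhoD := eta1'^-1.
have rhoD1 : 1 < rhoD by rewrite invf_gt1.
have inD i z : P i -> cmod z < rhoD -> cmod (ys i * z) < 1.
  move=> /hy' h hz; rewrite cmodM (le_lt_trans (ler_wpM2r (cmod_ge0 _) h)) //.
  by rewrite mulrC -ltr_pdivlMr // mul1r.
pose D z := \sum_(i <- s | P i) bs i * Gs (ys i * z).
pose D' z := \sum_(i <- s | P i) bs i * (Gp (ys i * z) * (ys i * 1)).
have dD z : cmod z < rhoD -> cderiv D z (D' z).
  move=> hz; apply: cderiv_sum => i Pi; apply: cderivZ.
  have [h _] := Gd _ (inD i z Pi hz).
  exact: cderiv_comp (cderivZ (ys i) (cderiv_id z)) h.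
pose b k := toC (theta k) * (b0 + \sum_(i <- s | P i) bs i * ys i ^+ k) * toC r ^+ k.
have bE k : b k.+1 = (b0 + \sum_(i <- s | P i) bs i * ys i ^+ k.+1) * dcoef gm k.
  by rewrite dcoef_gcoef /b; ring.
pose A' t := b0 * Gp t + D' t.
pose S := cmod b0 + \sum_(i <- s | P i) cmod (bs i).
have S0 : 0 <= S by rewrite addr_ge0 ?cmod_ge0 // sumr_ge0 // => i _; exact: cmod_ge0.
have d20 : 0 < d / 2 by rewrite divr_gt0.
have d2d : d / 2 < d by lra.
have d2D : d / 2 < rhoD by lra.
have bB k : (0 < k)%N -> cmod (b k) * (d / 2) ^+ k <= S * A.
  case: k => // k _; rewrite bE cmodM -mulrA ler_pM ?mulr_ge0 ?cmod_ge0 ?exprn_ge0 ?(ltW d20) //.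
    rewrite (le_trans (cmodD _ _)) // lerD2l (le_trans (cmod_sum _ _ _)) //.
    apply: ler_sum => i Pi; rewrite cmodM ler_piMr ?cmod_ge0 // cmodX exprn_ile1 ?cmod_ge0 //.
    by rewrite (le_trans (hy' i Pi)) // ltW.
  rewrite /dcoef cmodM cmod_nat expr_div_n.
  have -> : k.+1%:R * cmod (gm k.+1) * (d ^+ k.+1 / 2 ^+ k.+1) =
     (cmod (gm k.+1) * d ^+ k.+1) * (k.+1%:R / 2 ^+ k.+1) by ring.
  rewrite (le_trans _ (gA k.+1)) // ler_piMr ?mulr_ge0 ?cmod_ge0 ?exprn_ge0 ?(ltW dp) //.
  by rewrite ler_pdivrMr ?exprn_gt0 // mul1r -natrX ler_nat ltnW // ltn_expl.
have z0 (f : C R -> C R) : cconv (psum gm 0) (f 0) -> f 0 = 0.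
  move=> h; apply: (cconv_unique h) => e ep; exists 0%N => n _.
  rewrite (_ : psum gm 0 n = 0) ?subrr ?cmod0 ?ltW //.
  rewrite /psum big1 // => k _; case: (k : nat) => [|j]; last by rewrite expr0n mulr0.
  by rewrite /gm /gcoef invr0 mulr0 mul0r toC0 mul0r.
have F0 : b0 * g 0 + D 0 = 0.
  rewrite (z0 g) ?mulr0 ?add0r; last by apply: gconv; rewrite cmod0.
  rewrite /D big1 // => i _; rewrite mulr0 (z0 Gs) ?mulr0 //.
  by apply: Gc; rewrite cmod0.
have dF t : cmod t < d / 2 -> cderiv (fun z => b0 * g z + D z) t (A' t).
  move=> td; apply: cderivD; first by apply: cderivZ; apply: gd; exact: lt_trans d2d.
  by apply: dD; exact: lt_trans d2D.
have cF t : cmod t < d / 2 -> cconv (psum (fun k => b k.+1) t) (A' t).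
  move=> td.
  have -> : psum (fun k => b k.+1) t = (fun n => b0 * psum (dcoef gm) t n +
      \sum_(i <- s | P i) (bs i * ys i) * psum (dcoef gm) (ys i * t) n).
    apply/funext => n.
    have E2 : \sum_(i <- s | P i) (bs i * ys i) * psum (dcoef gm) (ys i * t) n =
        \sum_(k < n) \sum_(i <- s | P i) (bs i * ys i ^+ k.+1) * (dcoef gm k * t ^+ k).
      rewrite (eq_bigr (fun i => \sum_(k < n) (bs i * ys i ^+ k.+1) * (dcoef gm k * t ^+ k))).
        exact: exchange_big.
      move=> i _; rewrite /psum mulr_sumr; apply: eq_bigr => k _.
      by rewrite (exprMn _ (ys i)) exprS; ring.
    rewrite E2 /psum mulr_sumr -csum_split; apply: eq_bigr => k _.
    by rewrite bE -mulr_suml; ring.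
  have t1 : cmod t < 1 by rewrite (lt_trans td) // (lt_trans d2d).
  apply: cconvD; first by apply: cconvZ; case: (Gd _ t1).
  rewrite (_ : D' t = \sum_(i <- s | P i) bs i * ys i * Gp (ys i * t)).
    apply: cconv_sum => i Pi; apply: cconvZ.
    by have [] := Gd _ (inD i t Pi (lt_trans td d2D)).
  by apply: eq_bigr => i _; rewrite mulr1 mulrA mulrAC.
have [B [N H]] := exp_log_asymp R11 k01 d00 rhoD1 d20 ghol gsing
  (fun z hz => ex_intro _ _ (dD z hz)) (exp_rec_scale (toC r) qa) bB F0 dF cF.
exists B, N => n Nn n0; have := H n Nn n0.
rewrite (_ : D 1 = \sum_(i <- s | P i) bs i * g_Theta theta (toC r * ys i)) //.
by apply: eq_bigr => i _; rewrite mulr1.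
Qed.

(** ** The polynomial *)

Definition index_pairs (P : {poly {poly C R}}) : seq (nat * nat) :=
  [seq (k1, k2) | k1 <- iota 0 (size P), k2 <- iota 0 (size P`_k1)].

Lemma big_index_pairs (T : Type) (idx : T) (op : Monoid.law idx)
    (P : {poly {poly C R}}) (Q : pred (nat * nat)) (F : nat * nat -> T) :
  \big[op/idx]_(p <- index_pairs P | Q p) F p =
  \big[op/idx]_(k1 < size P)
    \big[op/idx]_(k2 < size P`_k1 | Q (k1 : nat, k2 : nat)) F (k1 : nat, k2 : nat).
Proof.
have io n (G : nat -> T) : \big[op/idx]_(i <- iota 0 n) G i = \big[op/idx]_(i < n) G i.
  by rewrite -(big_mkord xpredT G) /index_iota subn0.
rewrite big_mkcond big_allpairs_dep io; apply: eq_bigr => k1 _.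
by rewrite io [RHS]big_mkcond.
Qed.

Lemma bieval_sum (P : {poly {poly C R}}) z1 z2 :
  bieval P z1 z2 = \sum_(p <- index_pairs P) bicoef P p.1 p.2 * (z1 ^+ p.1 * z2 ^+ p.2).
Proof.
rewrite big_index_pairs /bieval (horner_coef P) horner_sum; apply: eq_bigr => k1 _.
rewrite hornerM -polyC_exp hornerC horner_coef mulr_suml; apply: eq_bigr => k2 _.
by rewrite /bicoef; ring.
Qed.

Lemma bieval_split (P : {poly {poly C R}}) z1 z2 :
  bieval P z1 z2 = bicoef P 0 0 +
    \sum_(p <- index_pairs P | p != (0, 0)%N) bicoef P p.1 p.2 * (z1 ^+ p.1 * z2 ^+ p.2).
Proof.
rewrite bieval_sum (bigID (fun p : nat * nat => p != (0, 0)%N)) addrC; congr (_ + _).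
rewrite (eq_bigl (pred1 (0, 0)%N)); last by move=> p; rewrite negbK.
have up : uniq (index_pairs P).
  by apply: allpairs_uniq_dep => [|k1 _|[? ?] [? ?] _ _ []]; rewrite ?iota_uniq // => -> ->.
rewrite -big_filter; have [h|h] := boolP ((0, 0)%N \in index_pairs P).
  by rewrite filter_pred1_uniq // big_seq1 !expr0 mulr1 mulr1.
rewrite big_filter big1_seq; last first.
  by move=> p /andP[/eqP -> pr]; rewrite pr in h.
apply/esym/eqP; apply: contraNT h => b0.
have s1 : (0 < size P)%N.
  by rewrite lt0n; apply: contraNneq b0 => s0; rewrite /bicoef [P`_0]nth_default ?s0 // coef0.
have s2 : (0 < size (P`_0)%R)%N.
  by rewrite lt0n; apply: contraNneq b0 => s0; rewrite /bicoef nth_default ?s0.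
by apply/allpairsPdep; exists 0%N, 0%N; rewrite !mem_iota.
Qed.

End Coefficients.

(** * The quotient of two coefficients *)

Section Quotient.
Variable R : realType.

Lemma cexp_sum I (s : seq I) (P : pred I) (F : I -> C R) :
  cexp (\sum_(i <- s | P i) F i) = \prod_(i <- s | P i) cexp (F i).
Proof. by apply: (big_morph _ (@cexpD R) (@cexp0 R)). Qed.

Lemma quotient_rate (u v : nat -> C R) (U V : C R) (B1 B2 : R) (N : nat) : V != 0 ->
  (forall n, (N <= n)%N -> (0 < n)%N -> cmod (u n - U) <= B1 / n%:R) ->
  (forall n, (N <= n)%N -> (0 < n)%N -> cmod (v n - V) <= B2 / n%:R) ->
  exists B : R, exists M, forall n, (M <= n)%N -> (0 < n)%N ->
    v n != 0 /\ cmod (u n / v n - U / V) <= B / n%:R.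
Proof.
move=> V0 hu hv; have Vp : 0 < cmod V by rewrite cmod_gt0.
pose N2 := Num.bound (`|B2| / (cmod V / 2)).
have V2 : 0 < cmod V / 2 by rewrite divr_gt0.
have hN2 : `|B2| / (cmod V / 2) < N2%:R := archi_boundP (divr_ge0 (normr_ge0 _) (ltW V2)).
pose c := cmod V / 2 * cmod V; have c0 : 0 < c by rewrite mulr_gt0.
exists ((`|B1| * cmod V + cmod U * `|B2|) / c), (maxn N N2) => n.
rewrite geq_max => /andP[Nn N2n] n0; have n0' : 0 < n%:R :> R by rewrite ltr0n.
have du : cmod (u n - U) <= `|B1| / n%:R.
  by rewrite (le_trans (hu n Nn n0)) // ler_wpM2r ?invr_ge0 ?(ltW n0') // ler_norm.
have dv : cmod (v n - V) <= `|B2| / n%:R.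
  by rewrite (le_trans (hv n Nn n0)) // ler_wpM2r ?invr_ge0 ?(ltW n0') // ler_norm.
have small : `|B2| / n%:R <= cmod V / 2.
  rewrite ler_pdivrMr // mulrC -ler_pdivrMr // (le_trans (ltW hN2)) // ler_nat //.
have vb : cmod V / 2 <= cmod (v n).
  have := cmodB V (V - v n); have -> : V - (V - v n) = v n by ring.
  by have := cmodD (V - v n) (v n); rewrite subrK [cmod (V - v n)]cmod_distC; lra.
have v0 : v n != 0 by rewrite -cmod_gt0 (lt_le_trans _ vb).
split=> //.
have -> : u n / v n - U / V = ((u n - U) * V - U * (v n - V)) / (v n * V).
  by field; rewrite v0 V0.
rewrite cmodM cmodV (cmodM (v n)).
have X : cmod ((u n - U) * V - U * (v n - V)) <= (`|B1| * cmod V + cmod U * `|B2|) / n%:R.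
  have -> : (`|B1| * cmod V + cmod U * `|B2|) / n%:R =
    `|B1| / n%:R * cmod V + cmod U * (`|B2| / n%:R) by ring.
  rewrite (le_trans (cmodB _ _)) // !cmodM lerD //.
    by rewrite ler_wpM2r ?cmod_ge0.
  by rewrite ler_wpM2l ?cmod_ge0.
rewrite mulrAC; apply: ler_pM => //; rewrite ?cmod_ge0 ?invr_ge0 ?mulr_ge0 ?cmod_ge0 //.
by rewrite lef_pV2 ?posrE ?mulr_gt0 ?ler_wpM2r ?cmod_ge0 // cmod_gt0.
Qed.

End Quotient.

Theorem theorem3p7 (R : realType) (theta : nat -> R)
    (htheta : forall k : nat, (0 < k)%N -> 0 < theta k)
    (P : {poly {poly C R}}) (x1 x2 : C R)
    (hx : Num.max (cmod x1) (cmod x2) < 1)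
    (r vartheta : R) (K : C R) (hr : 0 < r) (hvartheta : 0 < vartheta)
    (hg : g_Theta_in_F theta r vartheta K) :
  exists eps : nat -> C R,
    eps =O_\oo (fun N : nat => N%:R^-1 : C R) /\
    \forall N \near \oo,
      ewens_expect theta (@W R P x1 x2 N) =
      cpow N%:R (toC vartheta * (bicoef P 0 0 - 1)) *
      cexp (K * (bicoef P 0 0 - 1)) *
      (E1 theta r vartheta P x1 x2 + eps N).
Proof.
set b := bicoef P 0 0.
pose eta := Num.max (cmod x1) (cmod x2).
pose bs (p : nat * nat) := bicoef P p.1 p.2.
pose ys (p : nat * nat) := x1 ^+ p.1 * x2 ^+ p.2.
have hy p : p != (0, 0)%N -> cmod (ys p) <= eta.
  have b1 : cmod x1 <= eta by rewrite le_max lexx.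
  have b2 : cmod x2 <= eta by rewrite le_max lexx orbT.
  have c1 : cmod x1 <= 1 by rewrite (le_trans b1) // ltW.
  have c2 : cmod x2 <= 1 by rewrite (le_trans b2) // ltW.
  case: p => -[|k1] [|k2] // _; rewrite /ys cmodM !cmodX.
  - by rewrite expr0 mul1r (le_trans _ b2) // exprS ler_piMr ?cmod_ge0 // exprn_ile1 ?cmod_ge0.
  - by rewrite expr0 mulr1 (le_trans _ b1) // exprS ler_piMr ?cmod_ge0 // exprn_ile1 ?cmod_ge0.
  - rewrite (le_trans _ b1) // exprS -mulrA ler_piMr ?cmod_ge0 //.
    by rewrite mulr_ile1 ?exprn_ge0 ?exprn_ile1 ?cmod_ge0.
pose q n : C R := cycle_sum (fun k => toC (theta k) * bieval P (x1 ^+ k) (x2 ^+ k)) n / n`!%:R.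
pose h n : C R := cycle_sum (fun k => toC (theta k)) n / n`!%:R.
have qrec : exp_rec (fun k => toC (theta k) *
    (b + \sum_(p <- index_pairs P | p != (0, 0)%N) bs p * ys p ^+ k)) q.
  rewrite (_ : (fun k => _) = (fun k => toC (theta k) * bieval P (x1 ^+ k) (x2 ^+ k))).
    exact: cycle_sum_exp_rec.
  apply/funext => k; rewrite bieval_split; congr (_ * (_ + _)).
  by apply: eq_bigr => p _; rewrite /ys exprMn -!exprM ![(k * _)%N]mulnC.
have hrec : exp_rec (fun k => toC (theta k) *
    (1 + \sum_(p <- [::] | p != (0, 0)%N) bs p * ys p ^+ k)) h.
  rewrite (_ : (fun k => _) = (fun k => toC (theta k))).
    exact: cycle_sum_exp_rec.
  by apply/funext => k; rewrite big_nil addr0 mulr1.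
have [B1 [N1 H1]] := coef_asymp hr hg hx hy qrec.
have [B2 [N2 H2]] := coef_asymp hr hg hx hy hrec.
rewrite big_nil cexp0 mulr1 mul1r in H2.
set U := _ * _ * rgamma _ in H1; pose V := cexp K * rgamma (toC vartheta).
rewrite mulr1 -/V in H2.
pose u n := q n * toC r ^+ n / cpow n%:R (toC vartheta * b - 1).
pose v n := h n * toC r ^+ n / cpow n%:R (toC vartheta - 1).
have V0 : V != 0 by rewrite mulf_neq0 ?cexp_neq0 ?rgamma_neq0.
have [B [N HB]] := @quotient_rate R u v U V B1 B2 (maxn N1 N2) V0
  (fun n Nn => H1 n (leq_trans (leq_maxl _ _) Nn)) (fun n Nn => H2 n (leq_trans (leq_maxr _ _) Nn)).
have rn0 n : toC r ^+ n != 0 by rewrite expf_neq0 // -toC0 (inj_eq (@toC_inj R)) gt_eqF.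
pose cK := cexp (K * (b - 1)).
have cK0 : cK != 0 by exact: cexp_neq0.
have E1E : U / V = cK * E1 theta r vartheta P x1 x2.
  have -> : E1 theta r vartheta P x1 x2 = (rgamma (toC vartheta))^-1 * rgamma (toC vartheta * b) *
     cexp (\sum_(p <- index_pairs P | p != (0, 0)%N) bs p * g_Theta theta (toC r * ys p)).
    rewrite /E1 /cgamma -/b cexp_sum; congr (_ * _).
    rewrite big_index_pairs; apply: eq_bigr => k1 _; apply: eq_bigr => k2 _.
    by rewrite /G_Theta_pow /bs /ys mulrA.
  have -> : cK = cexp (b * K) / cexp K by rewrite -cexpB /cK; congr cexp; ring.
  rewrite /U /V; field; by rewrite cexp_neq0 rgamma_neq0.
pose eps n := cK^-1 * (ewens_expect theta (@W R P x1 x2 n) / cpow n%:R (toC vartheta * (b - 1))) -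
  E1 theta r vartheta P x1 x2.
exists eps; split; last first.
  exists 0%N => // n _; rewrite /= -/cK /eps.
  rewrite [E1 _ _ _ _ _ _ + _]addrC subrK.
  move: (cpow_neq0 n%:R (toC vartheta * (b - 1))) => c0.
  by rewrite -mulrA mulVKf // mulrC divfK.
have epsE n : v n != 0 -> eps n = cK^-1 * (u n / v n - U / V).
  move=> vn0; have hn0 : h n != 0.
    by apply: contraNneq vn0 => h0; rewrite /v h0 !mul0r.
  rewrite E1E /eps ewens_expect_cycle_sum -/(q n) -/(h n) [RHS]mulrBr mulKf //.
  congr (_ * _ - _).
  have -> : toC vartheta * (b - 1) = (toC vartheta * b - 1) - (toC vartheta - 1) by ring.
  rewrite cpowB /u /v.
  move: (cpow_neq0 n%:R (toC vartheta * b - 1)) (cpow_neq0 n%:R (toC vartheta - 1)).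
  move: (cpow n%:R (toC vartheta * b - 1)) (cpow n%:R (toC vartheta - 1)) => c1 c2 c10 c20.
  move: (q n) (h n) hn0 (rn0 n) => qn hn hn0; move: (toC r ^+ n) => rn rn_neq0.
  by field; rewrite hn0 c10 c20 rn_neq0.
apply/eqO_exP; pose k := cmod cK^-1 * `|B| + 1.
have k0 : 0 < k by rewrite ltr_wpDl // mulr_ge0 ?cmod_ge0.
exists (toC k); first by rewrite -toC0 lt_toC.
exists (maxn N 1) => // n; rewrite /= geq_max => /andP[Nn n0].
have [vn0 Hn] := HB n Nn n0.
have n0' : 0 < n%:R :> R by rewrite ltr0n.
have cn : cmod (n%:R^-1 : C R) = n%:R^-1 by rewrite cmodV cmod_nat.
rewrite !normE -toCM le_toC epsE // cmodM cn.
rewrite (le_trans (ler_wpM2l _ Hn)) ?cmod_ge0 // ?invr_ge0 ?cmod_ge0 //.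
rewrite mulrA ler_wpM2r ?invr_ge0 ?(ltW n0') // /k.
rewrite (le_trans (y := cmod cK^-1 * `|B|)) ?lerDl //.
by rewrite ler_wpM2l ?cmod_ge0 // ler_norm.
Qed.
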